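(* Let $d\ge1$, $\alpha\in\mathbb{R}\setminus\{0,1\}$ and let $\phi$ be almost homogeneous of order $\alpha$ on $\mathbb{R}^d$. For $\varepsilon>0$, $\kappa\in\mathbb{R}$ and $(x,t)\in\mathbb{R}^d\times\mathbb{R}$ define, if $\alpha>0$, $$\mathcal I^{\phi,+}_{\varepsilon,\kappa}(x,t)=\int_{\mathbb{R}^d}e^{i(x\cdot\xi+t\phi(\xi))}\,\chi(\varepsilon|\xi|)\,|\det H\phi(\xi)|^{\frac12+i\kappa}\,d\xi,$$ and, if $\alpha<0$, $$\mathcal I^{\phi,-}_{\varepsilon,\kappa}(x,t)=\int_{\mathbb{R}^d}e^{i(x\cdot\xi+t\phi(\xi))}\,\chi_\infty(\varepsilon^{-1}|\xi|)\,|\det H\phi(\xi)|^{\frac12+i\kappa}\,d\xi.$$ Then there exist $C<\infty$ and $N>0$ such that $$|\mathcal I^{\phi,\pm}_{\varepsilon,\kappa}(x,t)|\le C(1+|\kappa|)^N|t|^{-d/2},\qquad \pm\alpha>0,$$ for all $\varepsilon>0$, $\kappa\in\mathbb{R}$ and $(x,t)\in\mathbb{R}^d\times\mathbb{R}$.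
   Context: $\chi$ is a fixed function in $C_c^\infty(-1,1)$ with $\chi=1$ on $(-\frac12,\frac12)$, and $\chi_\infty=1-\chi$. $H\phi(\xi)=(\partial_i\partial_j\phi(\xi))_{1\le i,j\le d}$ is the Hessian matrix. For $\alpha\in\mathbb{R}\setminus\{0,1\}$, a real-valued function $\phi\in C^{d+2}(\mathbb{R}^d\setminus\{0\})$ is called almost homogeneous of order $\alpha$ if there are positive constants $d_1,d_2,\lambda,B$ such that for all $\xi\in\mathbb{R}^d\setminus\{0\}$: $$d_1|\xi|^{\alpha-1}\le|\nabla\phi(\xi)|\le d_2|\xi|^{\alpha-1};$$ $$|\partial^\gamma\phi(\xi)|\le B|\xi|^{\alpha-|\gamma|}\quad\text{for all multi-indices }|\gamma|\le d+2;$$ $$\lambda|\xi|^{\alpha-2}\le|v^{\mathrm t}H\phi(\xi)v|\quad\text{for all }v\in\mathbb{S}^{d-1}.$$ The constants $C,N$ are independent of $\varepsilon,\kappa,x,t$. For $t=0$ the right-hand side is interpreted as $+\infty$. *)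

(* Defs.v *)
From HB Require Import structures.
From mathcomp Require Import all_boot all_order all_algebra.
From mathcomp Require Import all_classical all_reals all_analysis.
From mathcomp Require Import complex.

Set Implicit Arguments.
Unset Strict Implicit.
Unset Printing Implicit Defensive.
Import Order.TTheory GRing.Theory Num.Theory.
Import numFieldNormedType.Exports.

Local Open Scope classical_set_scope.
Local Open Scope ring_scope.
Local Open Scope complex_scope.

Section lebesgue_tuple.
Context {R : realType}.
Local Notation mR := (measurableTypeR R).
Local Open Scope ereal_scope.

Definition cons_pair n (p : mR * n.-tuple mR) : n.+1.-tuple mR :=
  [tuple of p.1 :: p.2].

(* Lebesgue measure on R^n, as the n-fold product of the Lebesgue measure of
   the line, on n-tuples with the sigma-algebra generated by the coordinates. *)
Fixpoint lebesgue_tuple n : set (n.-tuple mR) -> \bar R :=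
  match n with
  | 0 => dirac [tuple]
  | n'.+1 => pushforward (lebesgue_measure \x @lebesgue_tuple n') (@cons_pair n')
  end.

Lemma measurable_cons_pair n : measurable_fun setT (@cons_pair n).
Proof. exact: measurable_cons. Qed.

Lemma preimage_cons_pair n (A : set (n.+1.-tuple mR)) :
  measurable A -> measurable (@cons_pair n @^-1` A).
Proof. by move=> mA; rewrite -[X in measurable X]setTI; exact: measurable_cons_pair. Qed.

Definition pair_cons n (x : n.+1.-tuple mR) : mR * n.-tuple mR :=
  (thead x, [tuple of behead x]).

Lemma measurable_pair_cons n : measurable_fun setT (@pair_cons n).
Proof.
apply/measurable_fun_pairP; split; last exact: measurable_behead.
exact: measurable_tnth.
Qed.

Lemma pair_consK n : cancel (@pair_cons n) (@cons_pair n).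
Proof. by move=> x; rewrite [RHS](tuple_eta x); apply: val_inj. Qed.

Lemma cons_pairK n : cancel (@cons_pair n) (@pair_cons n).
Proof. by move=> [x t]; congr pair; apply: val_inj. Qed.

Section step.
Variables (n : nat) (m : {sigma_finite_measure set (n.-tuple mR) -> \bar R}).

Definition lebesgue_cons : set (n.+1.-tuple mR) -> \bar R :=
  pushforward (lebesgue_measure \x m) (@cons_pair n).

Local Notation q := lebesgue_cons.

Let q0 : q set0 = 0.
Proof. by rewrite /lebesgue_cons /pushforward preimage_set0 measure0. Qed.

Let q_ge0 A : 0 <= q A.
Proof. by apply: integral_ge0 => x _; exact: measure_ge0. Qed.

Let q_sigma_additive : semi_sigma_additive q.
Proof.
move=> F mF tF mUF; rewrite /lebesgue_cons /pushforward preimage_bigcup.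
apply: measure_semi_sigma_additive.
- by move=> k; exact: preimage_cons_pair.
- apply/trivIsetP => i j _ _ ij; rewrite -preimage_setI.
  by move/trivIsetP : tF => /(_ _ _ _ _ ij) ->//; rewrite preimage_set0.
- by rewrite -preimage_bigcup; exact: preimage_cons_pair.
Qed.

HB.instance Definition _ := isMeasure.Build _ _ _ q q0 q_ge0 q_sigma_additive.

Let q_sigma_finite : sigma_finite setT q.
Proof.
have /sigma_finiteP[F [TF ndF Foo]] := sigma_finiteT (@lebesgue_measure R).
have /sigma_finiteP[G [TG ndG Goo]] := sigma_finiteT m.
exists (fun k => @pair_cons n @^-1` (F k `*` G k)).
  rewrite -preimage_bigcup -[LHS](preimage_setT (@pair_cons n)).
  congr (_ @^-1` _); rewrite -setXTT TF TG predeqE => -[x y]; split.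
    move=> [/= [k _ Fkx] [l _ Gly]]; exists (maxn k l) => //; split.
    - by move: x Fkx; exact/subsetPset/ndF/leq_maxl.
    - by move: y Gly; exact/subsetPset/ndG/leq_maxr.
  by move=> [k _ []/= ? ?]; split; exists k.
move=> k; have [mF Fkoo] := Foo k; have [mG Gkoo] := Goo k; split.
  rewrite -[X in measurable X]setTI; apply: measurable_pair_cons => //.
  exact: measurableX.
rewrite /lebesgue_cons /pushforward -comp_preimage.
rewrite (_ : _ \o _ = id) ?preimage_id; last first.
  by apply/funext => x; exact: cons_pairK.
by rewrite product_measure1E// lte_mul_pinfty// ge0_fin_numE.
Qed.

HB.instance Definition _ :=
  @Measure_isSigmaFinite.Build _ _ _ q q_sigma_finite.

End step.

Lemma lebesgue_tuple_sigma_finite_measure n :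
  exists m : {sigma_finite_measure set (n.-tuple mR) -> \bar R},
    m = @lebesgue_tuple n :> (set (n.-tuple mR) -> \bar R).
Proof.
elim: n => [|n [m mE]]; first by exists (dirac [tuple]).
by exists (lebesgue_cons m); rewrite /= -mE.
Qed.

Section instances.
Variable n : nat.

Let mu0 : @lebesgue_tuple n set0 = 0.
Proof. by have [m <-] := lebesgue_tuple_sigma_finite_measure n. Qed.

Let mu_ge0 A : 0 <= @lebesgue_tuple n A.
Proof. by have [m <-] := lebesgue_tuple_sigma_finite_measure n. Qed.

Let mu_sigma_additive : semi_sigma_additive (@lebesgue_tuple n).
Proof.
have [m <-] := lebesgue_tuple_sigma_finite_measure n.
exact: measure_semi_sigma_additive.
Qed.

HB.instance Definition _ :=
  isMeasure.Build _ _ _ (@lebesgue_tuple n) mu0 mu_ge0 mu_sigma_additive.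

Let mu_sigma_finite : sigma_finite setT (@lebesgue_tuple n).
Proof.
have [m <-] := lebesgue_tuple_sigma_finite_measure n.
exact: sigma_finiteT.
Qed.

HB.instance Definition _ :=
  @Measure_isSigmaFinite.Build _ _ _ (@lebesgue_tuple n) mu_sigma_finite.

End instances.

Lemma lebesgue_tuple_box n (A : 'I_n -> set mR) :
  (forall i, measurable (A i)) ->
  @lebesgue_tuple n [set x | forall i, A i (tnth x i)] =
  \prod_(i < n) lebesgue_measure (A i).
Proof.
elim: n A => [|n IH] A mA.
  rewrite big_ord0 /= diracE mem_set//.
  by move=> [].
rewrite big_ord_recl -IH//= /pushforward.
rewrite -product_measure1E//.
  congr (_ _); apply/seteqP; split => [[x t] /= H|[x t] /= [Hx Ht] i].
    split=> [|i]; first by have := H ord0.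
    by have := H (lift ord0 i); rewrite tnthS.
  by case: (unliftP ord0 i) => [j|] ->; rewrite ?tnthS// tnth0.
rewrite (_ : [set _ | _] =
  \big[setI/setT]_(i < n) ((@tnth n mR)^~ i @^-1` A (lift ord0 i))).
  apply: bigsetI_measurable => i _; rewrite -[X in measurable X]setTI.
  exact: measurable_tnth.
rewrite -bigcap_seq; apply/seteqP; split => x /= H i; first by move=> _; exact: H.
by apply: H; rewrite /= mem_index_enum.
Qed.

End lebesgue_tuple.
Arguments lebesgue_tuple : clear implicits.

Section calculus.
Context {R : realType} {d : nat}.
Implicit Types (f : 'rV[R]_d -> R) (x xi : 'rV[R]_d).

Definition dotv x xi : R := \sum_(i < d) x ord0 i * xi ord0 i.

(* The library norm `|x| on row vectors is the sup norm. *)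
Definition enorm x : R := Num.sqrt (\sum_(i < d) x ord0 i ^+ 2).

Definition partial (i : 'I_d) f : 'rV[R]_d -> R :=
  fun xi => 'D_(delta_mx ord0 i) f xi.

Definition iter_partial (s : seq 'I_d) f : 'rV[R]_d -> R := foldr partial f s.

Definition mderiv (gamma : {ffun 'I_d -> nat}) f : 'rV[R]_d -> R :=
  foldr (fun i => iter (gamma i) (partial i)) f (enum 'I_d).

Definition mlen (gamma : {ffun 'I_d -> nat}) : nat := (\sum_(i < d) gamma i)%N.

(* f is of class C^k on the open set U: its iterated partial derivatives up
   to order k, in every order of differentiation, exist and are continuous. *)
Definition class_C (k : nat) (U : set 'rV[R]_d) f : Prop :=
  forall s : seq 'I_d, forall xi, U xi ->
    ((size s <= k)%N -> {for xi, continuous (iter_partial s f)}) /\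
    ((size s < k)%N ->
       forall i, derivable (iter_partial s f) xi (delta_mx ord0 i)).

Definition gradient f xi : 'rV[R]_d := \row_i partial i f xi.

Definition hessian f xi : 'M[R]_d := \matrix_(i, j) partial i (partial j f) xi.

(* The values of f at the origin are irrelevant: f stands for a function on
   R^d minus the origin. *)
Definition almost_homogeneous (alpha : R) f : Prop :=
  class_C d.+2 [set xi | xi != 0] f /\
  exists d1 d2 lambda B : R,
    [/\ 0 < d1, 0 < d2, 0 < lambda & 0 < B] /\
    forall xi, xi != 0 ->
    [/\ d1 * enorm xi `^ (alpha - 1) <= enorm (gradient f xi)
          <= d2 * enorm xi `^ (alpha - 1),
        forall gamma : {ffun 'I_d -> nat}, (mlen gamma <= d.+2)%N ->
          `|mderiv gamma f xi| <= B * enorm xi `^ (alpha - (mlen gamma)%:R) &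
        forall v : 'rV[R]_d, enorm v = 1 ->
          lambda * enorm xi `^ (alpha - 2) <=
          `|(v *m hessian f xi *m v^T) ord0 ord0| ].

End calculus.

Section oscillatory_integrals.
Context {R : realType}.

Definition cexp (z : R[i]) : R[i] :=
  (expR (complex.Re z) * cos (complex.Im z)) +i*
  (expR (complex.Re z) * sin (complex.Im z)).

(* a to the power z, for a > 0 *)
Definition cpowR (a : R) (z : R[i]) : R[i] := cexp (z * (ln a)%:C).

Definition Cintegral (d : nat) (f : 'rV[R]_d -> R[i]) : R[i] :=
  (\int[lebesgue_tuple R d]_u complex.Re (f (\row_i tnth u i))) +i*
  (\int[lebesgue_tuple R d]_u complex.Im (f (\row_i tnth u i))).

Definition smooth (f : R -> R) : Prop := forall n s, derivable (derive1n n f) s 1.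

(* C_c^oo(-1,1), complex valued, each function being extended by zero to R *)
Definition test_function (f : R -> R[i]) : Prop :=
  let supp := closure [set s | f s != 0] in
  [/\ smooth (fun s => complex.Re (f s)), smooth (fun s => complex.Im (f s)),
      compact supp & supp `<=` `]-1, 1[].

Definition cutoff (chi : R -> R[i]) : Prop :=
  test_function chi /\ forall s, - 2^-1 < s < 2^-1 -> chi s = 1.

Definition chi_infty (chi : R -> R[i]) (s : R) : R[i] := 1 - chi s.

Context {d : nat}.
Implicit Types (phi : 'rV[R]_d -> R) (x xi : 'rV[R]_d) (chi : R -> R[i]).

Definition I_plus chi phi (eps kappa : R) x (t : R) : R[i] :=
  Cintegral (fun xi => cexp (0 +i* (dotv x xi + t * phi xi)) *
    chi (eps * enorm xi) *
    cpowR `|\det (hessian phi xi)| (2^-1 +i* kappa)).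

Definition I_minus chi phi (eps kappa : R) x (t : R) : R[i] :=
  Cintegral (fun xi => cexp (0 +i* (dotv x xi + t * phi xi)) *
    chi_infty chi (eps^-1 * enorm xi) *
    cpowR `|\det (hessian phi xi)| (2^-1 +i* kappa)).

End oscillatory_integrals.

(* Main.v *)
From HB Require Import structures.
Require Import Defs.
From mathcomp Require Import all_boot all_order all_algebra.
From mathcomp Require Import all_classical all_reals all_analysis.
From mathcomp Require Import complex measurable_realfun.
From mathcomp Require Import ring lra zify perm.

(** Write [psi xi = x . xi + t * phi xi] for the phase and put
      [S = 1 + |t| * |xi|^alpha + |x| * |xi|],  [h = |xi|^2 / S],
      [w = 1 + h * |grad psi|^2].
    The operator [L = 1 - i * h * grad psi . grad] satisfies
    [L (exp (i * psi)) = w * exp (i * psi)], so each integration by parts divides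
    the amplitude by [w], and replaces derivatives of size [|xi|^-1] by
    derivatives of size [(1 + |kappa|) * |xi|^-1 * (S / w)^(1/2)].  This
    loss is exactly compensated by the vector field [h * grad psi], which is of size
    [|xi| * (w / S)^(1/2)], so nothing but [1 + |kappa|] is lost.  The amplitude
    is of size [|xi|^((alpha-2)d/2)], because the Hessian determinant is of size
    [|xi|^((alpha-2)d)]; as [phi] has [d + 2] derivatives and the amplitude uses two,
    there is room for [d] integrations by parts ([osc_integral_bound]), and the
    oscillatory integral is at most a constant times
      [(1 + |kappa|)^d * \int |xi|^((alpha-2)d/2) * w^(-d) d xi].

    It remains to see that the last integral is at most a constant times
    [|t|^(-d/2)] ([weight_integral_bound]).  Cover the punctured space by boxes of
    size [r = 2^k] at distance of order [r] from the origin, each of them convex, and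
    put [s = |t| * r^alpha], [y = |x| * r].  For [s <= 1] one uses only [w >= 1].  For
    [s >= 1], unless [y] is comparable to [s], one of the two terms of
    [grad psi = x + t * grad phi] dominates, and [w] is of size at least [s].  If [y]
    is comparable to [s], the lower bound for the Hessian form along segments shows that
    [|grad psi|] grows at least linearly with the distance from its minimiser on the
    box, so [w] is bounded below as near a nondegenerate stationary point and
    the integral of [w^(-d)] is at most that of a product of [d] Cauchy profiles.  The
    contributions of the boxes sum to a multiple of [|t|^(-d/2)]: [s^(d/2)] runs
    through a geometric progression since [alpha != 0], and [y / s] is of size
    one for boundedly many [k] only since [alpha != 1].

    The integrations by parts are done with additional smooth truncations near the
    origin and near infinity, with bounds that do not depend on these.  Where
    the cutoff [chi] or [1 - chi] does not vanish, [|xi|^alpha] is bounded, so the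
    amplitude is dominated by the weight for [x = 0] and [t = 1], which is integrable
    by the estimate just described; hence the truncations are removed by dominated
    convergence ([cutoff_bound]). *)

Set Implicit Arguments.
Unset Strict Implicit.
Unset Printing Implicit Defensive.
Import Order.TTheory GRing.Theory Num.Theory.
Import numFieldNormedType.Exports.
Local Open Scope classical_set_scope.
Local Open Scope ring_scope.

(** * Directional derivatives *)

Section directional.
Context {R : realType} {d : nat}.
Implicit Types (f g : 'rV[R]_d -> R) (a v xi : 'rV[R]_d).

Lemma is_deriveP f a v l : is_derive a v f l <->
  (fun h : R => h^-1 * (f (h *: v + a) - f a)) @ 0^' --> l.
Proof.
split=> [[df <-]|fl]; first exact: df.
split; first by apply/cvg_ex; exists l.
exact: cvg_lim.
Qed.

Lemma is_derive_line f a v (s l : R) : is_derive (s *: v + a) v f l ->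
  is_derive s 1 (fun h : R => f (h *: v + a)) l.
Proof.
move=> /is_deriveP fl.
have E : (fun h : R => h^-1 *: ((fun h : R => f (h *: v + a)) (h *: 1 + s) -
    (fun h : R => f (h *: v + a)) s)) =
  (fun h => h^-1 * (f (h *: v + (s *: v + a)) - f (s *: v + a))).
  by apply/funext => h /=; rewrite /GRing.scale/= mulr1 -!/(GRing.scale _ _) scalerDl addrA.
split; first by apply/cvg_ex; exists l; rewrite E.
by rewrite /derive E; exact: cvg_lim.
Qed.

Lemma is_derive_lineP f a v (l : R) : is_derive a v f l <->
  is_derive (0:R) 1 (fun h : R => f (h *: v + a)) l.
Proof.
split=> [fl|[df dl]].
  by apply: is_derive_line; rewrite scale0r add0r.
apply/is_deriveP; move: df dl; rewrite /derivable /derive /=.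
under eq_fun do rewrite scale0r add0r addr0 /GRing.scale/= mulr1.
by move=> df <-.
Qed.

(** Restricted to a line this is the chain rule in one variable; in this form it
    applies to functions known through their partial derivatives only. *)
Lemma is_derive_rcomp (g : R -> R) f a v (df dg : R) :
  is_derive a v f df -> is_derive (f a) 1 g dg ->
  is_derive a v (fun xi => g (f xi)) (dg * df).
Proof.
move=> /is_derive_lineP fl gl; apply/is_derive_lineP.
have := @is_derive1_comp R g (fun h : R => f (h *: v + a)) 0 dg df.
rewrite /= scale0r add0r => /(_ gl fl) H.
by have -> : dg * df = (dg *: df : R) by [].
Qed.

Lemma near_delta f a : {for a, continuous f} -> forall e : R, 0 < e ->
  exists2 dl : R, 0 < dl & forall xi, `|xi - a| < dl -> `|f xi - f a| < e.
Proof.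
move=> fc e e0.
have /cvgrPdist_lt/(_ e e0) := fc.
move=> /nbhs_ballP[dl /= dl0 H]; exists dl => // xi xia.
by rewrite distrC; apply: H; rewrite -ball_normE /= distrC.
Qed.

(** Both signs of [r] occur as increments in difference quotients. *)
Lemma MVT0 (F F' : R -> R) (r : R) :
  (forall s : R, `|s| <= `|r| -> is_derive s 1 F (F' s)) ->
  exists2 th, `|th| <= `|r| & F r - F 0 = F' th * r.
Proof.
move=> dF; have [r0|r0] := leP 0 r.
  have [||c /=] := @MVT_segment R F F' 0 r r0.
  - move=> s; rewrite in_itv/= => /andP[s0 sr].
    by apply: dF; rewrite !ger0_norm//; exact: ltW.
  - apply: derivable_within_continuous => s; rewrite in_itv/= => /andP[s0 sr].
    by have [] := dF s _; rewrite ?ger0_norm.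
  rewrite in_itv/= => /andP[c0 cr] ->; exists c; first by rewrite !ger0_norm.
  by rewrite subr0.
have [||c /=] := @MVT_segment R F F' r 0 (ltW r0).
- move=> s; rewrite in_itv/= => /andP[s0 sr].
  by apply: dF; rewrite !ltr0_norm// lerN2; exact: ltW.
- apply: derivable_within_continuous => s; rewrite in_itv/= => /andP[s0 sr].
  by have [] := dF s _; rewrite ?ler0_norm ?lerN2//; exact: ltW.
rewrite in_itv/= => /andP[c0 cr] E; exists c; last by rewrite -opprB E; ring.
by rewrite !ler0_norm ?lerN2//; exact: ltW.
Qed.

(** The increment is a step along [v] followed by a step along [w]; the mean value
    theorem evaluates [g] at a point near [a] for the second step, whence the
    continuity of [g]. *)
Lemma is_derive_add_dir f g a v w (l c : R) :
  (\forall b \near a, is_derive b w f (g b)) -> {for a, continuous g} ->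
  is_derive a v f l -> is_derive a (v + c *: w) f (l + c * g a).
Proof.
move=> dg gc /is_deriveP fv; apply/is_deriveP.
have -> : (fun h : R => h^-1 * (f (h *: (v + c *: w) + a) - f a)) =
  (fun h => h^-1 * (f (h *: v + a) - f a)) \+
  (fun h => h^-1 * (f ((h * c) *: w + (h *: v + a)) - f (h *: v + a))).
  apply/funext => h /=; rewrite -mulrDr; congr (_ * _).
  rewrite scalerDr scalerA -addrA [_ + (_ + a)]addrCA; ring.
apply: cvgD => //; apply/cvgrPdist_lt => e e0.
move/nbhs_ballP : dg => [d1 /= d10 dg].
have e1 : 0 < e / (`|c| + 1) by rewrite divr_gt0// ltr_wpDl.
have [d2 d20 gd] := near_delta gc e1.
set K := `|v| + `|c| * `|w| + 1.
have K0 : 0 < K by rewrite /K ltr_wpDl// addr_ge0// mulr_ge0.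
exists (Num.min d1 d2 / K) => /=; first by rewrite divr_gt0// lt_min d10.
move=> h /=; rewrite sub0r normrN ltr_pdivlMr// => hd h0.
have hK s : `|s| <= `|h * c| -> `|s *: w + (h *: v + a) - a| < Num.min d1 d2.
  move=> sh; apply: le_lt_trans hd.
  rewrite addrA addrK /K (le_trans (ler_normD _ _))// !normrZ.
  rewrite normrM in sh.
  have := ler_wpM2r (normr_ge0 w) sh; have := normr_ge0 h.
  by rewrite !mulrDr mulr1 mulrA; lra.
have [|th th1] := @MVT0 (fun s : R => f (s *: w + (h *: v + a)))
   (fun s => g (s *: w + (h *: v + a))) (h * c).
  move=> s sh; apply: is_derive_line; apply: dg.
  rewrite -ball_normE /= distrC; apply: lt_le_trans (hK s sh) _.
  by rewrite ge_min lexx.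
rewrite /= scale0r add0r => ->.
rewrite [h * c]mulrC [_ * (c * h)]mulrA [h^-1 * _]mulrC mulfK//.
rewrite mulrC -mulrBl normrM.
have /gd : `|th *: w + (h *: v + a) - a| < d2.
  by apply: lt_le_trans (hK th th1) _; rewrite ge_min lexx orbT.
rewrite distrC ltr_pdivlMr ?ltr_wpDl// => H; apply: le_lt_trans H.
by rewrite ler_wpM2l// lerDl.
Qed.

Local Notation e_ i := (delta_mx ord0 i : 'rV[R]_d).

(** The coordinates are changed one at a time. *)
Lemma is_derive_dir f (g : 'I_d -> 'rV[R]_d -> R) a v :
  (forall i, \forall b \near a, is_derive b (e_ i) f (g i b)) ->
  (forall i, {for a, continuous (g i)}) ->
  is_derive a v f (\sum_i v ord0 i * g i a).
Proof.
move=> dg gc.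
have -> : v = \sum_i v ord0 i *: e_ i by exact: row_sum_delta.
have -> : \sum_i (\sum_i v ord0 i *: e_ i) ord0 i * g i a =
   \sum_i v ord0 i * g i a.
  by apply: eq_bigr => i _; rewrite -row_sum_delta.
elim: (index_enum _) => [|i s IH].
  by rewrite !big_nil; exact: is_derive0.
rewrite !big_cons addrC [_ + \sum_(j <- s) _ * _]addrC.
exact: is_derive_add_dir.
Qed.

(** Schwarz's theorem: both mixed derivatives are limits of the same second
    difference quotient. *)
Lemma mixed_derivative_symmetric f fi fj fij fji a v w :
  (\forall b \near a, [/\ is_derive b v f (fi b), is_derive b w f (fj b),
     is_derive b w fi (fji b) & is_derive b v fj (fij b)]) ->
  {for a, continuous fij} -> {for a, continuous fji} -> fij a = fji a.
Proof.
move=> /nbhs_ballP[d1 /= d10 dD] cij cji.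
apply/eqP; rewrite -subr_eq0 -normr_le0; apply/ler_addgt0Pr => e e0.
rewrite add0r.
have e2 : 0 < e / 2 by rewrite divr_gt0.
have [d2 d20 H2] := near_delta cij e2.
have [d3 d30 H3] := near_delta cji e2.
set K := `|v| + `|w| + 1.
have K0 : 0 < K by rewrite /K ltr_wpDl// addr_ge0.
pose dl := Num.min d1 (Num.min d2 d3).
have dl0 : 0 < dl by rewrite !lt_min d10 d20.
pose h := dl / K / 2.
have h0 : 0 < h by rewrite !divr_gt0.
have near s t : `|s| <= `|h| -> `|t| <= `|h| ->
    `|s *: v + (t *: w + a) - a| < dl.
  rewrite (gtr0_norm h0) => sh th; rewrite addrA addrK.
  rewrite (le_lt_trans (ler_normD _ _))// !normrZ.
  apply: (@le_lt_trans _ _ (h * K)).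
    by rewrite /K !mulrDr mulr1 ler_wpDr ?(ltW h0)// lerD// ler_wpM2r.
  by rewrite /h mulrAC divfK ?gt_eqF// ltr_pdivrMr// ltr_pMr// ltr1n.
have near1 s t : `|s| <= `|h| -> `|t| <= `|h| ->
    ball a d1 (s *: v + (t *: w + a)).
  move=> sh th; rewrite -ball_normE /= distrC.
  by apply: lt_le_trans (near _ _ sh th) _; rewrite /dl ge_min lexx.
have norm0h : `|0 : R| <= `|h| by rewrite normr0.
have [|t1 t1h E1] := @MVT0 (fun s : R => f (s *: v + (h *: w + a)) - f (s *: v + a))
  (fun s => fi (s *: v + (h *: w + a)) - fi (s *: v + a)) h.
  move=> s sh; apply: is_deriveB; apply: is_derive_line.
    by have [] := dD _ (near1 s h sh (lexx _)).
  by have [] := dD _ (near1 s 0 sh norm0h); rewrite scale0r add0r.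
have [|t2 t2h E2] := @MVT0 (fun t : R => fi (t *: w + (t1 *: v + a)))
  (fun t => fji (t *: w + (t1 *: v + a))) h.
  move=> t th; apply: is_derive_line.
  by rewrite addrCA; have [] := dD _ (near1 t1 t t1h th).
have [|t3 t3h E3] := @MVT0 (fun s : R => f (s *: w + (h *: v + a)) - f (s *: w + a))
  (fun s => fj (s *: w + (h *: v + a)) - fj (s *: w + a)) h.
  move=> s sh; apply: is_deriveB; apply: is_derive_line.
    by rewrite addrCA; have [] := dD _ (near1 h s (lexx _) sh).
  by have [] := dD _ (near1 0 s norm0h sh); rewrite scale0r add0r.
have [|t4 t4h E4] := @MVT0 (fun t : R => fj (t *: v + (t3 *: w + a)))
  (fun t => fij (t *: v + (t3 *: w + a))) h.
  move=> t th; apply: is_derive_line.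
  by have [] := dD _ (near1 t t3 th t3h).
have E : fji (t2 *: w + (t1 *: v + a)) = fij (t4 *: v + (t3 *: w + a)).
  move: E1 E2 E3 E4; rewrite /= !scale0r !add0r => E1 E2 E3 E4.
  apply: (mulIf (lt0r_neq0 h0)); rewrite -E2 -E4.
  apply: (mulIf (lt0r_neq0 h0)).
  rewrite addrCA -E1 [h *: v + (t3 *: w + a)]addrCA -E3.
  by rewrite [h *: w + (h *: v + a)]addrCA; ring.
rewrite (_ : fij a - fji a = (fji (t2 *: w + (t1 *: v + a)) - fji a) -
  (fij (t4 *: v + (t3 *: w + a)) - fij a)); last by rewrite E; ring.
rewrite (le_trans (ler_normB _ _))// [leRHS]splitr; apply: lerD; apply: ltW.
  apply: H3; rewrite addrCA; apply: lt_le_trans (near _ _ t1h t2h) _.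
  by rewrite /dl !ge_min lexx !orbT.
apply: H2; apply: lt_le_trans (near _ _ t4h t3h) _.
by rewrite /dl !ge_min lexx !orbT.
Qed.

Lemma cont_add f g xi : {for xi, continuous f} -> {for xi, continuous g} ->
  {for xi, continuous (fun y => f y + g y)}.
Proof. by move=> cf cg; exact: continuousD. Qed.

Lemma cont_mul f g xi : {for xi, continuous f} -> {for xi, continuous g} ->
  {for xi, continuous (fun y => f y * g y)}.
Proof. by move=> cf cg; exact: continuousM. Qed.

Lemma cont_opp f xi : {for xi, continuous f} ->
  {for xi, continuous (fun y => - f y)}.
Proof. by move=> cf; exact: continuousN. Qed.

Lemma cont_cst c xi : {for xi, continuous (fun _ : 'rV[R]_d => c : R)}.
Proof. exact: cst_continuous. Qed.

Lemma cont_inv f xi : f xi != 0 -> {for xi, continuous f} ->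
  {for xi, continuous (fun y => (f y)^-1)}.
Proof. by move=> f0 cf; exact: continuousV. Qed.

Lemma cont_comp f (g : R -> R) xi : {for xi, continuous f} ->
  {for f xi, continuous g} -> {for xi, continuous (fun y => g (f y))}.
Proof. by move=> cf cg; exact: continuous_comp. Qed.

Lemma cont_coord xi i : {for xi, continuous (fun y : 'rV[R]_d => y ord0 i : R)}.
Proof. exact: coord_continuous. Qed.

Lemma cont_eq f g xi : f =1 g -> {for xi, continuous f} ->
  {for xi, continuous g}.
Proof. by move=> /funext ->. Qed.

Lemma cont_sum (I : Type) (s : seq I) (F : I -> 'rV[R]_d -> R) xi :
  (forall i, {for xi, continuous (F i)}) ->
  {for xi, continuous (fun x => \sum_(i <- s) F i x)}.
Proof.
move=> cF; elim: s => [|i s IH].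
  by apply: (@cont_eq (fun=> 0)); [move=> x; rewrite big_nil|exact: cont_cst].
apply: (@cont_eq (fun x => F i x + \sum_(j <- s) F j x)).
  by move=> x; rewrite big_cons.
exact: cont_add.
Qed.

End directional.

(** * Symbols *)

Section symbols.
Context {R : realType} {d : nat} {P : Type}.
Local Notation rV := 'rV[R]_d.
Local Notation e_ i := (delta_mx ord0 i : 'rV[R]_d).
Local Notation family := (P -> 'rV[R]_d -> R).
Implicit Types (A B b f g : family) (k : nat).

Lemma deriveF_add (f g : rV -> R) x v df dg : is_derive x v f df ->
  is_derive x v g dg -> is_derive x v (fun y => f y + g y) (df + dg).
Proof. exact: is_deriveD. Qed.

Lemma deriveF_opp (f : rV -> R) x v df : is_derive x v f df ->
  is_derive x v (fun y => - f y) (- df).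
Proof. exact: is_deriveN. Qed.

Lemma deriveF_mul (f g : rV -> R) x v df dg : is_derive x v f df ->
  is_derive x v g dg -> is_derive x v (fun y => f y * g y) (df * g x + f x * dg).
Proof.
move=> H1 H2; have := is_deriveM H1 H2.
by move/is_derive_eq; apply; rewrite addrC /GRing.scale/= mulrC.
Qed.

Lemma deriveF_cst (c : R) (x v : rV) : is_derive x v (fun=> c) 0.
Proof. exact: is_derive_cst. Qed.

Lemma deriveF_inv (f : rV -> R) x v df : f x != 0 -> is_derive x v f df ->
  is_derive x v (fun y => (f y)^-1) (- df * (f x)^-1 * (f x)^-1).
Proof.
move=> f0 [fd <-]; split; first exact: derivableV.
by rewrite deriveV// /GRing.scale/= expr2 invfM; ring.
Qed.

(** Estimates are kept in the form: weight [A], and a factor [b] for each of up to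
    [k] derivatives, with constants independent of the parameter [p].  All of
    [x], [t], [kappa] and the cutoff parameters are put into [p], so that
    uniformity in them needs no further bookkeeping.  The derivatives are
    existentially quantified because the families have arbitrary values at the origin. *)
Fixpoint symbol b k A f : Prop :=
  [/\ forall p (xi : rV), xi != 0 -> {for xi, continuous (f p)},
      exists C, forall p (xi : rV), xi != 0 -> `|f p xi| <= C * A p xi &
      if k is k'.+1 then forall i, exists g,
        (forall p (xi : rV), xi != 0 -> is_derive xi (e_ i) (f p) (g p xi)) /\
        symbol b k' (fun p xi => A p xi * b p xi) g
      else True].

Lemma symbol_cont b k A f : symbol b k A f ->
  forall p (xi : rV), xi != 0 -> {for xi, continuous (f p)}.
Proof. by case: k => [|k] []. Qed.

Lemma symbol_bound b k A f : symbol b k A f ->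
  exists2 C, 0 <= C & forall p (xi : rV), xi != 0 -> `|f p xi| <= C * `|A p xi|.
Proof.
move=> H; have [C HC] : exists C, forall p (xi : rV), xi != 0 -> `|f p xi| <= C * A p xi.
  by case: k H => [|k] [].
exists `|C| => // p xi xi0; rewrite -normrM.
exact: le_trans (HC _ _ xi0) (ler_norm _).
Qed.

Lemma symbolW b k A f : symbol b k.+1 A f -> symbol b k A f.
Proof.
elim: k A f => [|k IH] A f [cf bf df]; first by split.
split=> // i; have [g [dg sg]] := df i.
by exists g; split=> //; exact: IH.
Qed.

Lemma symbolWn b k m A f : (k <= m)%N -> symbol b m A f -> symbol b k A f.
Proof.
move=> /subnK <-; elim: (m - k)%N => //= n IH H; apply: IH.
by exact: symbolW.
Qed.

(** Used to pass from the radial cost [|xi|^-1] of a derivative to the larger costs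
    that depend on the phase and on [kappa]. *)
Lemma symbol_le b b' k A A' f (K L : R) :
  (forall p (xi : rV), xi != 0 -> 0 <= A p xi <= K * A' p xi) ->
  (forall p (xi : rV), xi != 0 -> 0 <= b p xi <= L * b' p xi) ->
  symbol b k A f -> symbol b' k A' f.
Proof.
elim: k A A' f K => [|k IH] A A' f K HA Hb.
  move=> /[dup] sf [cf [C bf] _]; split=> //; exists (`|C| * K) => p xi xi0.
  have /andP[A0 AK] := HA p xi xi0.
  apply: le_trans (bf p xi xi0) _; rewrite -mulrA.
  apply: (@le_trans _ _ (`|C| * A p xi)); last by rewrite ler_wpM2l.
  by rewrite ler_wpM2r// ler_norm.
move=> [cf [C bf] df]; split=> //.
  exists (`|C| * K) => p xi xi0; have /andP[A0 AK] := HA p xi xi0.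
  apply: le_trans (bf p xi xi0) _; rewrite -mulrA.
  apply: (@le_trans _ _ (`|C| * A p xi)); last by rewrite ler_wpM2l.
  by rewrite ler_wpM2r// ler_norm.
move=> i; have [g [dg sg]] := df i; exists g; split=> //.
apply: (IH _ _ _ (K * L)) sg => //.
move=> p xi xi0; have /andP[A0 AK] := HA p xi xi0.
have /andP[b0 bL] := Hb p xi xi0.
by rewrite mulr_ge0//= mulrACA ler_pM.
Qed.

Lemma symbol_eqw b k A A' f : (forall p (xi : rV), xi != 0 -> A p xi = A' p xi) ->
  symbol b k A f -> symbol b k A' f.
Proof.
elim: k A A' f => [|k IH] A A' f AA' [cf [C bf] df]; split=> //.
- by exists C => p xi xi0; rewrite -AA'//; exact: bf.
- by exists C => p xi xi0; rewrite -AA'//; exact: bf.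
move=> i; have [g [dg sg]] := df i; exists g; split=> //.
  by apply: IH sg => p xi xi0; rewrite AA'.
Qed.

Lemma symbol_cst b k A (c : P -> R) (K : R) :
  (forall p (xi : rV), xi != 0 -> 0 <= A p xi) ->
  (forall p (xi : rV), xi != 0 -> 0 <= b p xi) ->
  (forall p (xi : rV), xi != 0 -> `|c p| <= K * A p xi) ->
  symbol b k A (fun p _ => c p).
Proof.
elim: k A c K => [|k IH] A c K A0 b0 cA; split=> //; try by exists K.
- by move=> p xi _; exact: cont_cst.
- by move=> p xi _; exact: cont_cst.
move=> i; exists (fun _ _ => 0); split; first by move=> *; exact: deriveF_cst.
apply: (IH _ _ 0) => // p xi xi0; first by rewrite mulr_ge0 ?A0 ?b0.
by rewrite normr0 mul0r.
Qed.

Lemma symbol_add b k A f g : symbol b k A f -> symbol b k A g ->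
  symbol b k A (fun p xi => f p xi + g p xi).
Proof.
elim: k A f g => [|k IH] A f g [cf [C bf] df] [cg [D bg] dg]; split=> //.
- by move=> p xi xi0; apply: cont_add; [exact: cf|exact: cg].
- exists (C + D) => p xi xi0; rewrite mulrDl (le_trans (ler_normD _ _))//.
  by rewrite lerD ?bf ?bg.
- by move=> p xi xi0; apply: cont_add; [exact: cf|exact: cg].
- exists (C + D) => p xi xi0; rewrite mulrDl (le_trans (ler_normD _ _))//.
  by rewrite lerD ?bf ?bg.
move=> i; have [f' [df' sf']] := df i; have [g' [dg' sg']] := dg i.
exists (fun p xi => f' p xi + g' p xi); split; last exact: IH.
by move=> p xi xi0; apply: deriveF_add; [exact: df'|exact: dg'].
Qed.

Lemma symbol_opp b k A f : symbol b k A f -> symbol b k A (fun p xi => - f p xi).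
Proof.
elim: k A f => [|k IH] A f [cf [C bf] df]; split=> //.
- by move=> p xi xi0; apply: cont_opp; exact: cf.
- by exists C => p xi xi0; rewrite normrN bf.
- by move=> p xi xi0; apply: cont_opp; exact: cf.
- by exists C => p xi xi0; rewrite normrN bf.
move=> i; have [f' [df' sf']] := df i.
exists (fun p xi => - f' p xi); split; last exact: IH.
by move=> p xi xi0; apply: deriveF_opp; exact: df'.
Qed.

Lemma symbol_mul b k A B f g : symbol b k A f -> symbol b k B g ->
  symbol b k (fun p xi => A p xi * B p xi) (fun p xi => f p xi * g p xi).
Proof.
elim: k A B f g => [|k IH] A B f g.
  move=> [cf [C bf] df] [cg [D bg] dg]; split=> //.
    by move=> p xi xi0; apply: cont_mul; [exact: cf|exact: cg].
  exists (C * D) => p xi xi0; rewrite mulrACA normrM.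
  by rewrite ler_pM ?bf ?bg.
move=> sf sg; have [cf [C bf] df] := sf; have [cg [D bg] dg] := sg; split=> //.
- by move=> p xi xi0; apply: cont_mul; [exact: cf|exact: cg].
- exists (C * D) => p xi xi0; rewrite mulrACA normrM.
  by rewrite ler_pM ?bf ?bg.
move=> i; have [f' [df' sf']] := df i; have [g' [dg' sg']] := dg i.
exists (fun p xi => f' p xi * g p xi + f p xi * g' p xi); split.
  by move=> p xi xi0; apply: deriveF_mul; [exact: df'|exact: dg'].
apply: symbol_add.
  apply: (symbol_eqw (A := fun p xi => (A p xi * b p xi) * B p xi)).
    by move=> p xi _; ring.
  by apply: IH => //; exact: symbolW.
apply: (symbol_eqw (A := fun p xi => A p xi * (B p xi * b p xi))).
  by move=> p xi _; ring.
by apply: IH => //; exact: symbolW.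
Qed.

Lemma symbol_scale b k A f (c : R) : symbol b k A f ->
  symbol b k A (fun p xi => c * f p xi).
Proof.
elim: k A f => [|k IH] A f [cf [C bf] df]; split=> //.
- by move=> p xi xi0; apply: cont_mul; [exact: cont_cst|exact: cf].
- by exists (`|c| * C) => p xi xi0; rewrite normrM -mulrA ler_wpM2l// bf.
- by move=> p xi xi0; apply: cont_mul; [exact: cont_cst|exact: cf].
- by exists (`|c| * C) => p xi xi0; rewrite normrM -mulrA ler_wpM2l// bf.
move=> i; have [f' [df' sf']] := df i.
exists (fun p xi => c * f' p xi); split; last exact: IH.
move=> p xi xi0; have := deriveF_mul (deriveF_cst c xi (e_ i)) (df' p xi xi0).
by rewrite mul0r add0r.
Qed.

Lemma symbol_sum b k A (I : Type) (s : seq I) (F : I -> family) :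
  (forall p (xi : rV), xi != 0 -> 0 <= A p xi) ->
  (forall p (xi : rV), xi != 0 -> 0 <= b p xi) ->
  (forall i, symbol b k A (F i)) ->
  symbol b k A (fun p xi => \sum_(i <- s) F i p xi).
Proof.
move=> A0 b0 sF; elim: s => [|i s IH].
  under eq_fun do under eq_fun do rewrite big_nil.
  by apply: (@symbol_cst _ _ _ (fun=> 0) 0) => // *; rewrite normr0 mul0r.
under eq_fun do under eq_fun do rewrite big_cons.
exact: symbol_add.
Qed.

Lemma symbol_prod b k A (I : Type) (s : seq I) (F : I -> family) :
  (forall p (xi : rV), xi != 0 -> 0 <= A p xi) ->
  (forall p (xi : rV), xi != 0 -> 0 <= b p xi) ->
  (forall i, symbol b k A (F i)) ->
  symbol b k (fun p xi => A p xi ^+ size s) (fun p xi => \prod_(i <- s) F i p xi).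
Proof.
move=> A0 b0 sF; elim: s => [|i s IH].
  under [X in symbol _ _ _ X]eq_fun do under eq_fun do rewrite big_nil.
  by apply: (@symbol_cst _ _ _ (fun=> 1) 1) => // *; rewrite expr0 ?normr1 ?mul1r.
under [X in symbol _ _ _ X]eq_fun do under eq_fun do rewrite big_cons.
under eq_fun do under eq_fun do rewrite /= exprS.
exact: symbol_mul.
Qed.

(** The derivative of [f^-1] is [- f' * f^-1 * f^-1], so the induction on the number
    of derivatives uses the statement itself for [f^-1]. *)
Lemma symbol_inv b k A f (c : R) : 0 < c ->
  (forall p (xi : rV), xi != 0 -> 0 < A p xi) ->
  (forall p (xi : rV), xi != 0 -> c * A p xi <= `|f p xi|) ->
  symbol b k A f ->
  symbol b k (fun p xi => (A p xi)^-1) (fun p xi => (f p xi)^-1).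
Proof.
move=> c0 A0 fA.
have f0 p xi : xi != 0 -> f p xi != 0.
  move=> xi0; rewrite -normr_gt0; apply: lt_le_trans (fA _ _ xi0).
  by rewrite mulr_gt0 ?A0.
have bV : exists C : R, forall p (xi : rV), xi != 0 ->
    `|(f p xi)^-1| <= C * (A p xi)^-1.
  exists c^-1 => p xi xi0; rewrite normfV -invfM lef_pV2 ?fA//.
    by rewrite posrE normr_gt0 f0.
  by rewrite posrE mulr_gt0 ?A0.
elim: k => [|k IH] sf.
  split=> // p xi xi0; apply: cont_inv; first exact: f0.
  exact: (symbol_cont sf).
split=> //.
  move=> p xi xi0; apply: cont_inv; first exact: f0.
  exact: (symbol_cont sf).
move=> i; have [_ _ /(_ i)[f' [df' sf']]] := sf.
exists (fun p xi => - f' p xi * (f p xi)^-1 * (f p xi)^-1); split.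
  by move=> p xi xi0; apply: deriveF_inv; [exact: f0|exact: df'].
apply: (symbol_eqw (A := fun p xi =>
    (A p xi * b p xi) * (A p xi)^-1 * (A p xi)^-1)).
  by move=> p xi xi0; have := A0 p xi xi0; move=> /lt0r_neq0 ?; field.
apply: symbol_mul; last exact/IH/symbolW.
by apply: symbol_mul; [exact: symbol_opp|exact/IH/symbolW].
Qed.

End symbols.

(** * The Euclidean norm and radial symbols *)

Section enorm.
Context {R : realType} {d : nat}.
Implicit Types (x y xi : 'rV[R]_d).

Lemma enorm_ge0 xi : 0 <= enorm xi. Proof. exact: sqrtr_ge0. Qed.

Lemma sumsq_ge0 xi : 0 <= \sum_(i < d) xi ord0 i ^+ 2.
Proof. by apply: sumr_ge0 => i _; exact: sqr_ge0. Qed.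

Lemma sumsq_gt0 xi : xi != 0 -> 0 < \sum_(i < d) xi ord0 i ^+ 2.
Proof.
move=> xi0; rewrite lt_neqAle sumsq_ge0 andbT eq_sym.
apply: contraNneq xi0; move/psumr_eq0P => H; apply/eqP/rowP => i.
by rewrite mxE; apply/eqP; rewrite -sqrf_eq0; apply/eqP/H => // j _; exact: sqr_ge0.
Qed.

Lemma enorm_gt0 xi : xi != 0 -> 0 < enorm xi.
Proof. by move=> xi0; rewrite /enorm sqrtr_gt0 sumsq_gt0. Qed.

Lemma sqr_enorm xi : enorm xi ^+ 2 = \sum_(i < d) xi ord0 i ^+ 2.
Proof. by rewrite /enorm sqr_sqrtr// sumsq_ge0. Qed.

Lemma coord_le_enorm xi i : `|xi ord0 i| <= enorm xi.
Proof.
rewrite -(@ler_pXn2r _ 2) ?nnegrE ?enorm_ge0// sqr_enorm real_normK ?num_real//.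
by rewrite (bigD1 i)//= lerDl sumr_ge0// => j _; exact: sqr_ge0.
Qed.

Lemma enorm_powR xi (s : R) : enorm xi `^ s = (\sum_(i < d) xi ord0 i ^+ 2) `^ (s / 2).
Proof.
rewrite /enorm -powR12_sqrt ?sumsq_ge0// -powRrM; congr (_ `^ _).
by rewrite mulrC.
Qed.

Lemma is_derive_coord xi i j :
  is_derive xi (delta_mx ord0 i : 'rV[R]_d) (fun x => x ord0 j) (i == j)%:R.
Proof.
apply/is_deriveP; apply: cvg_near_cst.
rewrite [i == j]eq_sym; near=> h; rewrite !mxE eqxx/= addrK mulrA mulVf ?mul1r//.
near: h; exact: nbhs_dnbhs_neq.
Unshelve. all: by end_near. Qed.

End enorm.

Lemma powRN2 {R : realType} (r : R) : 0 < r -> r `^ (- 2) = r^-1 * r^-1.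
Proof.
move=> r0; rewrite (_ : - 2 = -1 + -1 :> R); last by ring.
by rewrite powRD ?(gt_eqF r0) ?implybT// powR_inv1// ltW.
Qed.

Section radial_symbols.
Context {R : realType} {d : nat} {P : Type}.
Local Notation rV := 'rV[R]_d.
Local Notation e_ i := (delta_mx ord0 i : 'rV[R]_d).
Local Notation family := (P -> 'rV[R]_d -> R).

Definition invnorm : family := fun _ xi => (enorm xi)^-1.

Lemma invnorm_ge0 p xi : 0 <= invnorm p xi.
Proof. by rewrite invr_ge0 enorm_ge0. Qed.

Lemma symbol_coord k j :
  symbol invnorm k (fun _ xi => enorm xi) (fun (p : P) (xi : rV) => xi ord0 j).
Proof.
have bd : exists C, forall (p : P) (xi : rV), xi != 0 ->
    `|xi ord0 j| <= C * enorm xi.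
  by exists 1 => p xi _; rewrite mul1r coord_le_enorm.
case: k => [|k]; split=> //; try by move=> p xi _; exact: cont_coord.
move=> i; exists (fun _ _ => (i == j)%:R); split.
  by move=> p xi _; exact: is_derive_coord.
apply: (@symbol_cst _ _ _ _ _ _ (fun=> (i == j)%:R) 1).
- by move=> p xi _; rewrite mulr_ge0 ?invnorm_ge0 ?enorm_ge0.
- by move=> *; exact: invnorm_ge0.
- move=> p xi xi0; rewrite mul1r divff ?lt0r_neq0 ?enorm_gt0//.
  by case: (i == j); rewrite ?normr1 ?normr0.
Qed.

Lemma continuous_sumsq (xi : rV) :
  {for xi, continuous (fun x : rV => \sum_(i < d) x ord0 i ^+ 2)}.
Proof.
apply: cont_sum => i; apply: (@cont_eq _ _ (fun x => x ord0 i * x ord0 i)).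
  by move=> x; rewrite expr2.
by apply: cont_mul; exact: cont_coord.
Qed.

Lemma continuous_enorm_powR (s : R) (xi : rV) : xi != 0 ->
  {for xi, continuous (fun x : rV => enorm x `^ s)}.
Proof.
move=> xi0.
apply: (@cont_eq _ _ (fun x => (\sum_(i < d) x ord0 i ^+ 2) `^ (s / 2))).
  by move=> x; rewrite enorm_powR.
apply: (@cont_comp _ _ (fun x : rV => \sum_(i < d) x ord0 i ^+ 2) (fun y : R => y `^ (s / 2))); first exact: continuous_sumsq.
apply: differentiable_continuous; apply/derivable1_diffP.
by have [] := is_derive1_powR (s / 2) (sumsq_gt0 xi0).
Qed.

Lemma continuous_enorm (xi : rV) :
  {for xi, continuous (fun x : rV => enorm x)}.
Proof.
apply: (@cont_comp _ _ (fun x : rV => \sum_(i < d) x ord0 i ^+ 2) (@Num.sqrt R)); first exact: continuous_sumsq.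
exact: sqrt_continuous.
Qed.

Lemma is_derive_enorm_powR (s : R) (xi : rV) i : xi != 0 ->
  is_derive xi (e_ i) (fun x : rV => enorm x `^ s)
    (s * (xi ord0 i * enorm xi `^ (s - 2))).
Proof.
move=> xi0.
rewrite (_ : (fun x : rV => enorm x `^ s) = (fun x : rV => (\sum_(i < d) x ord0 i ^+ 2) `^ (s / 2))); last first.
  by apply/funext => x; exact: enorm_powR.
have dsq : is_derive xi (e_ i) (fun x : rV => \sum_(i < d) x ord0 i ^+ 2)
    (2 * xi ord0 i).
  rewrite (_ : 2 * _ = \sum_(j < d) ((i == j)%:R * xi ord0 j + xi ord0 j * (i == j)%:R)); last first.
    rewrite (bigD1 i)//= eqxx big1 => [|j /negPf ji]; first by rewrite !mulr1n; ring.
    by rewrite eq_sym ji mulr0n; ring.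
  elim: (index_enum _) => [|j s' IH].
    by under eq_fun do rewrite big_nil; rewrite big_nil; exact: deriveF_cst.
  under eq_fun do rewrite big_cons.
  rewrite big_cons; apply: deriveF_add => //; under eq_fun do rewrite expr2.
  by apply: deriveF_mul; exact: is_derive_coord.
have := is_derive_rcomp dsq (is_derive1_powR (s / 2) (sumsq_gt0 xi0)).
move/is_derive_eq; apply; rewrite enorm_powR.
rewrite (_ : (s - 2) / 2 = s / 2 - 1); last by field.
by field.
Qed.

(** The derivatives of [|xi|^s] are [s * xi_i * |xi|^(s-2)], so the induction is over
    all exponents at once. *)
Lemma symbol_enorm_powR k (s : R) :
  symbol invnorm k (fun _ xi => enorm xi `^ s)
    (fun (p : P) (xi : rV) => enorm xi `^ s).
Proof.
have bd s' : exists C, forall (p : P) (xi : rV), xi != 0 ->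
    `|enorm xi `^ s'| <= C * enorm xi `^ s'.
  by exists 1 => p xi _; rewrite mul1r ger0_norm ?powR_ge0.
elim: k s => [|k IH] s; split=> //;
  try by move=> p xi xi0; exact: continuous_enorm_powR.
move=> i; exists (fun (_ : P) (xi : rV) => s * (xi ord0 i * enorm xi `^ (s - 2))); split.
  by move=> p xi xi0; exact: is_derive_enorm_powR.
apply: symbol_scale.
apply: (symbol_eqw (A := fun p xi => enorm xi * enorm xi `^ (s - 2))).
  move=> p xi xi0; have n0 := enorm_gt0 xi0; rewrite /invnorm.
  rewrite -[X in X * _ = _]powRr1 ?enorm_ge0// -powRD; last first.
    by rewrite (gt_eqF n0) implybT.
  rewrite -powR_inv1 ?enorm_ge0// -powRD; last by rewrite (gt_eqF n0) implybT.
  by congr (_ `^ _); ring.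
by apply: symbol_mul; [exact: symbol_coord|exact: IH].
Qed.

(** The functions [s ^+ n * g^(n) s] form a class stable under [s * d/ds], hence under
    differentiating [g (e * |xi|)] at the cost [|xi|^-1], whatever the dilation
    [e]; and they are bounded, being continuous and zero for large [s]. *)
Lemma symbol_cutoff k (g : R -> R) (e : P -> R) : smooth g ->
  (forall s, 1 <= `|s| -> g s = 0) ->
  symbol invnorm k (fun _ _ => 1) (fun p (xi : rV) => g (e p * enorm xi)).
Proof.
move=> gs g0.
have g0n n s : 1 < `|s| -> derive1n n g s = 0.
  elim: n s => [|n IH] s s1; first by rewrite derive1n0 g0// ltW.
  rewrite derive1nS derive1E.
  rewrite (@near_eq_derive R R R _ (cst 0) s (1 : R)); last first.
    have : \forall z \near s, 1 < `|z|.
      have : {for s, continuous (fun z : R => `|z|)} by exact: norm_continuous.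
      by move/cvgr_gt; exact.
    by apply: filterS => z; exact: IH.
  by rewrite derive_cst.
have gc n : continuous (derive1n n g).
  move=> s; apply: differentiable_continuous; apply/derivable1_diffP.
  exact: gs.
pose T n s := s ^+ n * derive1n n g s.
have Tb n : exists C : R, forall s, `|T n s| <= C.
  have [||c cI H] := @EVT_max R (fun s => `|T n s|) (- 1) 1.
    by lra.
    apply: continuous_subspaceT => s.
    apply: (continuous_comp (g := fun x : R => `|x|)); last exact: norm_continuous.
    apply: cvgM; last exact: gc.
    exact: exprn_continuous.
  exists `|T n c| => s; have [s1|s1] := leP `|s| 1.
    by apply: H; rewrite in_itv/= -ler_norml.
  by rewrite /T g0n// mulr0 normr0.
suff H n : symbol invnorm k (fun _ _ => 1) (fun p (xi : rV) => T n (e p * enorm xi)).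
  have -> : (fun p (xi : rV) => g (e p * enorm xi)) =
      (fun p (xi : rV) => T 0%N (e p * enorm xi)).
    by apply/funext => p; apply/funext => xi; rewrite /T expr0 mul1r derive1n0.
  exact: H.
have Tc m p (xi : rV) : {for xi, continuous (fun xi => T m (e p * enorm xi))}.
  apply: (@cont_comp _ _ (fun x : rV => e p * enorm x) (T m)).
    by apply: cont_mul; [exact: cont_cst|exact: continuous_enorm].
  by apply: cvgM; [exact: exprn_continuous|exact: gc].
elim: k n => [|k IH] n.
  split=> // ; have [C HC] := Tb n.
  by exists C => p xi _; rewrite mulr1.
split=> //.
  have [C HC] := Tb n.
  by exists C => p xi _; rewrite mulr1.
move=> i.
exists (fun (p : P) (xi : rV) => (xi ord0 i * enorm xi `^ (- 2)) *
   (n%:R * T n (e p * enorm xi) + T n.+1 (e p * enorm xi))); split.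
  move=> p xi xi0; have N0 := enorm_gt0 xi0.
  have dN : is_derive xi (e_ i) (fun x : rV => e p * enorm x)
      (e p * (xi ord0 i * enorm xi `^ (-1))).
    have := deriveF_mul (deriveF_cst (e p) xi (e_ i)) (is_derive_enorm_powR 1 i xi0).
    rewrite mul0r add0r mul1r (_ : 1 - 2 = -1 :> R); last by ring.
    rewrite (_ : (fun y : rV => _) = (fun x : rV => e p * enorm x))//.
    by apply/funext => y; rewrite powRr1 ?enorm_ge0.
  have dT (s : R) : is_derive s 1 (T n)
      (n%:R * s ^+ n.-1 * derive1n n g s + s ^+ n * derive1n n.+1 g s).
    have dg : is_derive s 1 (derive1n n g) (derive1n n.+1 g s).
      by rewrite derive1nS derive1E; apply: derivableP; exact: gs.
    have dX : is_derive s (1 : R) (fun x : R => x ^+ n) (n%:R * s ^+ n.-1).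
      split; first exact: exprn_derivable.
      case: n {dg} => [|m]; first by rewrite mul0r; exact: derive_cst.
      by rewrite exp_derive /GRing.scale/= mulr1.
    have := is_deriveM dX dg.
    move/is_derive_eq; apply; rewrite /GRing.scale/= addrC; congr (_ + _).
    by rewrite mulrC.
  have := is_derive_rcomp dN (dT (e p * enorm xi)).
  move/is_derive_eq; apply; rewrite /T.
  rewrite (powRN2 N0) ?powR_inv1 ?enorm_ge0//.
  case: n {dT} => [|n]; first by rewrite /= !exprS expr0; field; exact: lt0r_neq0.
  by rewrite /= !exprS; field; exact: lt0r_neq0.
apply: (symbol_eqw (A := fun p xi => (enorm xi * enorm xi `^ (- 2)) * 1)).
  move=> p xi xi0; have N0 := enorm_gt0 xi0; rewrite /invnorm mul1r mulr1.
  rewrite (powRN2 N0) ?powR_inv1 ?enorm_ge0//.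
  by rewrite mulrA divff ?mul1r ?gt_eqF.
apply: symbol_mul.
  by apply: symbol_mul; [exact: symbol_coord|exact: symbol_enorm_powR].
by apply: symbol_add => //; apply: symbol_scale.
Qed.

(** Differentiating the complex function [exp ((1/2 + i kappa) l)] multiplies it by
    [(1/2 + i kappa) * dl], so each derivative costs an extra factor [1 + |kappa|];
    in real terms its two parts are differentiated together. *)
Lemma symbol_exp_pair k (b : family) (kap : P -> R) A (l : family) :
  (forall p (xi : rV), xi != 0 -> 0 <= b p xi) ->
  (forall p (xi : rV), xi != 0 -> expR (l p xi / 2) <= A p xi) ->
  (forall p (xi : rV), xi != 0 -> {for xi, continuous (l p)}) ->
  (forall i, exists g,
    (forall p (xi : rV), xi != 0 -> is_derive xi (e_ i) (l p) (g p xi)) /\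
    symbol b k b g) ->
  symbol (fun p xi => (1 + `|kap p|) * b p xi) k.+1 A
    (fun p xi => expR (l p xi / 2) * cos (kap p * l p xi)) /\
  symbol (fun p xi => (1 + `|kap p|) * b p xi) k.+1 A
    (fun p xi => expR (l p xi / 2) * sin (kap p * l p xi)).
Proof.
move=> b0 lA lc dl.
set c := fun p xi => (1 + `|kap p|) * b p xi.
set u := fun p xi => expR (l p xi / 2) * cos (kap p * l p xi).
set v := fun p xi => expR (l p xi / 2) * sin (kap p * l p xi).
have c0 p (xi : rV) : xi != 0 -> 0 <= c p xi.
  by move=> xi0; rewrite /c mulr_ge0 ?b0// addr_ge0.
have lc' p (xi : rV) : xi != 0 -> {for xi, continuous (fun x => l p x / 2)}.
  by move=> xi0; apply: cont_mul; [exact: lc|exact: cont_cst].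
have klc p (xi : rV) : xi != 0 -> {for xi, continuous (fun x => kap p * l p x)}.
  by move=> xi0; apply: cont_mul; [exact: cont_cst|exact: lc].
have ec p (xi : rV) : xi != 0 -> {for xi, continuous (fun x => expR (l p x / 2))}.
  move=> xi0; apply: (@cont_comp _ _ (fun x => l p x / 2) (@expR R)); first exact: lc'.
  exact: continuous_expR.
have uc p (xi : rV) : xi != 0 -> {for xi, continuous (u p)}.
  move=> xi0; apply: cont_mul; first exact: ec.
  by apply: (@cont_comp _ _ (fun x => kap p * l p x) (@cos R)); [exact: klc|exact: continuous_cos].
have vc p (xi : rV) : xi != 0 -> {for xi, continuous (v p)}.
  move=> xi0; apply: cont_mul; first exact: ec.
  by apply: (@cont_comp _ _ (fun x => kap p * l p x) (@sin R)); [exact: klc|exact: continuous_sin].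
have ub : exists C, forall p (xi : rV), xi != 0 -> `|u p xi| <= C * A p xi.
  exists 1 => p xi xi0; rewrite mul1r (le_trans _ (lA _ _ xi0))//.
  rewrite normrM ger0_norm ?expR_ge0// ler_piMr ?expR_ge0//.
  by rewrite ler_norml cos_geN1 cos_le1.
have vb : exists C, forall p (xi : rV), xi != 0 -> `|v p xi| <= C * A p xi.
  exists 1 => p xi xi0; rewrite mul1r (le_trans _ (lA _ _ xi0))//.
  rewrite normrM ger0_norm ?expR_ge0// ler_piMr ?expR_ge0//.
  by rewrite ler_norml sin_geN1 sin_le1.
have : forall j, (j <= k.+1)%N -> symbol c j A u /\ symbol c j A v.
  elim=> [|j IH] jk; first by split; split.
  have [su sv] := IH (ltnW jk).
  have half i : exists g,
      [/\ forall p (xi : rV), xi != 0 -> is_derive xi (e_ i) (l p) (g p xi),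
        symbol c j c (fun p xi => g p xi / 2) &
        symbol c j c (fun p xi => kap p * g p xi)].
    have [g [dg sg]] := dl i.
    have {}sg : symbol c j b g.
      apply: (@symbol_le _ _ _ b c j b b g 1 1).
      - by move=> p xi xi0; rewrite mul1r b0//=.
      - move=> p xi xi0; rewrite mul1r b0//= /c ler_peMl ?b0//.
        by rewrite lerDl.
      - exact: symbolWn sg.
    exists g; split=> //.
      under eq_fun do under eq_fun do rewrite mulrC.
      apply: symbol_scale.
      apply: (@symbol_le _ _ _ c c j b c g 1 1) => //.
      - move=> p xi xi0; rewrite mul1r b0//= /c ler_peMl ?b0//.
        by rewrite lerDl.
      - by move=> p xi xi0; rewrite mul1r c0 //=.
    apply: (symbol_mul (A := fun p _ => 1 + `|kap p|) (B := b)) => //.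
    apply: (@symbol_cst _ _ _ _ _ _ kap 1).
    - by move=> p xi _; rewrite addr_ge0.
    - exact: c0.
    - by move=> p xi _; rewrite mul1r lerDr.
  have dexp i p (xi : rV) g : is_derive xi (e_ i) (l p) g ->
      is_derive xi (e_ i) (fun x => expR (l p x / 2)) (expR (l p xi / 2) * (g / 2)).
    move=> dg; apply: is_derive_rcomp.
    have := deriveF_mul dg (deriveF_cst 2^-1 xi (e_ i)).
    by rewrite mulr0 addr0.
  have dkl i p (xi : rV) g : is_derive xi (e_ i) (l p) g ->
      is_derive xi (e_ i) (fun x => kap p * l p x) (kap p * g).
    move=> dg.
    have := deriveF_mul (deriveF_cst (kap p) xi (e_ i)) dg.
    by rewrite mul0r add0r.
  split; split=> // i; have [g [dg s1 s2]] := half i.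
    exists (fun p xi => u p xi * (g p xi / 2) + - (v p xi * (kap p * g p xi))); split.
      move=> p xi xi0.
      have := deriveF_mul (dexp i p xi _ (dg _ _ xi0))
        (is_derive_rcomp (dkl i p xi _ (dg _ _ xi0)) (is_derive_cos (kap p * l p xi))).
      by move/is_derive_eq; apply; rewrite /u /v; ring.
    by apply: symbol_add; last apply: symbol_opp; apply: symbol_mul.
  exists (fun p xi => v p xi * (g p xi / 2) + u p xi * (kap p * g p xi)); split.
    move=> p xi xi0.
    have := deriveF_mul (dexp i p xi _ (dg _ _ xi0))
      (is_derive_rcomp (dkl i p xi _ (dg _ _ xi0)) (is_derive_sin (kap p * l p xi))).
    by move/is_derive_eq; apply; rewrite /u /v; ring.
  by apply: symbol_add; apply: symbol_mul.
by move=> /(_ k.+1 (leqnn _)).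
Qed.

End radial_symbols.

(** * Derivatives of an almost homogeneous function *)

Section phase_derivatives.
Context {R : realType} {d : nat}.
Local Notation rV := 'rV[R]_d.
Local Notation e_ i := (delta_mx ord0 i : 'rV[R]_d).
Variables (alpha : R) (phi : rV -> R).

Lemma near_neq0 (xi : rV) : xi != 0 -> \forall x \near xi, x != 0.
Proof.
move=> xi0; have n0 : 0 < `|xi| by rewrite normr_gt0.
apply/nbhs_ballP; exists `|xi| => //= x; rewrite -ball_normE /= => H.
by apply: contraTneq H => ->; rewrite subr0 ltxx.
Qed.

Lemma eq_partial (f g : rV -> R) i : (forall xi, xi != 0 -> f xi = g xi) ->
  forall xi, xi != 0 -> partial i f xi = partial i g xi.
Proof.
move=> fg xi xi0; rewrite /partial; apply: near_eq_derive.
by apply: filterS (near_neq0 xi0) => x; exact: fg.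
Qed.

Lemma iter_partial_cat (s t : seq 'I_d) (f : rV -> R) :
  iter_partial (s ++ t) f = iter_partial s (iter_partial t f).
Proof. by rewrite /iter_partial foldr_cat. Qed.

Lemma mderivE (gamma : {ffun 'I_d -> nat}) (f : rV -> R) :
  mderiv gamma f = iter_partial (flatten [seq nseq (gamma i) i | i <- enum 'I_d]) f.
Proof.
rewrite /mderiv; elim: (enum _) => //= i s ->.
rewrite iter_partial_cat; elim: (gamma i) => //= n ->.
by [].
Qed.

Section smooth.
Hypothesis phiC : class_C d.+2 [set xi : rV | xi != 0] phi.

Lemma iter_partial_continuous s (xi : rV) : xi != 0 -> (size s <= d.+2)%N ->
  {for xi, continuous (iter_partial s phi)}.
Proof. by move=> xi0 sd; have [+ _] := phiC s xi0; exact. Qed.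

Lemma iter_partial_derive s (xi : rV) i : xi != 0 -> (size s < d.+2)%N ->
  is_derive xi (e_ i) (iter_partial s phi) (iter_partial (i :: s) phi xi).
Proof.
move=> xi0 sd; have [_ /(_ sd i)] := phiC s xi0.
exact: derivableP.
Qed.

Lemma iter_partial_swap i j s (xi : rV) : xi != 0 -> (size s <= d)%N ->
  iter_partial (i :: j :: s) phi xi = iter_partial (j :: i :: s) phi xi.
Proof.
move=> xi0 sd.
apply: (@mixed_derivative_symmetric _ _ (iter_partial s phi)
  (iter_partial (i :: s) phi) (iter_partial (j :: s) phi) _ _ _ (e_ i) (e_ j)).
- apply: filterS (near_neq0 xi0) => x x0.
  by split; apply: iter_partial_derive => //=; rewrite ltnS// ltnW.
- exact: iter_partial_continuous.
- exact: iter_partial_continuous.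
Qed.

Lemma iter_partial_insert i s t (xi : rV) : xi != 0 ->
  (size s + size t <= d.+1)%N ->
  iter_partial (i :: s ++ t) phi xi = iter_partial (s ++ i :: t) phi xi.
Proof.
elim: s xi => //= j s IH xi xi0 sd.
transitivity (iter_partial (j :: i :: s ++ t) phi xi).
  by apply: iter_partial_swap => //; rewrite size_cat -ltnS.
by apply: eq_partial => // x x0; apply: IH => //; exact: ltnW.
Qed.

(** Almost homogeneity bounds the derivatives taken in one fixed order of the
    variables; this transfers the bounds to all orders of differentiation. *)
Lemma iter_partial_perm s t (xi : rV) : xi != 0 -> (size s <= d.+2)%N ->
  perm_eq s t -> iter_partial s phi xi = iter_partial t phi xi.
Proof.
elim: s t xi => [|i s IH] t xi xi0 sd st.
  by have := perm_size st; case: t {st}.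
have it : i \in t by rewrite -(perm_mem st) mem_head.
case/splitPr: it st => t1 t2 st.
have st' : perm_eq s (t1 ++ t2).
  by rewrite -(perm_cons i) (perm_trans st)// perm_sym -cat1s perm_catCA.
rewrite -iter_partial_insert//; last first.
  by have := perm_size st'; rewrite size_cat => <-.
by apply: eq_partial => // x x0; apply: IH => //; exact: ltnW.
Qed.

End smooth.

Section bounds.
Hypothesis phiH : almost_homogeneous alpha phi.

Let phiC : class_C d.+2 [set xi : rV | xi != 0] phi.
Proof. by case: phiH. Qed.

Lemma iter_partial_bound : exists2 B : R, 0 < B & forall s (xi : rV),
  xi != 0 -> (size s <= d.+2)%N ->
  `|iter_partial s phi xi| <= B * enorm xi `^ (alpha - (size s)%:R).
Proof.
have [_ [d1 [d2 [lam [B [[_ _ _ B0] H]]]]]] := phiH.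
exists B => // s xi xi0 sd; have [_ + _] := H xi xi0.
pose gamma := [ffun i => count_mem i s]; move=> /(_ gamma).
pose t := flatten [seq nseq (gamma i) i | i <- enum 'I_d].
have st : perm_eq s t.
  apply/allP => j _ /=; rewrite /t count_flatten -map_comp sumnE big_map.
  rewrite big_enum (bigD1 j)//= count_nseq /= eqxx mul1n ffunE big1 ?addn0//.
  by move=> i /negPf ij; rewrite count_nseq /= ij.
have mt : mlen gamma = size s.
  rewrite (perm_size st) /t size_flatten /shape -map_comp sumnE big_map big_enum.
  by apply: eq_bigr => i _; rewrite /= size_nseq.
by rewrite mt mderivE -/t -(iter_partial_perm phiC xi0 sd st); exact.
Qed.

Lemma symbol_iter_partial (P : Type) k s : (size s + k <= d.+2)%N ->
  symbol invnorm k (fun (_ : P) xi => enorm xi `^ (alpha - (size s)%:R))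
    (fun (_ : P) (xi : rV) => iter_partial s phi xi).
Proof.
have [B B0 HB] := iter_partial_bound.
elim: k s => [|k IH] s sk.
  rewrite addn0 in sk; split=> //.
    by move=> p xi xi0; exact: iter_partial_continuous.
  by exists B => p xi xi0; exact: HB.
have sd : (size s < d.+2)%N by rewrite (leq_trans _ sk)// addnS ltnS leq_addr.
split=> //.
- by move=> p xi xi0; apply: iter_partial_continuous => //; exact: ltnW.
- by exists B => p xi xi0; apply: HB => //; exact: ltnW.
move=> i; exists (fun _ xi => iter_partial (i :: s) phi xi); split.
  by move=> p xi xi0; exact: iter_partial_derive.
apply: (symbol_eqw (A := fun _ xi => enorm xi `^ (alpha - (size (i :: s))%:R))).
  move=> p xi xi0; have N0 := enorm_gt0 xi0.
  rewrite /invnorm -powR_inv1 ?enorm_ge0// -powRD ?(gt_eqF N0) ?implybT//.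
  by congr (_ `^ _); rewrite /= -natr1; ring.
by apply: IH; rewrite /= addSn -addnS.
Qed.

Lemma partial_continuous i (xi : rV) : xi != 0 ->
  {for xi, continuous (partial i phi)}.
Proof. by move=> xi0; apply: (@iter_partial_continuous phiC [:: i]). Qed.

(** Arbitrary directions are needed to compare the gradient at the two ends of a
    segment. *)
Lemma is_derive_gradient_dir j (xi v : rV) : xi != 0 ->
  is_derive xi v (partial j phi) (\sum_i v ord0 i * hessian phi xi i j).
Proof.
move=> xi0; have := @is_derive_dir R d (partial j phi)
  (fun i => iter_partial [:: i; j] phi) xi v.
move=> H; rewrite (eq_bigr (fun i => v ord0 i * iter_partial [:: i; j] phi xi)); last first.
  by move=> i _; rewrite mxE.
apply: H => i.
  apply: filterS (near_neq0 xi0) => x x0.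
  by apply: (@iter_partial_derive phiC [:: j]).
exact: iter_partial_continuous.
Qed.

End bounds.
End phase_derivatives.

(** * Nondegeneracy of the Hessian *)

Section euclidean.
Context {R : realType} {d : nat}.
Local Notation rV := 'rV[R]_d.
Implicit Types (a b v : rV) (M : 'M[R]_d).

Lemma enorm0 : enorm (0 : rV) = 0.
Proof. by rewrite /enorm big1 ?sqrtr0// => i _; rewrite mxE expr0n. Qed.

Lemma enorm_eq0 a : (enorm a == 0) = (a == 0).
Proof.
apply/idP/eqP => [|->]; last by rewrite enorm0.
by apply: contraTeq => /enorm_gt0/lt0r_neq0.
Qed.

Lemma enormZ (c : R) a : enorm (c *: a) = `|c| * enorm a.
Proof.
rewrite /enorm (eq_bigr (fun i => c ^+ 2 * a ord0 i ^+ 2)).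
  by rewrite -mulr_sumr sqrtrM ?sqr_ge0// sqrtr_sqr.
by move=> i _; rewrite mxE exprMn.
Qed.

Lemma dotvv a : dotv a a = enorm a ^+ 2.
Proof. by rewrite sqr_enorm; apply: eq_bigr => i _; rewrite expr2. Qed.

Lemma dotvC a b : dotv a b = dotv b a.
Proof. by apply: eq_bigr => i _; rewrite mulrC. Qed.

Lemma dotvDl a b c : dotv (a + b) c = dotv a c + dotv b c.
Proof. by rewrite -big_split; apply: eq_bigr => i _; rewrite mxE mulrDl. Qed.

Lemma dotvZl (s : R) a b : dotv (s *: a) b = s * dotv a b.
Proof. by rewrite mulr_sumr; apply: eq_bigr => i _; rewrite mxE mulrA. Qed.

Lemma dotvNl a b : dotv (- a) b = - dotv a b.
Proof. by rewrite -scaleN1r dotvZl mulN1r. Qed.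

Lemma dotvDr a b c : dotv a (b + c) = dotv a b + dotv a c.
Proof. by rewrite dotvC dotvDl ![dotv a _]dotvC. Qed.

Lemma dotvZr (s : R) a b : dotv a (s *: b) = s * dotv a b.
Proof. by rewrite dotvC dotvZl dotvC. Qed.

Lemma dotvNr a b : dotv a (- b) = - dotv a b.
Proof. by rewrite dotvC dotvNl dotvC. Qed.

Lemma cauchy_schwarz a b : `|dotv a b| <= enorm a * enorm b.
Proof.
wlog: a / 0 <= dotv a b => [H|ab0].
  have [|/ltW ab] := leP 0 (dotv a b); first exact: H.
  have := H (- a); rewrite dotvNl oppr_ge0 normrN => /(_ ab).
  by rewrite -scaleN1r enormZ normrN1 mul1r.
rewrite ger0_norm//.
have [/eqP|A0] := eqVneq (enorm a) 0.
  rewrite enorm_eq0 => /eqP ->; rewrite enorm0 mul0r.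
  by rewrite /dotv big1// => i _; rewrite mxE mul0r.
have [/eqP|B0] := eqVneq (enorm b) 0.
  rewrite enorm_eq0 => /eqP ->; rewrite enorm0 mulr0.
  by rewrite /dotv big1// => i _; rewrite mxE mulr0.
have A1 : 0 < enorm a by rewrite lt_neqAle eq_sym A0 enorm_ge0.
have B1 : 0 < enorm b by rewrite lt_neqAle eq_sym B0 enorm_ge0.
have := sqr_ge0 (enorm (enorm b *: a - enorm a *: b)).
rewrite -dotvv !(dotvDl, dotvDr, dotvNl, dotvNr, dotvZl, dotvZr) !dotvv [dotv b a]dotvC => H.
have : 0 <= (enorm a * enorm b) * (enorm a * enorm b - dotv a b) by lra.
by rewrite pmulr_rge0 ?mulr_gt0// subr_ge0.
Qed.

Lemma enormD a b : enorm (a + b) <= enorm a + enorm b.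
Proof.
rewrite -(@ler_pXn2r _ 2) ?nnegrE ?addr_ge0 ?enorm_ge0//.
rewrite -dotvv !(dotvDl, dotvDr) !dotvv.
have := le_trans (ler_norm _) (cauchy_schwarz a b).
by rewrite [dotv b a]dotvC; lra.
Qed.

Lemma enormN a : enorm (- a) = enorm a.
Proof. by rewrite -scaleN1r enormZ normrN1 mul1r. Qed.

Lemma enormB a b : enorm (a - b) <= enorm a + enorm b.
Proof. by rewrite (le_trans (enormD _ _))// enormN. Qed.

Lemma mul_mx_dotv M v : (v *m M *m v^T) ord0 ord0 = dotv (v *m M) v.
Proof. by rewrite mxE; apply: eq_bigr => i _; rewrite !mxE. Qed.

(** Row [i] of [invmx M], call it [v], satisfies [v *m M = e_i], so that the form at
    [v] is [v_i] and [mu * |v|^2 <= |v|].  Hence the entries of [invmx M] are at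
    most [mu^-1] in modulus, and its determinant is a sum of [d`!] products of
    [d] of them. *)
Lemma det_ge_form M (mu : R) : 0 < mu ->
  (forall v, mu * enorm v ^+ 2 <= `|(v *m M *m v^T) ord0 ord0|) ->
  mu ^+ d / (d`!)%:R <= `|\det M|.
Proof.
move=> mu0 HM.
have Mu : M \in unitmx.
  rewrite unitmxE unitfE; apply/negP => /det0P[v v0 vM].
  have := HM v; rewrite vM mul0mx mxE normr0 leNgt => /negP; apply.
  by rewrite mulr_gt0// exprn_gt0// enorm_gt0.
have iM i j : `|invmx M i j| <= mu^-1.
  pose v := row i (invmx M).
  have vM : v *m M = delta_mx ord0 i.
    by rewrite -row_mul mulVmx// row1.
  have vij : invmx M i j = v ord0 j by rewrite mxE.
  rewrite vij (le_trans (coord_le_enorm _ _))//.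
  have [->|v0] := eqVneq v 0; first by rewrite enorm0 invr_ge0 ltW.
  have := HM v; rewrite mul_mx_dotv vM.
  have -> : dotv (delta_mx ord0 i) v = v ord0 i.
    rewrite /dotv (bigD1 i)//= mxE !eqxx mul1r big1 ?addr0// => k /negPf ki.
    by rewrite mxE eqxx ki mul0r.
  move=> /le_trans /(_ (coord_le_enorm v i)).
  rewrite expr2 mulrA -{3}[enorm v]mul1r ler_pM2r ?enorm_gt0//.
  by rewrite mulrC -ler_pdivlMr// mul1r.
have : `|\det (invmx M)| <= (d`!)%:R * mu^-1 ^+ d.
  rewrite (le_trans (ler_norm_sum _ _ _))//.
  apply: (@le_trans _ _ (\sum_(s : {perm 'I_d}) mu^-1 ^+ d)).
    apply: ler_sum => s _; rewrite normrM normrX normrN1 expr1n mul1r.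
    rewrite normr_prod -[X in _ ^+ X]card_ord -prodr_const.
    by apply: ler_prod => i _; rewrite normr_ge0 iM.
  have mud : 0 <= mu^-1 ^+ d by rewrite exprn_ge0// invr_ge0 ltW.
  have -> : d`!%:R = #|{perm 'I_d}|%:R :> R by rewrite card_Sn.
  by rewrite sumr_const mulr_natl ler_wpMn2l// max_card.
rewrite det_inv normfV -[X in _ -> _ <= X]invrK => H.
have D0 : 0 < `|\det M| by rewrite normr_gt0 -unitfE -unitmxE.
rewrite -lef_pV2 ?posrE ?divr_gt0 ?exprn_gt0 ?ltr0n ?fact_gt0//; last by rewrite invr_gt0 invr_gt0.
by rewrite invrK invf_div mulrC -exprVn mulrC.
Qed.

End euclidean.

Section hessian_form.
Context {R : realType} {d : nat}.
Local Notation rV := 'rV[R]_d.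
Variables (alpha : R) (phi : rV -> R).
Hypothesis phiH : almost_homogeneous alpha phi.

Lemma hessian_form_ge : exists2 lam : R, 0 < lam & forall xi v : rV,
  xi != 0 -> lam * enorm xi `^ (alpha - 2) * enorm v ^+ 2 <=
  `|(v *m hessian phi xi *m v^T) ord0 ord0|.
Proof.
have [_ [d1 [d2 [lam [B [[_ _ lam0 _] H]]]]]] := phiH.
exists lam => // xi v xi0; have [_ _ {}H] := H xi xi0.
have [->|v0] := eqVneq v 0.
  by rewrite enorm0 expr0n mulr0 normr_ge0.
have N0 := enorm_gt0 v0.
have := H ((enorm v)^-1 *: v).
rewrite enormZ ger0_norm ?invr_ge0 ?enorm_ge0// mulVf ?gt_eqF// => /(_ erefl).
rewrite mul_mx_dotv -scalemxAl dotvZl dotvZr mulrA -mul_mx_dotv.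
rewrite normrM -invfM ger0_norm ?invr_ge0 ?mulr_ge0 ?enorm_ge0//.
by rewrite [X in _ <= X -> _]mulrC ler_pdivlMr ?mulr_gt0// expr2.
Qed.

(** The mean value theorem is applied to the component of the gradient along the
    segment: its derivative is the Hessian form, whose modulus alone enters. *)
Lemma gradient_separates (lam m : R) (xi eta : rV) :
  (forall x v : rV, x != 0 -> lam * enorm x `^ (alpha - 2) * enorm v ^+ 2 <=
     `|(v *m hessian phi x *m v^T) ord0 ord0|) ->
  (forall tau : R, 0 <= tau <= 1 -> tau *: (xi - eta) + eta != 0 /\
     m <= lam * enorm (tau *: (xi - eta) + eta) `^ (alpha - 2)) ->
  m * enorm (xi - eta) <= enorm (gradient phi xi - gradient phi eta).
Proof.
move=> form seg; set v := xi - eta.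
have [->|v0] := eqVneq v 0; first by rewrite enorm0 mulr0 enorm_ge0.
pose G (tau : R) := \sum_j v ord0 j * partial j phi (tau *: v + eta).
have dG (tau : R) : 0 <= tau <= 1 ->
    is_derive tau 1 G ((v *m hessian phi (tau *: v + eta) *m v^T) ord0 ord0).
  move=> /seg[x0 _]; rewrite /G.
  have E : G = (\sum_j (fun tau => v ord0 j * partial j phi (tau *: v + eta))).
    by apply/funext => t; rewrite fct_sumE.
  rewrite -/G E mul_mx_dotv /dotv.
  apply: is_derive_sum => j.
  have := is_deriveZ (v ord0 j) (is_derive_line (is_derive_gradient_dir phiH j v x0)).
  by move/is_derive_eq; apply; rewrite /GRing.scale/= mulrC !mxE.
have [||c] := @MVT_segment R G
  (fun tau => (v *m hessian phi (tau *: v + eta) *m v^T) ord0 ord0) 0 1 ler01.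
- by move=> s; rewrite in_itv/= => /andP[s0 s1]; apply: dG; rewrite !ltW.
- by apply: derivable_within_continuous => s; rewrite in_itv/= => /dG[].
rewrite in_itv/= => /seg[x0 xm] E.
have N0 := enorm_gt0 v0.
rewrite -(ler_pM2r N0) -mulrA -expr2.
apply: le_trans (cauchy_schwarz _ _).
have -> : dotv (gradient phi xi - gradient phi eta) v = G 1 - G 0.
  rewrite /G scale1r scale0r add0r subrK -sumrB; apply: eq_bigr => j _.
  by rewrite !mxE mulrBl mulrC [X in _ - X]mulrC.
rewrite E subr0 mulr1.
apply: le_trans (form _ _ x0).
by rewrite ler_wpM2r// sqr_ge0.
Qed.

End hessian_form.

(** * Integration on tuples *)

Section tuple_integrals.
Context {R : realType}.
Local Notation mR := (measurableTypeR R).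
Local Notation mu n := (lebesgue_tuple R n).
Local Notation leb := (@lebesgue_measure R).

Definition rowof n (u : n.-tuple mR) : 'rV[R]_n := \row_i tnth u i.

Definition punctured n : set (n.-tuple mR) := [set u | rowof u != 0].
Arguments punctured : clear implicits.

Definition box n (I : 'I_n -> set mR) : set (n.-tuple mR) :=
  [set u | forall i, I i (tnth u i)].

Lemma measurable_box n (I : 'I_n -> set mR) :
  (forall i, measurable (I i)) -> measurable (box I).
Proof.
move=> mI; rewrite (_ : box I =
  \big[setI/setT]_(i < n) ((@tnth n mR)^~ i @^-1` I i)).
  apply: bigsetI_measurable => i _; rewrite -[X in measurable X]setTI.
  exact: measurable_tnth.
rewrite -bigcap_seq; apply/seteqP; split => x /= H i; first by move=> _; exact: H.
by apply: H; rewrite /= mem_index_enum.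
Qed.

Lemma measure_box n (I : 'I_n -> set mR) : (forall i, measurable (I i)) ->
  mu n (box I) = (\prod_(i < n) leb (I i))%E.
Proof. exact: lebesgue_tuple_box. Qed.

Lemma setC_punctured n : ~` punctured n = @box n (fun=> [set 0]).
Proof.
apply/seteqP; split => u /=.
  by move=> /negP; rewrite negbK => /eqP/rowP u0 i; have := u0 i; rewrite !mxE.
by move=> u0; apply/negP; rewrite negbK; apply/eqP/rowP => i; rewrite !mxE u0.
Qed.

Lemma measurable_punctured n : measurable (punctured n).
Proof.
by rewrite -[X in measurable X]setCK setC_punctured; apply: measurableC; exact: measurable_box.
Qed.

Lemma punctured_conull n : (0 < n)%N -> mu n (~` punctured n) = 0%E.
Proof.
case: n => // n _; rewrite setC_punctured measure_box//.
by rewrite big_ord_recl lebesgue_measure_set1 mul0e.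
Qed.

(** [f] is the limit of its values at the points with coordinates rounded down to
    multiples of [1 / m], and these approximations take countably many values. *)
Lemma measurable_continuous n (f : 'rV[R]_n -> R) :
  (forall xi, xi != 0 -> {for xi, continuous f}) ->
  measurable_fun (punctured n) (f \o @rowof n).
Proof.
move=> fc.
pose z m (u : n.-tuple mR) : n.-tuple int :=
  [tuple Num.floor (tnth u i * m.+1%:R) | i < n].
pose pt m (k : n.-tuple int) : 'rV[R]_n := \row_i ((tnth k i)%:~R / m.+1%:R).
apply: (@measurable_realfun.measurable_fun_cvg _ _ _ _ (fun m u => f (pt m (z m u)))).
  move=> m; apply: (@measurable_funS _ _ _ _ setT) => // _ B mB; rewrite setTI.
  rewrite (_ : _ @^-1` B = \bigcup_(k : n.-tuple int)
    (if f (pt m k) \in B then z m @^-1` [set k] else set0)).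
    apply: countable_bigcupT_measurable => // k; case: ifP => // _.
    rewrite (_ : _ @^-1` _ = box (fun i => [set x : R |
      (tnth k i)%:~R <= x * m.+1%:R < (tnth k i + 1)%:~R])).
      apply: measurable_box => i.
      rewrite (_ : [set x | _] = `[(tnth k i)%:~R / m.+1%:R, (tnth k i + 1)%:~R / m.+1%:R[%classic).
        exact: measurable_itv.
      by apply/seteqP; split => x /=; rewrite in_itv/= ler_pdivrMr// ltr_pdivlMr.
    apply/seteqP; split => u /=.
      by move=> <- i; rewrite tnth_mktuple; exact: floor_itv.
    move=> H; apply: eq_from_tnth => i; rewrite tnth_mktuple.
    by apply/eqP; rewrite (floor_eq (tnth u i * m.+1%:R : R)); exact: H.
  apply/seteqP; split => u /=.
    by move=> fB; exists (z m u) => //; rewrite mem_set.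
  by move=> [k _]; case: ifP => // /[!inE] fB /= ->.
move=> u u0; have := fc _ u0.
apply: cvg_comp.
apply/cvgrPdist_lt => e e0; near=> m.
rewrite [ltLHS]/Num.Def.normr/= mx_normrE; apply/bigmax_ltP; split => // -[i j] _ /=.
rewrite !mxE tnth_mktuple.
suff : forall r : R, `|r - (Num.floor (r * m.+1%:R))%:~R / m.+1%:R| < e by exact.
move=> r; have m0 : 0 < m.+1%:R :> R by [].
have em : m.+1%:R^-1 < e.
  by near: m; exact: (near_infty_natSinv_lt (PosNum e0)).
have := floor_itv (r * m.+1%:R); rewrite intrD => /andP[f1 f2].
rewrite ger0_norm; last by rewrite subr_ge0 ler_pdivrMr.
apply: le_lt_trans em; rewrite lerBlDr -[X in X + _]mul1r -mulrDl.
by rewrite ler_pdivlMr// addrC ltW.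
Unshelve. all: by end_near. Qed.

Lemma integrable_bounded_box n (f : n.-tuple mR -> R) (M L : R) :
  measurable_fun setT f -> (forall u, `|f u| <= M) ->
  (forall u, (exists i, L < `|tnth u i|) -> f u = 0) ->
  (mu n).-integrable setT (EFin \o f).
Proof.
move=> mf fM f0.
pose B := @box n (fun=> `[- L, L]%classic).
have mB : measurable B by apply: measurable_box => i; exact: measurable_itv.
have -> : EFin \o f = (EFin \o f) \_ B.
  apply/funext => u; rewrite patchE; case: ifPn => //= uB; congr EFin.
  apply: f0; apply: contrapT => H; move/negP: uB; apply; rewrite inE => i /=.
  by rewrite in_itv/= -ler_norml leNgt; apply/negP => Li; apply: H; exists i.
apply/(integrable_mkcond _ mB).1; apply: (@measurable_bounded_integrable _ _ _ (mu n) f B mB).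
- have [r rE] : exists r : R, leb `[- L, L]%classic = r%:E.
    rewrite lebesgue_measure_itv /=; case: ifP => _; last by exists 0.
    by exists (L - (- L)).
  have muB : lebesgue_tuple R n B = (\prod_(i < n) r)%:E.
    rewrite /B measure_box; last by move=> i; exact: measurable_itv.
    by under eq_bigr do rewrite rE; rewrite prodEFin.
  change (lebesgue_tuple R n B < +oo)%E.
  by rewrite muB ltry.
- exact: measurable_funTS.
- exists M; split; first exact: num_real.
  by move=> x Mx u _ /=; apply: le_trans (fM u) _; exact: ltW.
Qed.

Lemma continuous_integral_derive0 (F f : R -> R) (L : R) :
  (forall s : R, is_derive s 1 F (f s)) -> continuous f ->
  (forall s, L < `|s| -> F s = 0 /\ f s = 0) ->
  (\int[leb]_s (f s)%:E = 0)%E.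
Proof.
move=> dF fc f0; pose b : R := `|L| + 1.
have Lb : L < b by rewrite /b (le_lt_trans (ler_norm _))// ltrDl.
have b0 : 0 < b by rewrite /b ltr_wpDl.
transitivity (\int[leb]_(s in `[(- b)%R, b]) (f s)%:E)%E.
  rewrite [RHS]integral_mkcond; apply: eq_integral => s _; rewrite patchE.
  case: ifPn => // sb; congr EFin; have [] := f0 s => //.
  rewrite (lt_trans Lb)// ltNge; apply: contra sb => sb; rewrite inE/=.
  by rewrite in_itv/= -ler_norml.
have bb : - b < b by lra.
rewrite (continuous_FTC2 (F := F))//.
- have [-> _] : F b = 0 /\ f b = 0 by apply: f0; rewrite gtr0_norm.
  have [-> _] : F (- b) = 0 /\ f (- b) = 0 by apply: f0; rewrite normrN gtr0_norm.
  by rewrite subee.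
- exact: continuous_subspaceT.
- have cF : continuous F.
    move=> s; apply: differentiable_continuous; apply/derivable1_diffP.
    by have [] := dF s.
  split; first by move=> s _; have [] := dF s.
  + exact: cvg_at_right_filter (cF _).
  + exact: cvg_at_left_filter (cF _).
- by move=> s _; rewrite derive1E; have [_ ->] := dF s.
Qed.

Definition upd n (u : n.-tuple mR) (j : 'I_n) (s : R) : n.-tuple mR :=
  [tuple (if i == j then s else tnth u i) | i < n].

Lemma upd_cons0 n (x s : R) (t : n.-tuple mR) :
  upd (cons_pair (x, t)) ord0 s = cons_pair (s, t).
Proof.
apply: eq_from_tnth => i; rewrite tnth_mktuple.
by case: (unliftP ord0 i) => [k|] ->; rewrite ?eqxx ?tnth0 ?tnthS.
Qed.

Lemma upd_consS n (x s : R) (t : n.-tuple mR) j :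
  upd (cons_pair (x, t)) (lift ord0 j) s = cons_pair (x, upd t j s).
Proof.
apply: eq_from_tnth => i; rewrite tnth_mktuple.
case: (unliftP ord0 i) => [k|] ->; rewrite ?tnth0 ?tnthS//.
by rewrite (inj_eq lift_inj) tnth_mktuple.
Qed.

Lemma measurable_cons_pairl n (x : R) :
  measurable_fun setT (fun t : n.-tuple mR => cons_pair (x : mR, t)).
Proof. by apply: measurable_cons => /=; [exact: measurable_cst|exact: measurable_id]. Qed.

Lemma integrable_cons_pair n (f : n.+1.-tuple mR -> R) :
  measurable_fun setT f ->
  (mu n.+1).-integrable setT (EFin \o f) ->
  (leb \x mu n)%E.-integrable setT ((EFin \o f) \o @cons_pair R n).
Proof.
move=> mf /integrableP[_ fi]; apply/integrableP; split.
  by apply/measurable_EFinP; apply: measurableT_comp => //; exact: measurable_cons_pair.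
move: fi; rewrite /= ge0_integral_pushforward//=.
- exact: measurable_cons_pair.
- by apply/measurable_EFinP; exact: measurableT_comp.
Qed.

(** Integrating first in the variable of differentiation, each inner integral is the
    increment of a function that vanishes at both ends. *)
Lemma integral_partial0 n (j : 'I_n) (G G' : n.-tuple mR -> R) (M L : R) :
  measurable_fun setT G' -> (forall u, `|G' u| <= M) ->
  (forall u, (exists i, L < `|tnth u i|) -> G u = 0 /\ G' u = 0) ->
  (forall u (s : R), is_derive s 1 (fun s => G (upd u j s)) (G' (upd u j s))) ->
  (forall u, continuous (fun s : R => G' (upd u j s))) ->
  (\int[mu n]_u (G' u)%:E = 0)%E.
Proof.
elim: n j G G' => [[]//|n IH] j G G' mG GM G0 dG cG.
have iG : (mu n.+1).-integrable setT (EFin \o G').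
  by apply: (integrable_bounded_box (L := L) mG GM) => u /G0[].
have iG2 : (leb \x mu n)%E.-integrable setT
    ((EFin \o G') \o @cons_pair R n).
  exact: integrable_cons_pair.
rewrite /= integral_pushforward//=; last 2 first.
  exact: measurable_cons_pair.
  exact: ((measurable_EFinP setT G').2 mG).
rewrite preimage_setT.
case: (unliftP ord0 j) => [k|] jE.
  rewrite -integral12_prod_meas1//=.
  rewrite (eq_integral (fun=> 0%E)) ?integral0// => x _.
  apply: (IH k (fun t => G (cons_pair (x : mR, t))) (fun t => G' (cons_pair (x : mR, t)))) => //.
  - apply: measurableT_comp => //; exact: measurable_cons_pairl.
  - by move=> u [i Li]; apply: G0; exists (lift ord0 i); rewrite tnthS.
  - move=> u s; have := dG (cons_pair (x : mR, u)) s; rewrite jE upd_consS.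
    by under eq_fun do rewrite upd_consS.
  - move=> u; have := cG (cons_pair (x : mR, u)); rewrite jE.
    by under eq_fun do rewrite upd_consS.
rewrite -integral21_prod_meas1//=.
rewrite (eq_integral (fun=> 0%E)) ?integral0// => t _.
apply: (@continuous_integral_derive0 (fun x => G (cons_pair (x, t))) _ L).
- move=> s; have := dG (cons_pair (0 : mR, t)) s; rewrite jE upd_cons0.
  by under eq_fun do rewrite upd_cons0.
- have := cG (cons_pair (0 : mR, t)); rewrite jE.
  by under eq_fun do rewrite upd_cons0.
- by move=> s Ls; apply: G0; exists ord0; rewrite tnth0.
Qed.

(** Near a stationary point the integrand is dominated by a product of profiles in
    the single coordinates. *)
Lemma integral_prod_tuple n (f : 'I_n -> R -> R) :
  (forall i, measurable_fun setT (f i)) -> (forall i x, 0 <= f i x) ->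
  (\int[mu n]_u (\prod_(i < n) f i (tnth u i))%:E =
   \prod_(i < n) \int[leb]_x (f i x)%:E)%E.
Proof.
elim: n f => [|n IH] f mf f0.
  rewrite big_ord0 /= integral_dirac//.
    by rewrite diracT mul1e big_ord0.
  by under eq_fun do rewrite big_ord0; exact: measurable_cst.
have mp : measurable_fun setT (fun u : n.+1.-tuple mR => \prod_(i < n.+1) f i (tnth u i)).
  apply: measurable_prod => i _.
  by apply: measurableT_comp; [exact: mf|exact: measurable_tnth].
have mp' : measurable_fun setT (fun u : n.-tuple mR => \prod_(i < n) f (lift ord0 i) (tnth u i)).
  apply: measurable_prod => i _.
  by apply: measurableT_comp; [exact: mf|exact: measurable_tnth].
have mEp := (measurable_EFinP setT _).2 mp.
have mEp' := (measurable_EFinP setT _).2 mp'.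
rewrite /= ge0_integral_pushforward//; last 2 first.
- exact: measurable_cons_pair.
- by move=> u _; rewrite lee_fin prodr_ge0.
rewrite preimage_setT fubini_tonelli1//=; last 2 first.
- exact: (measurableT_comp mEp (@measurable_cons_pair R n)).
- by move=> u; rewrite lee_fin prodr_ge0.
rewrite big_ord_recl -IH//.
have I0 : (0 <= \int[mu n]_u (\prod_(i < n) f (lift ord0 i) (tnth u i))%:E)%E.
  by apply: integral_ge0 => u _; rewrite lee_fin prodr_ge0.
have mf0 := (measurable_EFinP setT _).2 (mf ord0).
rewrite muleC -ge0_integralZl//; last by move=> x _; rewrite lee_fin.
apply: eq_integral => x _; rewrite muleC -ge0_integralZl//; last 2 first.
- by move=> u _; rewrite lee_fin prodr_ge0.
- by rewrite lee_fin.
apply: eq_integral => t _; rewrite /= big_ord_recl tnth0 EFinM.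
by congr (_ * (_)%:E)%E; apply: eq_bigr => i _; rewrite tnthS.
Qed.

End tuple_integrals.

(** * Integration by parts away from the origin *)

Section annular.
Context {R : realType} {d : nat}.
Local Notation rV := 'rV[R]_d.
Local Notation e_ i := (delta_mx ord0 i : 'rV[R]_d).
Local Notation mR := (measurableTypeR R).
Local Notation mu := (lebesgue_tuple R d).
Local Notation D := (@punctured R d).
Implicit Types f g : rV -> R.

Definition vanishes_outside (dl L : R) f :=
  forall xi : rV, xi != 0 -> enorm xi < dl \/ L < enorm xi -> f xi = 0.

(** Parts are integrated for these functions only, as they avoid both the singularity
    at the origin and infinity.  The value at the origin itself is arbitrary. *)
Definition annular f :=
  (forall xi : rV, xi != 0 -> {for xi, continuous f}) /\
  exists2 dl : R, 0 < dl & exists L : R, vanishes_outside dl L f.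

Lemma annular_mul f g : (forall xi : rV, xi != 0 -> {for xi, continuous f}) ->
  annular g -> annular (fun xi => f xi * g xi).
Proof.
move=> cf [cg [dl dl0 [L gL]]]; split.
  by move=> xi xi0; apply: cont_mul; [exact: cf|exact: cg].
by exists dl => //; exists L => xi xi0 /gL -> //; rewrite mulr0.
Qed.

Lemma annular_add f g : annular f -> annular g ->
  annular (fun xi => f xi + g xi).
Proof.
move=> [cf [dl dl0 [L fL]]] [cg [dl' dl0' [L' gL]]]; split.
  by move=> xi xi0; apply: cont_add; [exact: cf|exact: cg].
exists (Num.min dl dl'); first by rewrite lt_min dl0.
exists (Num.max L L') => xi xi0; rewrite lt_min gt_max => H.
rewrite fL ?gL ?addr0//; first by case: H => /andP[]; [left|right].
by case: H => /andP[]; [left|right].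
Qed.

Lemma annular_sum (I : Type) (s : seq I) (F : I -> rV -> R) :
  (forall i, annular (F i)) -> annular (fun xi => \sum_(i <- s) F i xi).
Proof.
move=> aF; elim: s => [|i s IH].
  rewrite (_ : (fun _ => _) = fun=> 0); last by apply/funext => x; rewrite big_nil.
  split; first by move=> xi _; exact: cont_cst.
  by exists 1 => //; exists 0.
rewrite (_ : (fun _ => _) = fun xi => F i xi + \sum_(j <- s) F j xi).
  exact: annular_add.
by apply/funext => x; rewrite big_cons.
Qed.

Lemma norm_le_enorm (xi : rV) : `|xi| <= enorm xi.
Proof.
rewrite [leLHS]/Num.Def.normr/= mx_normrE; apply/bigmax_leP; split => /=.
  exact: enorm_ge0.
by move=> [i j] _ /=; rewrite ord1; exact: coord_le_enorm.
Qed.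

Lemma annular_bounded f : annular f ->
  exists M : R, forall xi : rV, xi != 0 -> `|f xi| <= M.
Proof.
move=> [cf [dl dl0 [L fL]]].
pose K := [set xi : rV | dl <= enorm xi <= L].
have K0 xi : K xi -> xi != 0.
  by move=> /andP[+ _]; apply: contraTneq => ->; rewrite enorm0 -ltNge.
have cK : compact K.
  apply: bounded_closed_compact.
    exists L; split; first exact: num_real.
    move=> M LM xi /andP[_ xiL]; apply: le_trans (norm_le_enorm xi) _.
    by rewrite (le_trans xiL)// ltW.
  rewrite (_ : K = enorm @^-1` [set` `[dl, L]%R]); last first.
    by apply/seteqP; split => xi /=; rewrite in_itv.
  apply: preimage_closed; last exact: (@interval_closed R (BLeft dl) (BRight L)).
  by move=> xi _; exact: continuous_enorm.
have cfK : {within K, continuous f}.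
  by apply: continuous_in_subspaceT => xi; rewrite inE => /K0; exact: cf.
have [M [_ HM]] := compact_bounded (continuous_compact cfK cK).
exists (Num.max (M + 1) 0) => xi xi0.
have [xiK|xiK] := pselect (K xi).
  by rewrite le_max HM ?ltrDl//; exists xi.
rewrite fL ?normr0 ?le_max ?lexx ?orbT//.
move: xiK; rewrite /K /= => /negP; rewrite negb_and -!ltNge => /orP[]; by [left|right].
Qed.

Definition zero_at0 f : rV -> R := fun xi => if xi == 0 then 0 else f xi.

Lemma zero_at0_restrict f : zero_at0 f \o @rowof R d = (f \o @rowof R d) \_ D.
Proof.
apply/funext => u; rewrite patchE /zero_at0 /=; case: ifPn => [/eqP u0|u0].
  by case: ifPn => //; rewrite inE /punctured /= u0 eqxx.
by case: ifPn => //; rewrite notin_setE /punctured /= u0.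
Qed.

Lemma measurable_zero_at0 f : (forall xi : rV, xi != 0 -> {for xi, continuous f}) ->
  measurable_fun setT (zero_at0 f \o @rowof R d).
Proof.
move=> cf; rewrite zero_at0_restrict.
exact: ((measurable_restrictT _ (@measurable_punctured R d)).1
  (measurable_continuous cf)).
Qed.

Lemma annular_box f : annular f -> exists L : R, forall u : d.-tuple mR,
  (exists i, L < `|tnth u i|) -> zero_at0 f (rowof u) = 0.
Proof.
move=> [_ [dl _ [L fL]]]; exists L => u [i Li].
rewrite /zero_at0; case: ifPn => // u0; apply: fL => //; right.
by apply: lt_le_trans (coord_le_enorm _ i); rewrite mxE.
Qed.

Lemma annular_zero_bounded f : annular f -> exists M : R, forall u : d.-tuple mR,
  `|zero_at0 f (rowof u)| <= M.
Proof.
move=> af; have [M fM] := annular_bounded af; exists (Num.max M 0) => u.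
rewrite /zero_at0; case: ifPn => u0; first by rewrite normr0 le_max lexx orbT.
by rewrite le_max fM.
Qed.

Lemma annular_integrable f : annular f ->
  mu.-integrable D (EFin \o (f \o @rowof R d)).
Proof.
move=> /[dup] af [cf _].
have [L fL] := annular_box af; have [M fM] := annular_zero_bounded af.
apply/(integrable_mkcond _ (@measurable_punctured R d)).2.
rewrite restrict_EFin -zero_at0_restrict.
exact: integrable_bounded_box (measurable_zero_at0 cf) fM fL.
Qed.

Lemma near0_enorm (dl : R) : 0 < dl -> \forall xi \near (0 : rV), enorm xi < dl.
Proof.
move=> dl0; have /cvgr_lt := @continuous_enorm R d 0.
by apply; rewrite enorm0.
Qed.

Lemma cont_near f g (xi : rV) : {for xi, continuous f} ->
  (\forall x \near xi, f x = g x) -> {for xi, continuous g}.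
Proof.
move=> cf fg; rewrite /prop_for /continuous_at -(nbhs_singleton fg).
by apply: cvg_trans cf; exact: (near_eq_cvg fg).
Qed.

Lemma is_derive_locally0 f xi v : (\forall x \near xi, f x = 0) ->
  is_derive xi v f 0.
Proof.
move=> H; apply: (@near_eq_is_derive _ _ _ (cst 0)).
by apply: filterS H => x ->.
Qed.

(** The extension of [f] by zero to the origin is differentiable everywhere and has
    compact support, so there are no boundary terms. *)
Lemma integral_partial_annular j f g : annular f ->
  (forall xi : rV, xi != 0 -> {for xi, continuous g}) ->
  (forall xi : rV, xi != 0 -> is_derive xi (e_ j) f (g xi)) ->
  annular g /\ \int[mu]_(u in D) g (rowof u) = 0.
Proof.
move=> /[dup] af [cf [dl dl0 [L fL]]] cg dg.
have gL : vanishes_outside dl L g.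
  move=> xi xi0 xiL; have [_ <-] := dg xi xi0.
  suff /(is_derive_locally0 (e_ j))[] : \forall x \near xi, f x = 0 by [].
  have cN := @continuous_enorm R d xi.
  case: xiL => xiL.
    have : \forall x \near xi, enorm x < dl by move/cvgr_lt : cN; exact.
    by apply: filterS2 (near_neq0 xi0) => x x0 xd; apply: fL => //; left.
  have : \forall x \near xi, L < enorm x by move/cvgr_gt : cN; exact.
  by apply: filterS2 (near_neq0 xi0) => x x0 xd; apply: fL => //; right.
have ag : annular g by split=> //; exists dl => //; exists L.
split=> //.
have z0 (h : rV -> R) : vanishes_outside dl L h -> \forall x \near (0 : rV), zero_at0 h x = 0.
  move=> hL; apply: filterS (near0_enorm dl0) => x xd.
  by rewrite /zero_at0; case: ifPn => // x0; apply: hL => //; left.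
have zn (h : rV -> R) (xi : rV) : xi != 0 -> \forall x \near xi, h x = zero_at0 h x.
  by move=> /near_neq0; apply: filterS => x /negPf x0; rewrite /zero_at0 x0.
have dz (xi : rV) : is_derive xi (e_ j) (zero_at0 f) (zero_at0 g xi).
  have [->|xi0] := eqVneq xi 0.
    rewrite {2}/zero_at0 eqxx; apply: is_derive_locally0; exact: (z0 _ fL).
  apply: (near_eq_is_derive (zn f xi xi0)).
  by rewrite /zero_at0 (negPf xi0); exact: dg.
have cz (xi : rV) : {for xi, continuous (zero_at0 g)}.
  have [->|xi0] := eqVneq xi 0.
    apply: (@cont_near (fun=> 0)); first exact: cont_cst.
    by apply: filterS (z0 _ gL) => x ->.
  by apply: (cont_near (cg xi xi0)); exact: zn.
have [Lf HLf] := annular_box af; have [Lg HLg] := annular_box ag.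
have [M gM] := annular_zero_bounded ag.
have line (u : d.-tuple mR) (s : R) : rowof (upd u j s) =
    s *: e_ j + rowof (upd u j 0).
  apply/rowP => i; rewrite !mxE !tnth_mktuple eqxx /=.
  by case: eqVneq => _ /=; rewrite ?mulr1 ?addr0 ?mulr0 ?add0r.
rewrite /Rintegral integral_mkcond (eq_integral (fun u => (zero_at0 g (rowof u))%:E)); last first.
  move=> u _; rewrite patchE /zero_at0; case: ifPn => uD.
    by move: uD; rewrite inE /punctured /= => /negPf ->.
  by move: uD; rewrite notin_setE /punctured /= => /negP; rewrite negbK => ->.
suff -> : (\int[mu]_u (zero_at0 g (rowof u))%:E = 0)%E by [].
apply: (@integral_partial0 _ _ j (zero_at0 f \o @rowof R d)
  (zero_at0 g \o @rowof R d) M (Num.max Lf Lg)) => //.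
- exact: measurable_zero_at0.
- move=> u [i +]; rewrite gt_max => /andP[i1 i2].
  by split; [apply: HLf; exists i|apply: HLg; exists i].
- move=> u s /=; rewrite line.
  rewrite (_ : (fun t => _) = (fun t : R => zero_at0 f (t *: e_ j + rowof (upd u j 0)))).
    exact: is_derive_line.
  by apply/funext => t; rewrite line.
- move=> u.
  rewrite (_ : (fun s => _) = (fun t : R => zero_at0 g (t *: e_ j + rowof (upd u j 0)))).
    move=> s; apply: (@continuous_comp _ _ _ (fun t : R => t *: e_ j + rowof (upd u j 0))); last exact: cz.
    by apply: cvgD; [apply: cvgZr_tmp; exact: cvg_id|exact: cvg_cst].
  by apply/funext => t /=; rewrite line.
Qed.

Lemma annular_integralD f g : annular f -> annular g ->
  \int[mu]_(u in D) (f (rowof u) + g (rowof u)) =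
  \int[mu]_(u in D) f (rowof u) + \int[mu]_(u in D) g (rowof u).
Proof.
by move=> af ag; apply: RintegralD;
  [exact: measurable_punctured|exact: annular_integrable..].
Qed.

Lemma annular_integral_sum (I : Type) (s : seq I) (F : I -> rV -> R) :
  (forall i, annular (F i)) ->
  \int[mu]_(u in D) (\sum_(i <- s) F i (rowof u)) =
  \sum_(i <- s) \int[mu]_(u in D) F i (rowof u).
Proof.
move=> aF; elim: s => [|i s IH].
  rewrite big_nil; under eq_Rintegral do rewrite big_nil.
  by rewrite Rintegral_cst ?mul0r//; exact: measurable_punctured.
rewrite big_cons -IH.
rewrite -(annular_integralD (g := fun xi => \sum_(j <- s) F j xi))//; last exact: annular_sum.
by under eq_Rintegral do rewrite big_cons.
Qed.

End annular.

(** * The phase: size, gain and cost *)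

Section phase.
Context {R : realType} {d : nat}.
Local Notation rV := 'rV[R]_d.
Local Notation e_ i := (delta_mx ord0 i : 'rV[R]_d).
Variables (alpha : R) (phi : rV -> R).
Implicit Types (x xi : rV) (t : R).

Definition phase_gradient x t xi : rV := x + t *: gradient phi xi.

(** The size of the phase on the dyadic shell of [xi], made at least one. *)
Definition phase_size x t xi : R := 1 + `|t| * enorm xi `^ alpha + enorm x * enorm xi.

(** The factor [w] by which one integration by parts improves the amplitude, namely
    [1 + h * |grad psi|^2] with [h = |xi|^2 / phase_size]: of the size of the phase
    where the phase is not stationary, and one at its stationary points. *)
Definition ibp_gain x t xi : R :=
  1 + enorm xi ^+ 2 / phase_size x t xi * enorm (phase_gradient x t xi) ^+ 2.

Lemma phase_size_ge1 x t xi : 1 <= phase_size x t xi.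
Proof. by rewrite /phase_size -addrA lerDl addr_ge0// mulr_ge0 ?powR_ge0 ?enorm_ge0. Qed.

Lemma phase_size_gt0 x t xi : 0 < phase_size x t xi.
Proof. exact: lt_le_trans ltr01 (phase_size_ge1 _ _ _). Qed.

Lemma ibp_gain_ge1 x t xi : 1 <= ibp_gain x t xi.
Proof.
by rewrite /ibp_gain lerDl mulr_ge0 ?divr_ge0 ?sqr_ge0// ltW// phase_size_gt0.
Qed.

Lemma ibp_gain_gt0 x t xi : 0 < ibp_gain x t xi.
Proof. exact: lt_le_trans ltr01 (ibp_gain_ge1 _ _ _). Qed.

Hypothesis phiH : almost_homogeneous alpha phi.

Lemma enorm_powRM (xi : rV) (r s : R) : xi != 0 ->
  enorm xi `^ r * enorm xi `^ s = enorm xi `^ (r + s).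
Proof. by move=> xi0; rewrite powRD// (gt_eqF (enorm_gt0 xi0)) implybT. Qed.

Lemma ibp_gain_le : exists2 K : R, 0 < K & forall x t xi, xi != 0 ->
  ibp_gain x t xi <= K * phase_size x t xi.
Proof.
have [_ [d1 [d2 [lam [B [[_ d20 _ _] H]]]]]] := phiH.
exists (1 + (1 + d2) ^+ 2); first by rewrite ltr_wpDr// sqr_ge0.
move=> x t xi xi0; have [/andP[_ gle] _ _] := H xi xi0.
set S := phase_size x t xi; set G := enorm (phase_gradient x t xi).
have S1 : 1 <= S := phase_size_ge1 x t xi.
have S0 : 0 < S := phase_size_gt0 x t xi.
have NG : enorm xi * G <= (1 + d2) * S.
  have : G <= enorm x + `|t| * (d2 * enorm xi `^ (alpha - 1)).
    rewrite (le_trans (enormD _ _))// enormZ lerD2l ler_wpM2l//.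
  move/(ler_wpM2l (enorm_ge0 xi))/le_trans; apply.
  have -> : enorm xi * (enorm x + `|t| * (d2 * enorm xi `^ (alpha - 1))) =
    enorm x * enorm xi + d2 * (`|t| * enorm xi `^ alpha).
    have <- : enorm xi `^ 1 * enorm xi `^ (alpha - 1) = enorm xi `^ alpha.
      by rewrite enorm_powRM//; congr (_ `^ _); ring.
    by rewrite powRr1 ?enorm_ge0//; ring.
  rewrite /S /phase_size.
  have := mulr_ge0 (normr_ge0 t) (powR_ge0 (enorm xi) alpha).
  have := mulr_ge0 (enorm_ge0 x) (enorm_ge0 xi).
  move: (_ * enorm xi) (_ * _ `^ _) => u v u0 v0.
  have := mulr_ge0 (ltW d20) u0; lra.
rewrite /ibp_gain -/S -/G mulrDl mul1r lerD//.
rewrite mulrAC ler_pdivrMr// -exprMn -mulrA -expr2 -exprMn.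
have D0 : 0 <= (1 + d2) * S by apply: mulr_ge0; lra.
by rewrite ler_pXn2r ?nnegrE// mulr_ge0 ?enorm_ge0.
Qed.

Section families.
Variables (P : Type) (kap T : P -> R) (X : P -> rV).

Local Notation S := (fun p xi => phase_size (X p) (T p) xi).
Local Notation w := (fun p xi => ibp_gain (X p) (T p) xi).
Local Notation rho := (fun p xi => Num.sqrt (ibp_gain (X p) (T p) xi / phase_size (X p) (T p) xi)).
Local Notation h := (fun p xi => enorm xi ^+ 2 / phase_size (X p) (T p) xi).

(** The length [|xi| * rho] is the scale on which the gain varies: at a stationary
    point it is [|xi| / sqrt phase_size], the width of the stationary region.  The
    factor [1 + |kappa|] pays for the imaginary power of the determinant. *)
Definition ibp_cost (p : P) (xi : rV) : R :=
  (1 + `|kap p|) * ((enorm xi)^-1 * (rho p xi)^-1).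

Lemma rho_gt0 p xi : 0 < rho p xi.
Proof. by rewrite sqrtr_gt0 divr_gt0 ?ibp_gain_gt0 ?phase_size_gt0. Qed.

Lemma sqr_rho p xi : rho p xi ^+ 2 = w p xi / S p xi.
Proof. by rewrite sqr_sqrtr// divr_ge0 ?ltW ?ibp_gain_gt0 ?phase_size_gt0. Qed.

Lemma kap_ge1 p : 1 <= 1 + `|kap p|.
Proof. by rewrite lerDl. Qed.

Lemma ibp_cost_ge0 p xi : 0 <= ibp_cost p xi.
Proof.
by rewrite !mulr_ge0 ?invr_ge0 ?enorm_ge0 ?ltW ?rho_gt0// ltr_wpDr.
Qed.

Lemma invnorm_le_cost : exists K : R, forall p xi, xi != 0 ->
  0 <= @invnorm R d P p xi <= K * ibp_cost p xi.
Proof.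
have [K K0 HK] := ibp_gain_le.
exists (Num.sqrt K) => p xi xi0; rewrite invnorm_ge0 /=.
have N0 := enorm_gt0 xi0.
have r0 := rho_gt0 p xi.
rewrite /invnorm /ibp_cost.
apply: (@le_trans _ _ (Num.sqrt K * ((enorm xi)^-1 * (rho p xi)^-1))).
  rewrite mulrCA ler_peMr ?invr_ge0 ?enorm_ge0//.
  rewrite ler_pdivlMr ?rho_gt0// mul1r ler_wsqrtr//.
  by rewrite ler_pdivrMr ?phase_size_gt0// HK.
rewrite [leRHS]mulrCA ler_peMl ?kap_ge1// mulr_ge0 ?sqrtr_ge0//.
by rewrite mulr_ge0 ?invr_ge0 ?enorm_ge0 ?ltW.
Qed.

Lemma symbol_cost k A f : (forall p xi, xi != 0 -> 0 <= A p xi) ->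
  symbol (@invnorm R d P) k A f -> symbol ibp_cost k A f.
Proof.
move=> A0; have [K HK] := invnorm_le_cost.
by apply: (@symbol_le _ _ _ _ _ _ _ _ _ 1 K) => // p xi xi0; rewrite mul1r A0//=.
Qed.

Lemma symbol_phase_size k : symbol (@invnorm R d P) k S S.
Proof.
have S0 p xi : xi != 0 -> 0 <= S p xi by rewrite ltW ?phase_size_gt0.
have i0 p xi : xi != 0 -> 0 <= @invnorm R d P p xi by rewrite invnorm_ge0.
have le1 (A : P -> rV -> R) f : (forall p xi, xi != 0 -> 0 <= A p xi <= S p xi) ->
    symbol (@invnorm R d P) k A f -> symbol (@invnorm R d P) k S f.
  move=> AS; apply: (@symbol_le _ _ _ _ _ _ _ _ _ 1 1) => p xi xi0; rewrite mul1r ?AS//.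
  by rewrite i0//=.
have tN p xi : 0 <= `|T p| * enorm xi `^ alpha by rewrite mulr_ge0 ?powR_ge0.
have xN p xi : 0 <= enorm (X p) * enorm xi by rewrite mulr_ge0 ?enorm_ge0.
apply: symbol_add; first apply: symbol_add.
- apply: (@symbol_cst _ _ _ _ _ _ (fun=> 1) 1) => // p xi xi0.
  by rewrite normr1 mul1r phase_size_ge1.
- apply: (le1 (fun p xi => `|T p| * enorm xi `^ alpha)).
    move=> p xi xi0; rewrite tN /phase_size /=.
    by have := xN p xi; lra.
  apply: (symbol_mul (A := fun p _ => `|T p|)); last exact: symbol_enorm_powR.
  apply: (@symbol_cst _ _ _ _ _ _ (fun p => `|T p|) 1) => // p xi xi0.
  by rewrite normr_id mul1r.
- apply: (le1 (fun p xi => enorm (X p) * enorm xi)).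
    move=> p xi xi0; rewrite xN /phase_size /=.
    by have := tN p xi; lra.
  apply: (symbol_mul (A := fun p _ => enorm (X p)) (B := fun _ xi => enorm xi)).
    apply: (@symbol_cst _ _ _ _ _ _ (fun p => enorm (X p)) 1) => // p xi xi0.
      exact: enorm_ge0.
    by rewrite mul1r ger0_norm ?enorm_ge0.
  have := @symbol_enorm_powR R d P k 1.
  rewrite (_ : (fun=> _) = (fun (_ : P) (xi : rV) => enorm xi))//.
  by apply/funext => p; apply/funext => xi; rewrite powRr1 ?enorm_ge0.
Qed.

Lemma symbol_h k : symbol (@invnorm R d P) k h h.
Proof.
apply: (symbol_mul (A := fun p xi => enorm xi ^+ 2) (B := fun p xi => (S p xi)^-1)).
  have := @symbol_enorm_powR R d P k 2.
  rewrite (_ : (fun=> _) = (fun (_ : P) (xi : rV) => enorm xi ^+ 2))//.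
  by apply/funext => p; apply/funext => xi; rewrite powR_mulrn ?enorm_ge0.
apply: (symbol_inv (c := 1)) (symbol_phase_size k) => //.
- by move=> p xi _; rewrite phase_size_gt0.
- by move=> p xi _; rewrite mul1r ler_norm.
Qed.

Definition gradient_weight (p : P) (xi : rV) : R := S p xi * (enorm xi)^-1 * rho p xi.

Lemma gradient_weight_ge0 p xi : 0 <= gradient_weight p xi.
Proof.
by rewrite /gradient_weight !mulr_ge0 ?invr_ge0 ?enorm_ge0 ?ltW ?rho_gt0 ?phase_size_gt0.
Qed.

(** The gradient itself is small where [ibp_gain] is small, but its derivatives need
    not be; this is the reason for the factor [rho] in [ibp_cost]. *)
Lemma symbol_phase_gradient j k : (k <= d.+1)%N ->
  symbol ibp_cost k gradient_weight
    (fun p xi => phase_gradient (X p) (T p) xi ord0 j).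
Proof.
move=> kd.
have gc p xi : xi != 0 ->
    {for xi, continuous (fun xi => phase_gradient (X p) (T p) xi ord0 j)}.
  move=> xi0; apply: (@cont_eq _ _ (fun xi => X p ord0 j + T p * partial j phi xi)).
    by move=> y; rewrite !mxE.
  apply: cont_add; first exact: cont_cst.
  apply: cont_mul; first exact: cont_cst.
  exact: (partial_continuous phiH xi0).
have gb : exists C, forall p xi, xi != 0 ->
    `|phase_gradient (X p) (T p) xi ord0 j| <= C * gradient_weight p xi.
  exists 1 => p xi xi0; rewrite mul1r (le_trans (coord_le_enorm _ _))//.
  have N0 := enorm_gt0 xi0.
  rewrite -(@ler_pXn2r _ 2) ?nnegrE ?enorm_ge0 ?gradient_weight_ge0//.
  rewrite /gradient_weight !exprMn sqr_rho.
  have S0 := phase_size_gt0 (X p) (T p) xi.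
  have SN := lt0r_neq0 S0; have NN := lt0r_neq0 N0.
  rewrite (_ : _ * (_ / _) = w p xi * (S p xi / enorm xi ^+ 2)); last first.
    by field; rewrite SN NN.
  set G := enorm _.
  apply: (@le_trans _ _ ((enorm xi ^+ 2 / S p xi * G ^+ 2) * (S p xi / enorm xi ^+ 2))).
    by rewrite le_eqVlt; apply/orP; left; apply/eqP; field; rewrite SN NN.
  rewrite ler_wpM2r ?divr_ge0 ?sqr_ge0 ?(ltW S0)//.
  by rewrite /ibp_gain lerDr.
case: k kd => [|k] kd; split=> //.
move=> i; exists (fun p xi => T p * iter_partial [:: i; j] phi xi); split.
  move=> p xi xi0.
  have dphi : is_derive xi (e_ i) (partial j phi) (iter_partial [:: i; j] phi xi).
    have [phiC _] := phiH.
    by apply: (@iter_partial_derive _ _ _ phiC [:: j]).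
  have := deriveF_add (deriveF_cst (X p ord0 j) xi (e_ i))
    (deriveF_mul (deriveF_cst (T p) xi (e_ i)) dphi).
  rewrite mul0r !add0r (_ : (fun _ => _) = (fun xi => phase_gradient (X p) (T p) xi ord0 j))//.
  by apply/funext => y; rewrite !mxE.
have [K HK] := invnorm_le_cost.
apply: (@symbol_le _ _ _ (@invnorm R d P) _ _ (fun p xi => `|T p| * enorm xi `^ (alpha - 2)) _ _ 1 K) => //.
  move=> p xi xi0; have N0 := enorm_gt0 xi0.
  rewrite mulr_ge0 ?powR_ge0//= mul1r /gradient_weight /ibp_cost.
  have r0 := rho_gt0 p xi.
  rewrite (_ : _ * _ * _ * _ = (1 + `|kap p|) * (S p xi * (enorm xi)^-1 ^+ 2)); last first.
    by field; rewrite !lt0r_neq0.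
  apply: (@le_trans _ _ (S p xi * (enorm xi)^-1 ^+ 2)); last first.
    by rewrite ler_peMl ?kap_ge1// mulr_ge0 ?exprn_ge0 ?invr_ge0 ?enorm_ge0 ?ltW ?phase_size_gt0.
  rewrite exprVn ler_pdivlMr ?exprn_gt0// -mulrA.
  rewrite -powR_mulrn ?enorm_ge0// enorm_powRM// subrK.
  by rewrite /phase_size; have := mulr_ge0 (enorm_ge0 (X p)) (enorm_ge0 xi); lra.
apply: (symbol_mul (A := fun p _ => `|T p|)).
  apply: (@symbol_cst _ _ _ _ _ _ T 1) => //.
    by move=> *; rewrite invnorm_ge0.
  by move=> *; rewrite mul1r.
by apply: (@symbol_iter_partial _ _ _ _ phiH P k [:: i; j]).
Qed.

Lemma symbol_ibp_gain k : (k <= d.+1)%N -> symbol ibp_cost k w w.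
Proof.
move=> kd.
have cost0 p xi : xi != 0 -> 0 <= ibp_cost p xi by rewrite ibp_cost_ge0.
apply: symbol_add.
  apply: (@symbol_cst _ _ _ _ _ _ (fun=> 1) 1) => //.
    by move=> p xi _; rewrite ltW ?ibp_gain_gt0.
  by move=> p xi _; rewrite normr1 mul1r ibp_gain_ge1.
have h0 p xi : xi != 0 -> 0 <= h p xi.
  by move=> _; rewrite divr_ge0 ?sqr_ge0// ltW ?phase_size_gt0.
apply: (symbol_eqw (A := fun p xi => h p xi * (gradient_weight p xi * gradient_weight p xi))).
  move=> p xi xi0; rewrite /gradient_weight.
  have S0 := lt0r_neq0 (phase_size_gt0 (X p) (T p) xi).
  have N0 := lt0r_neq0 (enorm_gt0 xi0).
  have r2 : rho p xi ^+ 2 = w p xi / S p xi := sqr_rho p xi.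
  move: (rho p xi) r2 => r r2.
  transitivity (h p xi * (S p xi * (enorm xi)^-1) ^+ 2 * r ^+ 2); first by ring.
  by rewrite r2; field; rewrite S0 N0.
apply: (symbol_mul (A := h)); first exact: symbol_cost (symbol_h k).
rewrite (_ : (fun p xi => enorm (phase_gradient (X p) (T p) xi) ^+ 2) =
  (fun p xi => \sum_j phase_gradient (X p) (T p) xi ord0 j * phase_gradient (X p) (T p) xi ord0 j)); last first.
  apply/funext => p; apply/funext => xi; rewrite sqr_enorm.
  by apply: eq_bigr => j _; rewrite expr2.
apply: symbol_sum => //.
  by move=> p xi _; rewrite mulr_ge0 ?gradient_weight_ge0.
by move=> j; apply: symbol_mul; exact: symbol_phase_gradient.
Qed.

Lemma symbol_ibp_gainV k : (k <= d.+1)%N ->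
  symbol ibp_cost k (fun p xi => (w p xi)^-1) (fun p xi => (w p xi)^-1).
Proof.
move=> kd; apply: (symbol_inv (c := 1)) (symbol_ibp_gain kd) => //.
- by move=> p xi _; exact: ibp_gain_gt0.
- by move=> p xi _; rewrite mul1r ler_norm.
Qed.

End families.
End phase.

(** * Repeated integration by parts *)

Section oscillation.
Context {R : realType} {d : nat}.
Local Notation rV := 'rV[R]_d.
Local Notation e_ i := (delta_mx ord0 i : 'rV[R]_d).
Local Notation mR := (measurableTypeR R).
Local Notation mu := (lebesgue_tuple R d).
Local Notation D := (@punctured R d).
Variables (alpha : R) (phi : rV -> R).
Hypothesis phiH : almost_homogeneous alpha phi.
Variables (P : Type) (kap T : P -> R) (X : P -> rV).
Local Notation family := (P -> 'rV[R]_d -> R).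

Local Notation w := (fun p xi => ibp_gain alpha phi (X p) (T p) xi).
Local Notation h := (fun p xi => enorm xi ^+ 2 / phase_size alpha (X p) (T p) xi).
Local Notation grad := (fun p xi => phase_gradient phi (X p) (T p) xi).
Local Notation cost := (ibp_cost alpha phi kap T X).

Definition phase (x : rV) (t : R) (xi : rV) : R := dotv x xi + t * phi xi.

Lemma continuous_phase x t xi : xi != 0 -> {for xi, continuous (phase x t)}.
Proof.
move=> xi0; apply: cont_add.
  by apply: cont_sum => i; apply: cont_mul; [exact: cont_cst|exact: cont_coord].
apply: cont_mul; first exact: cont_cst.
have [phiC _] := phiH.
exact: (iter_partial_continuous phiC (s := [::]) xi0).
Qed.

Lemma is_derive_phase x t xi j : xi != 0 ->
  is_derive xi (e_ j) (phase x t) (phase_gradient phi x t xi ord0 j).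
Proof.
move=> xi0; rewrite !mxE; apply: deriveF_add; last first.
  have [phiC _] := phiH.
  have := deriveF_mul (deriveF_cst t xi (e_ j)) (iter_partial_derive phiC (s := [::]) j xi0 isT).
  by rewrite mul0r add0r.
rewrite (_ : x ord0 j = \sum_i (0 * xi ord0 i + x ord0 i * (j == i)%:R)); last first.
  rewrite (bigD1 j)//= eqxx mulr1n mul0r add0r mulr1 big1 ?addr0// => i /negPf ij.
  by rewrite eq_sym ij mulr0n mul0r mulr0 addr0.
rewrite /dotv; elim: (index_enum _) => [|i s IH].
  rewrite big_nil (_ : (fun _ => _) = fun _ : rV => 0); first exact: deriveF_cst.
  by apply/funext => y; rewrite big_nil.
rewrite big_cons (_ : (fun _ => _) = fun y : rV => x ord0 i * y ord0 i + \sum_(j <- s) x ord0 j * y ord0 j); last first.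
  by apply/funext => y; rewrite big_cons.
apply: deriveF_add => //.
exact: (deriveF_mul (deriveF_cst (x ord0 i) xi (e_ j)) (is_derive_coord xi j i)).
Qed.

Definition osc_integral (p : P) (theta : R) (a : rV -> R) : R :=
  \int[mu]_(u in D) (cos (phase (X p) (T p) (rowof u) + theta) * a (rowof u)).

Lemma continuous_shifted_phase p theta xi : xi != 0 ->
  {for xi, continuous (fun xi => phase (X p) (T p) xi + theta)}.
Proof. by move=> xi0; apply: cont_add; [exact: continuous_phase|exact: cont_cst]. Qed.

Lemma continuous_cos_phase p theta xi : xi != 0 ->
  {for xi, continuous (fun xi => cos (phase (X p) (T p) xi + theta))}.
Proof.
move=> xi0; apply: (@cont_comp _ _ (fun xi => phase (X p) (T p) xi + theta) (@cos R)).
  exact: continuous_shifted_phase.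
exact: continuous_cos.
Qed.

Lemma continuous_sin_phase p theta xi : xi != 0 ->
  {for xi, continuous (fun xi => sin (phase (X p) (T p) xi + theta))}.
Proof.
move=> xi0; apply: (@cont_comp _ _ (fun xi => phase (X p) (T p) xi + theta) (@sin R)).
  exact: continuous_shifted_phase.
exact: continuous_sin.
Qed.

(** With [L = 1 - i h grad . nabla] one has
    [L exp (i phase) = w exp (i phase)], so that [a] is replaced by
    [a / w + i div (h grad a / w)]; the factor [i] is the quarter turn of the
    phase in the last integral. *)
Lemma osc_integral_by_parts k (A a : family) : (k <= d)%N ->
  (forall p xi, xi != 0 -> 0 <= A p xi) ->
  symbol cost k.+1 A a -> (forall p, annular (a p)) ->
  exists b : family,
    [/\ symbol cost k (fun p xi => A p xi * ((1 + `|kap p|) / w p xi)) b,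
        forall p, annular (b p) &
        forall p theta, osc_integral p theta (a p) =
          osc_integral p theta (fun xi => a p xi / w p xi) +
          osc_integral p (theta + pi / 2) (b p)].
Proof.
move=> kd A0 sa aa.
pose v j p xi := h p xi * grad p xi ord0 j * (a p xi * (w p xi)^-1).
pose V p xi := h p xi * gradient_weight alpha phi T X p xi * (A p xi * (w p xi)^-1).
have h0 p xi : xi != 0 -> 0 <= h p xi.
  by move=> _; rewrite divr_ge0 ?sqr_ge0// ltW ?phase_size_gt0.
have sv j : symbol cost k.+1 V (v j).
  apply: symbol_mul; last by apply: symbol_mul => //; exact: symbol_ibp_gainV.
  apply: symbol_mul; last exact: symbol_phase_gradient.
  by apply: (symbol_cost phiH) => //; exact: symbol_h.
have VE p xi : xi != 0 -> V p xi * cost p xi = A p xi * ((1 + `|kap p|) / w p xi).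
  move=> xi0; rewrite /V /ibp_cost /gradient_weight.
  have S0 := lt0r_neq0 (phase_size_gt0 alpha (X p) (T p) xi).
  have N0 := lt0r_neq0 (enorm_gt0 xi0).
  have W0 := lt0r_neq0 (ibp_gain_gt0 alpha phi (X p) (T p) xi).
  have r0 := lt0r_neq0 (rho_gt0 alpha phi T X p xi).
  by field; rewrite S0 N0 W0 r0.
have /choice[g gP] : forall j, exists g : family,
    (forall p xi, xi != 0 -> is_derive xi (e_ j) (v j p) (g p xi)) /\
    symbol cost k (fun p xi => A p xi * ((1 + `|kap p|) / w p xi)) g.
  move=> j; have [_ _ /(_ j)[g [dg sg]]] := sv j.
  by exists g; split=> //; exact: symbol_eqw VE sg.
have wc p xi : xi != 0 -> {for xi, continuous (fun xi => (w p xi)^-1)}.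
  exact: symbol_cont (symbol_ibp_gainV phiH kap T X (ltnW (ltnSn d))) p xi.
have aw p : annular (fun xi => a p xi / w p xi).
  rewrite (_ : (fun _ => _) = fun xi => (w p xi)^-1 * a p xi).
    by apply: annular_mul => //; exact: wc.
  by apply/funext => xi; rewrite mulrC.
have av j p : annular (v j p).
  rewrite (_ : v j p = fun xi => (h p xi * grad p xi ord0 j) * (a p xi / w p xi))//.
  apply: annular_mul => // xi xi0; apply: cont_mul.
    exact: (symbol_cont (symbol_h alpha T X 0)).
  exact: (symbol_cont (symbol_phase_gradient phiH kap T X j (leq0n _))).
have ag j p : annular (g j p).
  have [dg sg] := gP j.
  by have [] := integral_partial_annular (av j p) (symbol_cont sg (p := p)) (dg p).
exists (fun p xi => \sum_j g j p xi); split.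
- apply: symbol_sum => [p xi xi0|p xi xi0|j]; last by have [] := gP j.
    by rewrite mulr_ge0 ?A0// divr_ge0// ltW ?ibp_gain_gt0// ltr_wpDr.
  exact: ibp_cost_ge0.
- by move=> p; exact: annular_sum.
move=> p theta.
pose F j xi := sin (phase (X p) (T p) xi + theta) * v j p xi.
pose F' j xi := cos (phase (X p) (T p) xi + theta) * (grad p xi ord0 j * v j p xi) +
  sin (phase (X p) (T p) xi + theta) * g j p xi.
have gc j xi : xi != 0 -> {for xi, continuous (fun xi => grad p xi ord0 j)}.
  exact: (symbol_cont (symbol_phase_gradient phiH kap T X j (leq0n _))).
have IF j : annular (F' j) /\ \int[mu]_(u in D) F' j (rowof u) = 0.
  apply: (@integral_partial_annular _ _ j (F j)).
  - by apply: annular_mul => // xi xi0; exact: continuous_sin_phase.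
  - move=> xi xi0; apply: cont_add; apply: cont_mul.
    + exact: continuous_cos_phase.
    + by apply: cont_mul; [exact: gc|case: (av j p) => + _; exact].
    + exact: continuous_sin_phase.
    + by case: (ag j p) => + _; exact.
  - move=> xi xi0.
    have dph : is_derive xi (e_ j) (fun xi => phase (X p) (T p) xi + theta) (grad p xi ord0 j).
      have := deriveF_add (is_derive_phase (X p) (T p) j xi0) (deriveF_cst theta xi (e_ j)).
      by rewrite addr0.
    have [/(_ p xi xi0) dg _] := gP j.
    have := deriveF_mul (is_derive_rcomp dph (is_derive_sin _)) dg.
    by move/is_derive_eq; apply; rewrite /F'; ring.
have aF : annular (fun xi => \sum_j F' j xi).
  by apply: annular_sum => j; have [] := IF j.
have acw : annular (fun xi => cos (phase (X p) (T p) xi + theta) * (a p xi / w p xi)).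
  by apply: annular_mul => // xi xi0; exact: continuous_cos_phase.
have acb : annular (fun xi => cos (phase (X p) (T p) xi + (theta + pi / 2)) * (\sum_j g j p xi)).
  apply: annular_mul; last exact: annular_sum.
  by move=> xi xi0; exact: continuous_cos_phase.
rewrite /osc_integral -(annular_integralD acw acb).
have IF0 : \int[mu]_(u in D) (\sum_j F' j (rowof u)) = 0.
  rewrite annular_integral_sum; last by move=> j; have [] := IF j.
  by rewrite big1// => j _; have [] := IF j.
rewrite -[RHS]add0r -{1}IF0 -(annular_integralD aF (annular_add acw acb)).
apply: eq_Rintegral => u; rewrite inE /punctured /= => u0.
set xi := rowof u; rewrite big_split /= -mulr_sumr -[\sum_(j < d) (_ * g j p xi)]mulr_sumr.
have -> : cos (phase (X p) (T p) xi + (theta + pi / 2)) =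
    - sin (phase (X p) (T p) xi + theta).
  by rewrite addrA cosD cos_pihalf sin_pihalf mulr0 mulr1 sub0r.
have -> : \sum_j grad p xi ord0 j * v j p xi = a p xi - a p xi / w p xi.
  transitivity (h p xi * enorm (grad p xi) ^+ 2 * (a p xi / w p xi)).
    rewrite [enorm (phase_gradient _ _ _ _) ^+ 2]sqr_enorm mulr_sumr mulr_suml; apply: eq_bigr => j _.
    by rewrite /v; ring.
  have -> : h p xi * enorm (grad p xi) ^+ 2 = w p xi - 1 by rewrite /ibp_gain; ring.
  have W0 := lt0r_neq0 (ibp_gain_gt0 alpha phi (X p) (T p) xi).
  by field.
by ring.
Qed.

(** Each integration by parts leaves two amplitudes of the same kind, with the weight
    multiplied by [(1 + |kappa|) / w] and one derivative less to spend. *)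
Lemma osc_integral_bound k (A a : family) : (k <= d)%N ->
  (forall p xi, xi != 0 -> 0 <= A p xi) ->
  (forall p xi, xi != 0 -> {for xi, continuous (A p)}) ->
  symbol cost k A a -> (forall p, annular (a p)) ->
  exists2 C : R, 0 <= C & forall p theta,
    (`|osc_integral p theta (a p)|%:E <= C%:E *
     \int[mu]_(u in D) (A p (rowof u) *
        ((1 + `|kap p|) / w p (rowof u)) ^+ k)%:E)%E.
Proof.
have wc p xi : xi != 0 -> {for xi, continuous (fun xi => (w p xi)^-1)}.
  exact: symbol_cont (symbol_ibp_gainV phiH kap T X (leq0n _)) p xi.
have gain0 p xi : 0 <= (1 + `|kap p|) / w p xi.
  by rewrite divr_ge0// ltW ?ibp_gain_gt0// ltr_wpDr.
have gainc p xi : xi != 0 -> {for xi, continuous (fun xi => (1 + `|kap p|) / w p xi)}.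
  by move=> xi0; apply: cont_mul; [exact: cont_cst|exact: wc].
have powc k' p xi : xi != 0 ->
    {for xi, continuous (fun xi => ((1 + `|kap p|) / w p xi) ^+ k')}.
  move=> xi0; elim: k' => [|k' IH].
    by apply: (@cont_eq _ _ (fun=> 1)); [move=> y; rewrite expr0|exact: cont_cst].
  apply: (@cont_eq _ _ (fun xi => ((1 + `|kap p|) / w p xi) * ((1 + `|kap p|) / w p xi) ^+ k')).
    by move=> y; rewrite exprS.
  by apply: cont_mul; [exact: gainc|].
elim: k A a => [|k IH] A a kd A0 Ac sa aa.
  have [C C0 HC] := symbol_bound sa; exists C => // p theta.
  have aca : annular (fun xi => cos (phase (X p) (T p) xi + theta) * a p xi).
    by apply: annular_mul => // xi xi0; exact: continuous_cos_phase.
  have iac := annular_integrable aca.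
  have mD := @measurable_punctured R d.
  have mA : measurable_fun D (fun u : d.-tuple mR => (A p (rowof u))%:E).
    by apply/measurable_EFinP; exact: (measurable_continuous (Ac p)).
  rewrite /osc_integral EFin_normr_Rintegral//.
  apply: le_trans (le_abse_integral _ _ _) _ => //; first exact: measurable_int iac.
  rewrite -ge0_integralZl//.
  - apply: ge0_le_integral => //.
    + by apply: measurableT_comp => //; exact: measurable_int iac.
    + apply: measurable_funeM.
      by under eq_fun do rewrite expr0 mulr1.
    + move=> u; rewrite /punctured /= => u0.
      rewrite expr0 mulr1 lee_fin normrM -[leRHS]mul1r ler_pM//.
        by rewrite ler_norml cos_geN1 cos_le1.
      by rewrite (le_trans (HC p _ u0))// ger0_norm ?A0.
  - by under eq_fun do rewrite expr0 mulr1.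
  - by move=> u u0; rewrite lee_fin expr0 mulr1 A0.
have [b [sb ab bE]] := osc_integral_by_parts (ltnW kd) A0 sa aa.
pose A' p xi := A p xi * ((1 + `|kap p|) / w p xi).
have A'0 p xi : xi != 0 -> 0 <= A' p xi by move=> xi0; rewrite mulr_ge0 ?A0.
have A'c p xi : xi != 0 -> {for xi, continuous (A' p)}.
  by move=> xi0; apply: cont_mul; [exact: Ac|exact: gainc].
have saw : symbol cost k A' (fun p xi => a p xi / w p xi).
  have cost0 p xi : xi != 0 -> 0 <= cost p xi by rewrite ibp_cost_ge0.
  apply: (@symbol_le _ _ _ cost _ _ (fun p xi => A p xi * (w p xi)^-1) _ _ 1 1).
  - move=> p xi xi0; have W0 := ltW (ibp_gain_gt0 alpha phi (X p) (T p) xi).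
    rewrite mulr_ge0 ?invr_ge0 ?A0//= mul1r /A' ler_wpM2l ?A0//.
    by rewrite ler_peMl ?invr_ge0// lerDl.
  - by move=> p xi xi0; rewrite cost0//= mul1r.
  - apply: symbol_mul; first exact: symbolW.
    by apply: (symbol_ibp_gainV phiH); rewrite leqW// ltnW.
have aaw p : annular (fun xi => a p xi / w p xi).
  rewrite (_ : (fun _ => _) = fun xi => (w p xi)^-1 * a p xi).
    by apply: annular_mul => //; exact: wc.
  by apply/funext => xi; rewrite mulrC.
have [C1 C10 H1] := IH A' _ (ltnW kd) A'0 A'c saw aaw.
have [C2 C20 H2] := IH A' _ (ltnW kd) A'0 A'c sb ab.
exists (C1 + C2); first by rewrite addr_ge0.
move=> p theta; rewrite bE.
have E u : (A p (rowof u) * ((1 + `|kap p|) / w p (rowof u)) ^+ k.+1)%:E =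
    (A' p (rowof u) * ((1 + `|kap p|) / w p (rowof u)) ^+ k)%:E.
  by rewrite /A' exprS mulrA.
rewrite (eq_integral (fun u => (A' p (rowof u) * ((1 + `|kap p|) / w p (rowof u)) ^+ k)%:E)); last by move=> u _; exact: E.
rewrite EFinD ge0_muleDl ?lee_fin//.
apply: (@le_trans _ _ (`|osc_integral p theta (fun xi => a p xi / w p xi)|%:E +
   `|osc_integral p (theta + pi / 2) (b p)|%:E)%E).
  by rewrite -EFinD lee_fin ler_normD.
by apply: leeD; [exact: H1|exact: H2].
Qed.

End oscillation.

(** * Tools for the integral of the weight *)

Section dyadic_sums.
Context {R : realType}.

(** A function comparable to [min z z^-1]; along a geometric progression it is
    dominated by the increments of the bounded function [z / (1 + z)]. *)
Definition bump (z : R) : R := z / (1 + z) ^+ 2.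

Lemma bump_ge0 z : 0 <= z -> 0 <= bump z.
Proof. by move=> z0; rewrite divr_ge0// sqr_ge0. Qed.

Lemma le_bump_small z : 0 <= z <= 1 -> z <= 4 * bump z.
Proof.
move=> /andP[z0 z1]; rewrite /bump mulrA ler_pdivlMr ?exprn_gt0 ?ltr_wpDr//.
rewrite mulrC; apply: ler_wpM2r => //.
by rewrite expr2; have := @ler_pM _ (1 + z) 2 (1 + z) 2; move=> H;
  apply: le_trans (H _ _ _ _) _; lra.
Qed.

Lemma le_bump_large z : 1 <= z -> z^-1 <= 4 * bump z.
Proof.
move=> z1; have z0 : 0 < z by lra.
have -> : bump z = bump z^-1.
  by rewrite /bump; field; repeat (apply/andP; split); apply: lt0r_neq0; lra.
by apply: le_bump_small; rewrite invr_ge0 ltW//= invf_le1.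
Qed.

(** The bound does not depend on the starting point [c] of the progression: the
    increments telescope, and [z / (1 + z)] stays between [0] and [1]. *)
Lemma sum_bump_geometric (q : R) : 0 < q -> q != 1 -> exists2 K : R, 0 <= K &
  forall (c : R) n, 0 <= c -> \sum_(k < n) bump (c * q ^+ k) <= K.
Proof.
move=> q0 q1; have [K HK] : exists K : R, forall z : R, 0 <= z ->
    bump z <= K * ((q * z) / (1 + q * z) - z / (1 + z)).
  have E z : 0 <= z -> (q * z) / (1 + q * z) - z / (1 + z) =
      (q - 1) * z / ((1 + q * z) * (1 + z)).
    move=> z0; have qz := mulr_ge0 (ltW q0) z0.
    by field; repeat (apply/andP; split); apply: lt0r_neq0; lra.
  have [q1'|q1'] := ltP 1 q.
    exists (q / (q - 1)) => z z0; rewrite E// /bump.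
    have qz := mulr_ge0 (ltW q0) z0.
    rewrite (_ : q / (q - 1) * _ = z * (q / ((1 + q * z) * (1 + z)))); last first.
      by field; repeat (apply/andP; split); apply: lt0r_neq0; lra.
    rewrite ler_wpM2l// -[leLHS]mul1r ler_pdivrMr ?exprn_gt0 ?ltr_wpDr//.
    rewrite mulrAC ler_pdivlMr ?mulr_gt0// ?mul1r; try lra.
    rewrite expr2 mulrA ler_wpM2r//; lra.
  have q2 : 0 < 1 - q by rewrite subr_gt0 lt_neqAle q1 q1'.
  exists (- (1 - q)^-1) => z z0; rewrite E// /bump.
  have qz := mulr_ge0 (ltW q0) z0.
  rewrite (_ : - (1 - q)^-1 * _ = z * ((1 + q * z) * (1 + z))^-1); last first.
    by field; repeat (apply/andP; split); apply: lt0r_neq0; lra.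
  rewrite ler_wpM2l// lef_pV2 ?posrE ?exprn_gt0 ?mulr_gt0//; try lra.
  rewrite expr2 ler_wpM2r//; first lra.
  by rewrite lerD2l ler_piMl.
exists `|K| => // c n c0.
have z01 (z : R) : 0 <= z -> 0 <= z / (1 + z) <= 1.
  move=> z0; rewrite divr_ge0//=; last lra.
  by rewrite ler_pdivrMr ?mul1r; lra.
pose u n := c * q ^+ n / (1 + c * q ^+ n).
have u01 m : 0 <= u m <= 1 by apply: z01; rewrite mulr_ge0// exprn_ge0// ltW.
apply: (@le_trans _ _ (K * (u n - u 0%N))).
  rewrite -(@telescope_sumr _ 0 n)// mulr_sumr big_mkord.
  apply: ler_sum => k _; apply: le_trans (HK _ _) _.
    by rewrite mulr_ge0// exprn_ge0// ltW.
  by rewrite /u exprS mulrCA.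
rewrite (le_trans (ler_norm _))// normrM ler_piMr// ler_norml.
by have := u01 n; have := u01 0%N; lra.
Qed.

End dyadic_sums.

Section line_integral.
Context {R : realType}.
Local Notation leb := (@lebesgue_measure R).

Definition cauchy_bump (L b a u : R) : R :=
  \1_(`[- L, L]%classic) u * (1 + b * (u - a) ^+ 2)^-1.

Lemma cauchy_bump_ge0 L b a u : 0 <= b -> 0 <= cauchy_bump L b a u.
Proof.
move=> b0; apply: mulr_ge0; first by rewrite indicE; case: (_ \in _).
by rewrite invr_ge0 addr_ge0// mulr_ge0// sqr_ge0.
Qed.

Lemma continuous_cauchy (b a : R) : 0 <= b ->
  continuous (fun u : R => (1 + b * (u - a) ^+ 2)^-1).
Proof.
move=> b0 u; apply: cvgV.
  by apply: lt0r_neq0; rewrite ltr_wpDr// mulr_ge0// sqr_ge0.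
apply: cvgD; first exact: cvg_cst.
apply: cvgM; first exact: cvg_cst.
by apply: cvgM; apply: cvgB; [exact: cvg_id|exact: cvg_cst|exact: cvg_id|exact: cvg_cst].
Qed.

Lemma measurable_cauchy_bump (L b a : R) : 0 <= b ->
  measurable_fun setT (cauchy_bump L b a).
Proof.
move=> b0; apply: measurable_funM; first exact: measurable_indic.
by apply: continuous_measurable_fun; exact: continuous_cauchy.
Qed.

Lemma integral_cauchy_bump (L b a : R) : 0 < L -> 0 < b ->
  (\int[leb]_u (cauchy_bump L b a u)%:E <= (pi / Num.sqrt b)%:E)%E.
Proof.
move=> L0 b0; set f := fun u : R => (1 + b * (u - a) ^+ 2)^-1.
have -> : (\int[leb]_u (cauchy_bump L b a u)%:E = \int[leb]_(u in `[(- L)%R, L]) (f u)%:E)%E.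
  rewrite [RHS]integral_mkcond; apply: eq_integral => u _; rewrite patchE /cauchy_bump indicE.
  by case: (u \in _); rewrite ?mul1r ?mul0r.
have sb : 0 < Num.sqrt b by rewrite sqrtr_gt0.
pose F u := atan (Num.sqrt b * (u - a)) / Num.sqrt b.
have dF (u : R) : is_derive u 1 F (f u).
  have d1 : is_derive u (1 : R) (fun u : R => Num.sqrt b * (u - a)) (Num.sqrt b).
    have := is_deriveZ (Num.sqrt b) (is_deriveB (is_derive_id u (1 : R)) (is_derive_cst a u (1 : R))).
    by move/is_derive_eq; apply; rewrite subr0 /GRing.scale/= mulr1.
  have := is_deriveZ (Num.sqrt b)^-1 (is_derive1_comp (is_derive1_atan _) d1).
  rewrite (_ : _ \*: _ = F); last first.
    by apply/funext => v; rewrite /F /= /GRing.scale/= mulrC.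
  move/is_derive_eq; apply; rewrite /GRing.scale/= /f exprMn sqr_sqrtr ?ltW//.
  by rewrite mulrCA mulVf ?mulr1 ?lt0r_neq0.
rewrite (continuous_FTC2 (F := F))//.
- rewrite -EFinB lee_fin /F -mulrBl ler_wpM2r ?invr_ge0 ?sqrtr_ge0//.
  have := atan_ltpi2 (Num.sqrt b * (L - a)).
  have := atan_gtNpi2 (Num.sqrt b * (- L - a)); lra.
- lra.
- by apply: continuous_subspaceT; apply: continuous_cauchy; exact: ltW.
- have cF : continuous F.
    move=> s; apply: differentiable_continuous; apply/derivable1_diffP.
    by have [] := dF s.
  split; first by move=> s _; have [] := dF s.
  + exact: cvg_at_right_filter (cF _).
  + exact: cvg_at_left_filter (cF _).
- by move=> s _; rewrite derive1E; have [_ ->] := dF s.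
Qed.

End line_integral.

Section covers.
Local Open Scope ereal_scope.
Context {R : realType} dsp (Tm : measurableType dsp) (m : {measure set Tm -> \bar R}).
Variables (f : Tm -> \bar R) (D : set Tm).
Hypothesis mD : measurable D.
Hypothesis f0 : forall x, D x -> 0 <= f x.
Hypothesis mf : measurable_fun D f.

Lemma integral_subset_ge0 (Q : set Tm) : measurable Q -> Q `<=` D ->
  measurable_fun setT (f \_ Q) /\ forall x, 0 <= (f \_ Q) x.
Proof.
move=> mQ QD; split.
  apply/(measurable_restrictT _ mQ).1; exact: measurable_funS mf.
by apply: erestrict_ge0 => x /QD; exact: f0.
Qed.

Lemma integral_le_cover (Q : nat -> set Tm) (E : set Tm) :
  measurable E -> E `<=` D ->
  (forall k, measurable (Q k)) -> (forall k, Q k `<=` D) -> E `<=` \bigcup_k Q k ->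
  \int[m]_(x in E) f x <= \sum_(k <oo) \int[m]_(x in Q k) f x.
Proof.
move=> mE ED mQ QD EQ.
have H k := integral_subset_ge0 (mQ k) (QD k).
have [mfE fE0] := integral_subset_ge0 mE ED.
under eq_eseriesr do rewrite integral_mkcond.
rewrite integral_mkcond -integral_nneseries//; last 2 first.
- by move=> k; have [] := H k.
- by move=> k x _; have [_] := H k; exact.
apply: ge0_le_integral => //.
- apply: ge0_emeasurable_sum => //; first by move=> k x _ _; have [_] := H k; exact.
  by move=> k _; have [] := H k.
- move=> x _; have [xE|xE] := pselect (E x); last first.
    rewrite patchE memNset//; apply: nneseries_ge0 => k _ _.
    by have [_] := H k; exact.
  have [k _ Qk] := EQ x xE.
  apply: (@le_trans _ _ ((f \_ (Q k)) x)).
    by rewrite !patchE !mem_set.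
  rewrite (nneseriesD1 (n := k))//; last by move=> i _; have [_] := H i; exact.
  by rewrite leeDl// nneseries_ge0// => i _ _; have [_] := H i; exact.
Qed.

Lemma integral_le_finite_cover (I : finType) (Q : I -> set Tm) :
  (forall k, measurable (Q k)) -> (forall k, Q k `<=` D) -> D `<=` \bigcup_k Q k ->
  \int[m]_(x in D) f x <= \sum_(k : I) \int[m]_(x in Q k) f x.
Proof.
move=> mQ QD DQ.
have H k := integral_subset_ge0 (mQ k) (QD k).
have [mfD fD0] := integral_subset_ge0 mD (@subset_refl _ D).
under eq_bigr do rewrite integral_mkcond.
rewrite integral_mkcond -ge0_integral_sum//; last 2 first.
- by move=> k; have [] := H k.
- by move=> k x _; have [_] := H k; exact.
apply: ge0_le_integral => //.
- by apply: emeasurable_sum => k; have [] := H k.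
- move=> x _; have [xD|xD] := pselect (D x); last first.
    rewrite patchE memNset//; apply: sume_ge0 => k _.
    by have [_] := H k; exact.
  have [k _ Qk] := DQ x xD.
  apply: (@le_trans _ _ ((f \_ (Q k)) x)).
    by rewrite !patchE !mem_set.
  rewrite (bigD1 k)//= leeDl// sume_ge0// => i _; by have [_] := H i; exact.
Qed.

End covers.

(** * Dyadic boxes *)

Section power_comparison.
Context {R : realType}.

Lemma powR_cmp (c r N b : R) : 1 <= c -> 0 < r -> r <= N <= c * r ->
  N `^ b <= c `^ `|b| * r `^ b /\ r `^ b <= c `^ `|b| * N `^ b.
Proof.
move=> c1 r0 /andP[rN Ncr].
have c0 : 0 < c by lra.
have N0 : 0 < N by lra.
have mono (p u v : R) : 0 <= p -> 0 <= u -> u <= v -> u `^ p <= v `^ p.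
  by move=> p0 u0 uv; apply: ge0_ler_powR => //; rewrite nnegrE; lra.
have [b0|b0] := leP 0 b.
  rewrite ger0_norm//; split.
    rewrite -powRM ?(ltW c0) ?(ltW r0)//.
    by apply: mono => //; lra.
  apply: (@le_trans _ _ (N `^ b)).
    by apply: mono => //; lra.
  by rewrite ler_peMl ?powR_ge0// -(@powRr0 _ c); apply: ler_powR.
have inv (u v : R) : 0 < u -> u <= v -> v `^ b <= u `^ b.
  move=> u0 uv; have v0 : 0 < v by lra.
  rewrite -[b]opprK !(powRN _ (- b)) lef_pV2 ?posrE ?powR_gt0//.
  by apply: mono; lra.
rewrite ltr0_norm//; split.
  apply: (le_trans (inv r N r0 rN)).
  by rewrite ler_peMl ?powR_ge0// -(@powRr0 _ c); apply: ler_powR => //; lra.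
have cr : (c * r) `^ b = c `^ b * r `^ b by rewrite powRM ?ltW.
apply: (@le_trans _ _ (c `^ (- b) * (c * r) `^ b)).
  by rewrite cr mulrA -powRD ?(gt_eqF c0) ?implybT// addNr powRr0 mul1r.
by rewrite ler_wpM2l ?powR_ge0// inv.
Qed.

End power_comparison.

Lemma prode_le {R : realType} n (F : 'I_n -> \bar R) (M : R) :
  (forall i, (0 <= F i <= M%:E)%E) -> (\prod_(i < n) F i <= (M ^+ n)%:E)%E.
Proof.
elim: n F => [|n IH] F FM; first by rewrite big_ord0 expr0.
rewrite big_ord_recl exprS EFinM; have /andP[F0 F1] := FM ord0.
apply: lee_pmul => //; last by apply: IH => i; exact: FM.
by apply: prode_ge0 => i _; have /andP[] := FM (lift ord0 i).
Qed.

Section dyadic_boxes.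
Context {R : realType} {d : nat}.
Local Notation rV := 'rV[R]_d.
Local Notation mR := (measurableTypeR R).
Local Notation mu := (lebesgue_tuple R d).

(** The sides of a box of size [r] at distance [r] from the origin: the [j]-th
    coordinate has a definite sign, so that the box is convex and avoids the
    origin, and finitely many of them cover a dyadic shell. *)
Definition box_side (r : R) (j : 'I_d) (sg : bool) (i : 'I_d) : set mR :=
  if i == j then (if sg then `[r, 2 * r]%classic else `[- (2 * r), - r]%classic)
  else `[- (2 * r), 2 * r]%classic.

Definition shell_box r j sg : set rV := [set xi | forall i, box_side r j sg i (xi ord0 i)].

Lemma measurable_box_side r j sg i : measurable (box_side r j sg i).
Proof. by rewrite /box_side; case: ifP => _; [case: sg|]; exact: measurable_itv. Qed.

Lemma box_side_le r j sg i u : 0 < r -> box_side r j sg i u -> - (2 * r) <= u <= 2 * r.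
Proof.
by move=> r0; rewrite /box_side; case: ifP => _; [case: sg|];
  rewrite /= in_itv/= => /andP[? ?]; apply/andP; split; lra.
Qed.

Lemma box_side_ge r j sg u : 0 < r -> box_side r j sg j u -> r <= `|u|.
Proof.
move=> r0; rewrite /box_side eqxx; case: sg; rewrite /= in_itv/= => /andP[? ?].
  by rewrite (le_trans _ (ler_norm _)).
by rewrite -normrN (le_trans _ (ler_norm _))//; lra.
Qed.

Lemma box_side_convex r j sg i (u v tau : R) : 0 <= tau <= 1 ->
  box_side r j sg i u -> box_side r j sg i v ->
  box_side r j sg i (tau * (u - v) + v).
Proof.
move=> /andP[t0 t1].
have E : tau * (u - v) + v = tau * u + (1 - tau) * v by ring.
have H (a b : R) : a <= u <= b -> a <= v <= b -> a <= tau * (u - v) + v <= b.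
  move=> /andP[au ub] /andP[av vb]; rewrite E.
  have t2 : 0 <= 1 - tau by lra.
  have := ler_wpM2l t0 au; have := ler_wpM2l t0 ub.
  have := ler_wpM2l t2 av; have := ler_wpM2l t2 vb.
  by move=> ? ? ? ?; apply/andP; split; lra.
by rewrite /box_side; case: ifP => _; [case: sg|]; rewrite /= !in_itv/=; exact: H.
Qed.

Lemma shell_box_enorm r j sg xi : 0 < r -> shell_box r j sg xi ->
  r <= enorm xi <= (2 * d%:R) * r.
Proof.
move=> r0 xiQ; apply/andP; split.
  by rewrite (le_trans _ (coord_le_enorm _ j))// (box_side_ge r0 (xiQ j)).
have d1 : 1 <= d%:R :> R by rewrite ler1n (leq_ltn_trans (leq0n j) (ltn_ord j)).
rewrite -(@ler_pXn2r _ 2) ?nnegrE ?enorm_ge0//; last by rewrite !mulr_ge0// ltW.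
rewrite sqr_enorm.
apply: (@le_trans _ _ (\sum_(i < d) (2 * r) ^+ 2)).
  apply: ler_sum => i _; rewrite -[leLHS]real_normK ?num_real//.
  rewrite ler_pXn2r ?nnegrE//; last by rewrite mulr_ge0// ltW.
  by rewrite ler_norml (box_side_le r0 (xiQ i)).
rewrite sumr_const card_ord -[leLHS]mulr_natl.
rewrite (_ : (2 * d%:R * r) ^+ 2 = d%:R * (d%:R * (2 * r) ^+ 2)); last by ring.
by rewrite ler_wpM2l ?ler0n// ler_peMl ?sqr_ge0.
Qed.

Lemma shell_box_neq0 r j sg xi : 0 < r -> shell_box r j sg xi -> xi != 0.
Proof.
move=> r0 /(shell_box_enorm r0)/andP[rN _].
by apply: contraTneq rN => ->; rewrite enorm0 -ltNge.
Qed.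

Lemma shell_box_convex r j sg xi eta (tau : R) : 0 <= tau <= 1 ->
  shell_box r j sg xi -> shell_box r j sg eta ->
  shell_box r j sg (tau *: (xi - eta) + eta).
Proof. by move=> t01 hx he i; rewrite !mxE; apply: box_side_convex. Qed.

Lemma shell_box_compact r j sg : compact (shell_box r j sg).
Proof.
apply: (@rV_compact _ _ (box_side r j sg)) => i.
by rewrite /box_side; case: ifP => _; [case: sg|]; exact: segment_compact.
Qed.

Lemma shell_box_nonempty r j sg : 0 < r -> exists xi, shell_box r j sg xi.
Proof.
move=> r0; exists (\row_i (if i == j then (if sg then r else - r) else 0)) => i.
rewrite mxE /box_side; case: ifP => _; [case: sg|]; rewrite /= in_itv/=; lra.
Qed.

Definition tuple_box r j sg : set (d.-tuple mR) := box (box_side r j sg).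

Lemma tuple_boxE r j sg u : tuple_box r j sg u <-> shell_box r j sg (rowof u).
Proof. by split => H i; have := H i; rewrite mxE. Qed.

Lemma measurable_tuple_box r j sg : measurable (tuple_box r j sg).
Proof. by apply: measurable_box => i; exact: measurable_box_side. Qed.

Lemma measure_tuple_box r j sg : 0 < r ->
  (mu (tuple_box r j sg) <= ((4 * r) ^+ d)%:E)%E.
Proof.
move=> r0; rewrite measure_box; last by move=> i; exact: measurable_box_side.
have le4 i : (0 <= @lebesgue_measure R (box_side r j sg i) <= (4 * r)%:E)%E.
  rewrite measure_ge0 /=.
  apply: (@le_trans _ _ (@lebesgue_measure R `[- (2 * r), 2 * r]%classic)).
    apply: le_measure; rewrite ?inE; [exact: measurable_box_side|exact: measurable_itv|].
    by move=> u /(box_side_le r0); rewrite /= in_itv.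
  rewrite lebesgue_measure_itv/= lte_fin ifT; last lra.
  by rewrite -EFinD lee_fin; lra.
exact: prode_le.
Qed.

End dyadic_boxes.

(** * The gain on a dyadic box *)

Section weight_integral.
Context {R : realType} {d : nat}.
Local Notation rV := 'rV[R]_d.
Variables (alpha : R) (phi : rV -> R).
Hypothesis phiH : almost_homogeneous alpha phi.
Local Notation cd := (2 * d%:R : R).
Local Notation gain := (ibp_gain alpha phi).

Lemma shell_powR (b r : R) j sg (xi : rV) : 0 < r -> shell_box r j sg xi ->
  enorm xi `^ b <= cd `^ `|b| * r `^ b /\ r `^ b <= cd `^ `|b| * enorm xi `^ b.
Proof.
move=> r0 xiQ; apply: powR_cmp => //; last exact: shell_box_enorm xiQ.
have : 1 <= d%:R :> R by rewrite ler1n (leq_ltn_trans (leq0n j) (ltn_ord j)).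
lra.
Qed.

Lemma cd_powR_gt0 (j : 'I_d) (b : R) : 0 < cd `^ b.
Proof.
by rewrite powR_gt0// mulr_gt0// ltr0n (leq_ltn_trans (leq0n j) (ltn_ord j)).
Qed.

(** Let [a] minimise the length of the phase gradient on the box.  The gradients at
    [xi] and [a] differ by at least [2 * c * |t| * r^(alpha-2) * |xi - a|], and the
    one at [xi] is the longer, so it accounts for half of this difference.  No
    stationary point need exist for this argument. *)
Lemma phase_gradient_growth : exists2 c : R, 0 < c &
  forall x t r j sg, 0 < r -> exists a : rV, forall xi, shell_box r j sg xi ->
    c * (`|t| * r `^ (alpha - 2) * enorm (xi - a)) <=
    enorm (phase_gradient phi x t xi).
Proof.
have [lam lam0 form] := hessian_form_ge phiH.
case: (posnP d) => [d0|d0].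
  exists 1 => // x t r j; exfalso; have : (j < d)%N := ltn_ord j.
  by rewrite {2}d0.
pose j0 := Ordinal d0.
have K0 := cd_powR_gt0 j0 `|alpha - 2|.
exists (lam / cd `^ `|alpha - 2| / 2); first by rewrite !divr_gt0.
move=> x t r j sg r0.
have neq0 xi : shell_box r j sg xi -> xi != 0 by exact: shell_box_neq0.
have Gc : {within shell_box r j sg, continuous (fun xi => enorm (phase_gradient phi x t xi))}.
  apply: continuous_in_subspaceT => xi; rewrite inE => /neq0 xi0.
  apply: (@cont_comp _ _ (fun xi => \sum_(i < d) phase_gradient phi x t xi ord0 i ^+ 2) (@Num.sqrt R)); last exact: sqrt_continuous.
  apply: cont_sum => i.
  have gc : {for xi, continuous (fun xi => phase_gradient phi x t xi ord0 i)}.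
    apply: (@cont_eq _ _ (fun xi => x ord0 i + t * partial i phi xi)).
      by move=> y; rewrite !mxE.
    apply: cont_add; first exact: cont_cst.
    apply: cont_mul; first exact: cont_cst.
    exact: (partial_continuous phiH xi0).
  by apply: (cont_mul gc gc).
have [a aQ amin] := EVT_min_rV (shell_box_nonempty j sg r0) (@shell_box_compact R d r j sg) Gc.
rewrite inE in aQ.
exists a => xi xiQ.
have sep : (lam / cd `^ `|alpha - 2| * r `^ (alpha - 2)) * enorm (xi - a) <=
    enorm (gradient phi xi - gradient phi a).
  apply: (gradient_separates phiH form) => tau tau01.
  have zQ := shell_box_convex tau01 xiQ aQ.
  split; first exact: neq0.
  rewrite -mulrA ler_pM2l// mulrC ler_pdivrMr// mulrC.
  by have [_] := shell_powR (alpha - 2) r0 zQ.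
have diff : phase_gradient phi x t xi - phase_gradient phi x t a =
    t *: (gradient phi xi - gradient phi a).
  by rewrite /phase_gradient opprD addrACA subrr add0r scalerBr.
have := ler_wpM2l (normr_ge0 t) sep; rewrite -enormZ -diff => H.
have := le_trans H (enormB _ _).
have aG := amin xi; rewrite inE in aG; have := aG xiQ.
lra.
Qed.

(** On the box the two terms [x] and [t * grad phi] of the phase gradient have sizes
    [y / r] and [s / r].  If [s] and [y] are not comparable then one term dominates
    and the gain is of size at least [s]; if they are, then the terms may cancel,
    and the gain is bounded below as at a nondegenerate stationary point [a]. *)
Lemma box_gain : exists c1 C1 c3 c4 : R,
  [/\ 0 < c1, 0 < c3, 0 < c4 & forall x t r j sg, 0 < r ->
    let s := `|t| * r `^ alpha in let y := enorm x * r in 1 <= s ->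
    exists a : rV, forall xi, shell_box r j sg xi ->
      if c1 * s <= y <= C1 * s
      then 1 + c4 * s * r ^- 2 * enorm (xi - a) ^+ 2 <= gain x t xi
      else c3 * s <= gain x t xi].
Proof.
have [c c0 Hc] := phase_gradient_growth.
have [_ [d1 [d2 [lam [B [[d10 d20 _ _] H]]]]]] := phiH.
case: (posnP d) => [dz|d0].
  exists 1, 1, 1, 1; split => // x t r j; exfalso.
  by have : (j < d)%N := ltn_ord j; rewrite {2}dz.
pose j0 := Ordinal d0.
have cd1 : 1 <= cd.
  have : 1 <= d%:R :> R by rewrite ler1n.
  lra.
(* Outside [c1 * s <= y <= C1 * s] one of the two terms of the gradient is at least
   twice the other.  The constants [C2], [C3], [C4] bound [phase_size] by [y] or
   [s] in the three cases, and [e * s] is a lower bound for [|xi|] times the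
   gradient where [t * grad phi] dominates. *)
pose K := cd `^ `|alpha|.
have K0 : 0 < K := cd_powR_gt0 j0 `|alpha|.
pose C1 := 2 * d2 * K.
have C10 : 0 < C1 by rewrite /C1 !mulr_gt0.
pose c1 := d1 / (2 * cd * K).
have cd0 : 0 < cd by lra.
have c10 : 0 < c1 by rewrite /c1 divr_gt0// mulr_gt0// mulr_gt0.
pose C2 := (1 + K) / C1 + cd.
have C20 : 0 < C2 by rewrite /C2 addr_gt0// divr_gt0// addr_gt0.
pose C3 := 1 + K + cd * c1.
have C30 : 0 < C3 by rewrite /C3 !addr_gt0// mulr_gt0.
pose C4 := 1 + K + cd * C1.
have C40 : 0 < C4 by rewrite /C4 !addr_gt0// mulr_gt0.
pose e := d1 / (2 * K).
have e0 : 0 < e by rewrite /e divr_gt0// mulr_gt0.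
pose c3 := Num.min (C1 / (4 * C2)) (e ^+ 2 / C3).
exists c1, C1, c3, (c ^+ 2 / C4); split => //.
- rewrite /c3 lt_min; apply/andP; split; apply: divr_gt0 => //.
    by apply: mulr_gt0.
  exact: exprn_gt0.
- by apply: divr_gt0 => //; exact: exprn_gt0.
move=> x t r j sg r0 s y s1; have [a Ha] := Hc x t r j sg r0.
exists a => xi xiQ.
have xi0 := shell_box_neq0 r0 xiQ.
have N0 := enorm_gt0 xi0.
have /andP[rN Nr] := shell_box_enorm r0 xiQ.
have [NK KN] := shell_powR alpha r0 xiQ.
rewrite -/K in NK KN.
have [/andP[gle gge] _ _] := H xi xi0.
set S := phase_size alpha x t xi; set G := enorm (phase_gradient phi x t xi).
have S0 : 0 < S := phase_size_gt0 alpha x t xi.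
have y0 : 0 <= y by rewrite /y mulr_ge0 ?enorm_ge0// ltW.
have Sle : S <= 1 + K * s + cd * y.
  rewrite /S /phase_size; apply: lerD.
    rewrite lerD2l /s mulrCA ler_wpM2l//.
  by rewrite /y mulrCA ler_wpM2l ?enorm_ge0.
have gainE (b : R) : 0 <= b -> b <= enorm xi * G -> b ^+ 2 / S <= gain x t xi.
  move=> b0 bG; rewrite /ibp_gain -/S -/G -[leLHS]add0r; apply: lerD => //.
  rewrite [leRHS]mulrAC ler_wpM2r ?invr_ge0 ?(ltW S0)// -exprMn.
  by rewrite ler_pXn2r ?nnegrE// (le_trans b0).
have tN : `|t| * enorm xi `^ alpha <= K * s by rewrite /s mulrCA ler_wpM2l.
have tN' : s <= K * (`|t| * enorm xi `^ alpha) by rewrite /s mulrCA ler_wpM2l.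
have xN : enorm x * enorm xi <= cd * y by rewrite /y mulrCA ler_wpM2l ?enorm_ge0.
have xN' : y <= enorm x * enorm xi by rewrite /y ler_wpM2l ?enorm_ge0.
have Na : enorm xi * enorm xi `^ (alpha - 1) = enorm xi `^ alpha.
  by rewrite -{1}(powRr1 (ltW N0)) enorm_powRM//; congr (_ `^ _); ring.
set g := enorm (gradient phi xi) in gle gge.
have tg : enorm (t *: gradient phi xi) = `|t| * g by rewrite enormZ.
have Ng1 : enorm xi * (`|t| * g) <= d2 * (`|t| * enorm xi `^ alpha).
  rewrite -Na; have := ler_wpM2l (mulr_ge0 (ltW N0) (normr_ge0 t)) gge.
  by move=> h; apply: le_trans (le_trans _ h) _; rewrite le_eqVlt; apply/orP; left; apply/eqP; ring.
have Ng2 : d1 * (`|t| * enorm xi `^ alpha) <= enorm xi * (`|t| * g).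
  rewrite -Na; have := ler_wpM2l (mulr_ge0 (ltW N0) (normr_ge0 t)) gle.
  by move=> h; apply: le_trans (le_trans _ h) _; rewrite le_eqVlt; apply/orP; left; apply/eqP; ring.
have Glow1 : enorm x - `|t| * g <= G.
  have := enormB (phase_gradient phi x t xi) (t *: gradient phi xi).
  by rewrite /phase_gradient addrK -/(phase_gradient phi x t xi) -/G tg; lra.
have Glow2 : `|t| * g - enorm x <= G.
  have := enormB (phase_gradient phi x t xi) x.
  by rewrite /phase_gradient addrAC subrr add0r -/(phase_gradient phi x t xi) -/G tg; lra.
case: ifPn => [/andP[sy ys]|].
  (* here [phase_size] is of size [s], so that [h] is of size [r ^ 2 / s] *)
  rewrite /ibp_gain -/S -/G lerD2l.
  have SC4 : S <= C4 * s.
    apply: le_trans Sle _; rewrite /C4.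
    have := ler_wpM2l (ltW cd0) ys; lra.
  have GE := Ha xi xiQ; rewrite -/G in GE.
  set E := enorm (xi - a) in GE *.
  have E0 : 0 <= E := enorm_ge0 _.
  apply: (@le_trans _ _ (r ^+ 2 / (C4 * s) * (c * (`|t| * r `^ (alpha - 2) * E)) ^+ 2)).
    have -> : r `^ (alpha - 2) = r `^ alpha * r ^- 2.
      rewrite powRD ?(gt_eqF r0) ?implybT// (powRN2 r0); congr (_ * _).
      by rewrite -invfM -expr2.
    rewrite le_eqVlt; apply/orP; left; apply/eqP.
    have s0 : 0 < s by lra.
    have -> : (c * (`|t| * (r `^ alpha * r ^- 2) * E)) ^+ 2 = (c * (s * r ^- 2 * E)) ^+ 2.
      by rewrite /s; ring.
    by field; rewrite !lt0r_neq0.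
  have s0 : 0 < s by lra.
  apply: ler_pM.
  - by rewrite divr_ge0 ?sqr_ge0// mulr_ge0 ?ltW.
  - exact: sqr_ge0.
  - apply: ler_pM; first exact: sqr_ge0.
    + by rewrite invr_ge0 ltW// mulr_gt0.
    + by rewrite ler_pXn2r ?nnegrE ?enorm_ge0 ?(ltW r0)//.
    + by rewrite lef_pV2 ?posrE ?(mulr_gt0 C40 s0)//.
  - have L0 : 0 <= c * (`|t| * r `^ (alpha - 2) * E).
      by rewrite !mulr_ge0 ?powR_ge0// ltW.
    by rewrite ler_pXn2r ?nnegrE ?enorm_ge0//.
rewrite negb_and -!ltNge => /orP[ys|sy].
  (* here [|t| * |grad phi|] is at least twice [|x|] *)
  have c3le : c3 <= e ^+ 2 / C3 by rewrite /c3 ge_min lexx orbT.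
  have low : e * s <= enorm xi * G.
    have := ler_wpM2l (ltW N0) Glow2.
    have h1 : 2 * (e * s) <= d1 * (`|t| * enorm xi `^ alpha).
      have := ler_wpM2l (ltW d10) tN'.
      rewrite /e => h; rewrite -(ler_pM2r K0).
      apply: le_trans (le_trans _ h) _; rewrite le_eqVlt; apply/orP; left; apply/eqP; last by ring.
      by field; rewrite lt0r_neq0.
    have h2 : cd * y <= e * s.
      have := ltW ys; rewrite -(ler_pM2l cd0) => h; apply: le_trans h _.
      rewrite le_eqVlt; apply/orP; left; apply/eqP; rewrite /c1 /e.
      by field; rewrite !lt0r_neq0//; lra.
    lra.
  have SC3 : S <= C3 * s.
    apply: le_trans Sle _; rewrite /C3.
    have := ler_wpM2l (ltW cd0) (ltW ys); lra.
  have s0 : 0 < s by lra.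
  apply: le_trans (gainE (e * s) _ low); last by rewrite mulr_ge0 ?ltW.
  apply: (@le_trans _ _ ((e * s) ^+ 2 / (C3 * s))).
    rewrite (_ : _ / _ = e ^+ 2 / C3 * s); last by field; rewrite !lt0r_neq0.
    by rewrite ler_wpM2r// ltW.
  by rewrite ler_wpM2l ?sqr_ge0// lef_pV2 ?posrE ?(mulr_gt0 C30 s0)//.
(* here [|x|] is at least twice [|t| * |grad phi|] *)
have c3le : c3 <= C1 / (4 * C2) by rewrite /c3 ge_min lexx.
have low : y / 2 <= enorm xi * G.
  have := ler_wpM2l (ltW N0) Glow1.
  have h1 := ler_wpM2l (ltW d20) tN.
  have h2 : 2 * (d2 * (K * s)) <= y by apply: le_trans (ltW sy); rewrite /C1; lra.
  lra.
have s0 : 0 < s by lra.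
have yy : 0 < y by apply: le_lt_trans sy; rewrite mulr_ge0 ?ltW.
have SC2 : S <= C2 * y.
  apply: le_trans Sle _; rewrite /C2 [leRHS]mulrDl lerD2r.
  have K1 : 0 < 1 + K by rewrite addr_gt0.
  apply: (@le_trans _ _ ((1 + K) * s)); first by lra.
  rewrite -mulrA ler_pM2l// mulrC ler_pdivlMr// mulrC; exact: ltW.
apply: le_trans (gainE (y / 2) _ low); last by rewrite divr_ge0.
apply: (@le_trans _ _ ((y / 2) ^+ 2 / (C2 * y))).
  apply: (@le_trans _ _ (C1 / (4 * C2) * s)); first by rewrite ler_wpM2r ?(ltW s0).
  rewrite (_ : (y / 2) ^+ 2 / (C2 * y) = (4 * C2)^-1 * y); last by field; rewrite !lt0r_neq0.
  rewrite mulrAC mulrC ler_wpM2l ?invr_ge0 ?mulr_ge0 ?(ltW C20)//.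
  exact: ltW.
by rewrite ler_wpM2l ?sqr_ge0// lef_pV2 ?posrE ?(mulr_gt0 C20 yy)//.
Qed.

End weight_integral.

(** * The integral of the weight over a box *)

Section weight.
Context {R : realType} {d : nat}.
Local Notation rV := 'rV[R]_d.
Local Notation mR := (measurableTypeR R).
Local Notation mu := (lebesgue_tuple R d).
Local Notation D := (@punctured R d).
Variables (alpha : R) (phi : rV -> R).
Hypothesis phiH : almost_homogeneous alpha phi.
Local Notation cd := (2 * d%:R : R).
Local Notation gain := (ibp_gain alpha phi).
Local Notation beta := ((alpha - 2) * d%:R / 2).

Lemma continuous_gain x t (xi : rV) : xi != 0 -> {for xi, continuous (gain x t)}.
Proof.
move=> xi0; have H := symbol_ibp_gain phiH (fun _ : unit => 0) (fun _ => t)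
  (fun _ => x) (leq0n _).
exact: (symbol_cont H (p := tt) xi0).
Qed.

(** What remains of the integrand after [d] integrations by parts: the size
    [|xi|^((alpha-2)d/2)] of the square root of the Hessian determinant, and [d]
    gains. *)
Definition decay_weight (x : rV) (t : R) (xi : rV) : R :=
  enorm xi `^ beta * ((gain x t xi)^-1) ^+ d.

Lemma decay_weight_ge0 x t xi : 0 <= decay_weight x t xi.
Proof.
by rewrite mulr_ge0 ?powR_ge0// exprn_ge0// invr_ge0 ltW// ibp_gain_gt0.
Qed.

Lemma continuous_decay_weight x t (xi : rV) : xi != 0 ->
  {for xi, continuous (decay_weight x t)}.
Proof.
move=> xi0; apply: cont_mul; first exact: continuous_enorm_powR.
have gc : {for xi, continuous (fun xi => (gain x t xi)^-1)}.
  by apply: cont_inv; [exact: lt0r_neq0 (ibp_gain_gt0 _ _ _ _ _)|exact: continuous_gain].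
have pc n : {for xi, continuous (fun xi => (gain x t xi)^-1 ^+ n)}; last exact: pc.
elim: n => [|n IH].
  by apply: (@cont_eq _ _ (fun=> 1)); [move=> y; rewrite expr0|exact: cont_cst].
apply: (@cont_eq _ _ (fun xi => (gain x t xi)^-1 * (gain x t xi)^-1 ^+ n)).
  by move=> y; rewrite exprS.
exact: cont_mul.
Qed.

Lemma measurable_decay_weight x t :
  measurable_fun D (fun u : d.-tuple mR => (decay_weight x t (rowof u))%:E).
Proof.
apply/measurable_EFinP; apply: measurable_continuous => xi xi0.
exact: continuous_decay_weight.
Qed.

Lemma tuple_box_punctured (r : R) j sg : 0 < r -> tuple_box r j sg `<=` D.
Proof. by move=> r0 u /tuple_boxE/(shell_box_neq0 r0). Qed.

Lemma box_integral_flat x t (r M : R) j sg : 0 < r -> 0 <= M ->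
  (forall xi, shell_box r j sg xi -> decay_weight x t xi <= M) ->
  (\int[mu]_(u in tuple_box r j sg) (decay_weight x t (rowof u))%:E <=
    (M * (4 * r) ^+ d)%:E)%E.
Proof.
move=> r0 M0 HM; have mQ := measurable_tuple_box r j sg.
apply: (@le_trans _ _ (\int[mu]_(u in tuple_box r j sg) M%:E)%E).
  apply: ge0_le_integral => //.
  - by move=> u _; rewrite lee_fin decay_weight_ge0.
  - apply: measurable_funS (measurable_decay_weight x t) => //.
      exact: measurable_punctured.
    exact: tuple_box_punctured.
  - by move=> u /tuple_boxE uQ; rewrite lee_fin HM.
rewrite integral_cst// EFinM lee_wpmul2l ?lee_fin//.
exact: measure_tuple_box.
Qed.

Lemma box_integral_cauchy x t (r M b : R) j sg (a : rV) : 0 < r -> 0 <= M -> 0 < b ->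
  (forall xi, shell_box r j sg xi -> enorm xi `^ beta <= M) ->
  (forall xi, shell_box r j sg xi -> 1 + b * enorm (xi - a) ^+ 2 <= gain x t xi) ->
  (\int[mu]_(u in tuple_box r j sg) (decay_weight x t (rowof u))%:E <=
    (M * (pi / Num.sqrt b) ^+ d)%:E)%E.
Proof.
move=> r0 M0 b0 HM Hg; have mQ := measurable_tuple_box r j sg.
have mc i := measurable_cauchy_bump (2 * r) (a ord0 i) (ltW b0).
have c0 i u := cauchy_bump_ge0 (2 * r) (a ord0 i) u (ltW b0).
have p0 (u : d.-tuple mR) : 0 <= \prod_(i < d) cauchy_bump (2 * r) b (a ord0 i) (tnth u i).
  by apply: prodr_ge0 => i _; exact: c0.
have mp : measurable_fun setT (fun u : d.-tuple mR =>
    (\prod_(i < d) cauchy_bump (2 * r) b (a ord0 i) (tnth u i))%:E).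
  apply/measurable_EFinP; apply: measurable_prod => i _.
  by apply: measurableT_comp; [exact: mc|exact: measurable_tnth].
rewrite integral_mkcond.
apply: (@le_trans _ _ (\int[mu]_u (M%:E *
   (\prod_(i < d) cauchy_bump (2 * r) b (a ord0 i) (tnth u i))%:E))%E).
  apply: ge0_le_integral => //.
  - by move=> u _; apply: erestrict_ge0 => v _; rewrite lee_fin decay_weight_ge0.
  - apply: ((measurable_restrictT _ mQ).1 _).
    apply: measurable_funS (measurable_decay_weight x t) => //.
      exact: measurable_punctured.
    exact: tuple_box_punctured.
  - by apply: measurable_funeM; exact: mp.
  - move=> u _; rewrite patchE; case: ifPn => [|_]; last first.
      by rewrite -EFinM lee_fin mulr_ge0.
    rewrite inE => /tuple_boxE uQ; rewrite -EFinM lee_fin.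
    apply: ler_pM.
    + exact: powR_ge0.
    + by rewrite exprn_ge0// invr_ge0 ltW// ibp_gain_gt0.
    + exact: HM.
    + rewrite -[X in _ ^+ X]card_ord -prodr_const.
      apply: ler_prod => i _; rewrite invr_ge0 (ltW (ibp_gain_gt0 _ _ _ _ _))/=.
      have : tnth u i \in `[- (2 * r), 2 * r]%classic.
        have := box_side_le r0 (uQ i); rewrite mxE inE /= in_itv.
        by [].
      rewrite /cauchy_bump indicE => ->; rewrite mul1r.
      have bb : 0 < 1 + b * (tnth u i - a ord0 i) ^+ 2.
        by rewrite ltr_wpDr// mulr_ge0 ?sqr_ge0// ltW.
      rewrite lef_pV2 ?posrE ?ibp_gain_gt0//.
      apply: le_trans (Hg _ uQ).
      rewrite lerD2l ler_wpM2l ?(ltW b0)//.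
      rewrite -[leLHS]real_normK ?num_real// ler_pXn2r ?nnegrE ?enorm_ge0//.
      by have := coord_le_enorm (rowof u - a) i; rewrite !mxE.
rewrite ge0_integralZl//; last first.
  by move=> u _; rewrite lee_fin.
rewrite (integral_prod_tuple (f := fun i => cauchy_bump (2 * r) b (a ord0 i)))//.
rewrite [leRHS]EFinM lee_wpmul2l ?lee_fin//.
apply: prode_le => i; rewrite integral_ge0/=; last by move=> u _; rewrite lee_fin.
by apply: integral_cauchy_bump => //; rewrite mulr_gt0.
Qed.

(** Put [s = |t| * r^alpha] and [y = |x| * r].  The box has volume of order [r^d], so
    without any gain its contribution is of order [|t|^(-d/2) * s^(d/2)], which is
    used for [s <= 1].  For [s >= 1] a gain of size [s] turns [s^(d/2)] into
    [s^(-d/2)].  If [y] is comparable to [s], the [d] integrals of Cauchy profiles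
    contribute [s^(-d/2)] altogether, which leaves [|t|^(-d/2)] without decay in
    [s], but only while [y / s] is of size one.  Both alternatives are expressed by
    [bump], so that the sum over dyadic [r] converges. *)
Lemma box_integral_bound : exists2 K : R, 0 <= K & forall x t r j sg,
  t != 0 -> 0 < r ->
  (\int[mu]_(u in tuple_box r j sg) (decay_weight x t (rowof u))%:E <=
   (K * `|t| `^ (- (d%:R / 2)) * (bump ((`|t| * r `^ alpha) `^ (d%:R / 2)) +
      bump (enorm x * r / (`|t| * r `^ alpha))))%:E)%E.
Proof.
have [c1 [C1 [c3 [c4 [c10 c30 c40 H]]]]] := box_gain phiH.
case: (posnP d) => [dz|d0].
  exists 1 => // x t r j; exfalso.
  by have : (j < d)%N := ltn_ord j; rewrite {2}dz.
pose Kb := cd `^ `|beta|.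
have Kb0 : 0 <= Kb by exact: powR_ge0.
pose K2 := Kb * 4 ^+ d * 4.
pose K3 := Kb * 4 ^+ d * (c3^-1) ^+ d * 4.
pose K4 := Kb * (pi / Num.sqrt c4) ^+ d * ((1 + C1) ^+ 2 / c1).
have K20 : 0 <= K2 by rewrite /K2 !mulr_ge0// exprn_ge0.
have K30 : 0 <= K3.
  by rewrite /K3 !mulr_ge0// exprn_ge0// invr_ge0 ltW.
have K40 : 0 <= K4.
  rewrite /K4 mulr_ge0//; last by rewrite divr_ge0 ?sqr_ge0// ltW.
  by rewrite mulr_ge0// exprn_ge0// divr_ge0 ?pi_ge0 ?sqrtr_ge0.
exists (K2 + K3 + K4); first by rewrite !addr_ge0.
move=> x t r j sg t0 r0.
set s := `|t| * r `^ alpha; set y := enorm x * r.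
have T0 : 0 < `|t| by rewrite normr_gt0.
have s0 : 0 < s by rewrite mulr_gt0 ?powR_gt0.
have y0 : 0 <= y by rewrite mulr_ge0 ?enorm_ge0 ?ltW.
set z := s `^ (d%:R / 2).
have z0 : 0 < z by rewrite powR_gt0.
set tt := `|t| `^ _.
have tt0 : 0 < tt by rewrite powR_gt0.
have bz := bump_ge0 (ltW z0).
have by_ := bump_ge0 (divr_ge0 y0 (ltW s0)).
have rz : r `^ beta * r ^+ d = tt * z.
  rewrite /tt /z /s powRM ?(ltW T0) ?powR_ge0// -powRrM mulrA.
  rewrite -powRD ?(gt_eqF T0) ?implybT// addNr powRr0 mul1r.
  rewrite -powR_mulrn ?(ltW r0)// -powRD ?(gt_eqF r0) ?implybT//.
  by congr (_ `^ _); field.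
have HN xi : shell_box r j sg xi -> enorm xi `^ beta <= Kb * r `^ beta.
  by move=> /(shell_powR beta r0)[].
have fin (I : \bar R) (M : R) : (I <= M%:E)%E ->
    M <= (K2 + K3 + K4) * tt * (bump z + bump (y / s)) ->
    (I <= ((K2 + K3 + K4) * tt * (bump z + bump (y / s)))%:E)%E.
  by move=> I1 I2; apply: le_trans I1 _; rewrite lee_fin.
have dom (K' b : R) : 0 <= b -> K' <= K2 + K3 + K4 ->
    b <= bump z + bump (y / s) ->
    K' * tt * b <= (K2 + K3 + K4) * tt * (bump z + bump (y / s)).
  move=> b0 KK bb.
  apply: (@le_trans _ _ ((K2 + K3 + K4) * tt * b)).
    by rewrite ler_wpM2r// ler_wpM2r// ltW.
  by apply: ler_wpM2l => //; apply: mulr_ge0; [rewrite !addr_ge0|exact: ltW].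
have e1 : 1 `^ (d%:R / 2) = 1 :> R by rewrite powR1.
have Mr0 : 0 <= Kb * r `^ beta by rewrite mulr_ge0 ?powR_ge0.
have [s1|s1] := leP s 1.
  apply: (fin _ (Kb * r `^ beta * (4 * r) ^+ d)).
    apply: box_integral_flat => // xi xiQ.
    apply: le_trans (HN _ xiQ); rewrite ler_piMr ?powR_ge0//.
    apply: exprn_ile1; first by rewrite invr_ge0 ltW// ibp_gain_gt0.
    by rewrite invf_le1 ?ibp_gain_gt0// ibp_gain_ge1.
  have z1 : z <= 1.
    rewrite /z -[leRHS]e1 ge0_ler_powR ?nnegrE ?divr_ge0 ?ler0n ?(ltW s0)//.
  apply: (@le_trans _ _ (K2 * tt * bump z)); last by apply: dom => //; lra.
  rewrite exprMn mulrACA rz /K2.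
  have h : z <= 4 * bump z by apply: le_bump_small; rewrite ltW.
  have := ler_wpM2l (mulr_ge0 (mulr_ge0 Kb0 (exprn_ge0 d (ler0n R 4))) (ltW tt0)) h.
  by move=> h'; apply: le_trans (le_trans _ h') _; rewrite le_eqVlt; apply/orP; left; apply/eqP; ring.
have [a Ha] := H x t r j sg r0 (ltW s1).
have [st|nst] := boolP (c1 * s <= y <= C1 * s); last first.
  have {}Ha xi : shell_box r j sg xi -> c3 * s <= gain x t xi.
    by move=> /Ha; rewrite -/s -/y (negPf nst).
  apply: (fin _ (Kb * r `^ beta * (c3 * s)^-1 ^+ d * (4 * r) ^+ d)).
    apply: box_integral_flat => //.
      by rewrite mulr_ge0// exprn_ge0// invr_ge0 ltW// mulr_gt0.
    move=> xi xiQ; apply: ler_pM; rewrite ?powR_ge0 ?HN//.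
      by rewrite exprn_ge0// invr_ge0 ltW// ibp_gain_gt0.
    rewrite ler_pXn2r ?nnegrE ?invr_ge0 ?(ltW (ibp_gain_gt0 _ _ _ _ _)) ?(ltW (mulr_gt0 c30 s0))//.
    by rewrite lef_pV2 ?posrE ?ibp_gain_gt0 ?(mulr_gt0 c30 s0)// Ha.
  apply: (@le_trans _ _ (K3 * tt * bump z)); last by apply: dom => //; lra.
  have zz : z * z = s ^+ d.
    by rewrite /z -powRD ?(gt_eqF s0) ?implybT// -splitr powR_mulrn// ltW.
  have -> : Kb * r `^ beta * (c3 * s)^-1 ^+ d * (4 * r) ^+ d =
      Kb * 4 ^+ d * c3^-1 ^+ d * tt * z^-1.
    rewrite exprMn invfM exprMn.
    rewrite (_ : _ * _ = Kb * 4 ^+ d * c3^-1 ^+ d * (r `^ beta * r ^+ d) * s^-1 ^+ d); last by ring.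
    rewrite rz [s^-1 ^+ d]exprVn -zz; field; exact: lt0r_neq0.
  have h : z^-1 <= 4 * bump z.
    apply: le_bump_large; rewrite /z -[leLHS]e1.
    by rewrite ge0_ler_powR ?nnegrE ?divr_ge0 ?ler0n ?(ltW s0)// ltW.
  have KK : 0 <= Kb * 4 ^+ d * c3^-1 ^+ d * tt.
    by rewrite !mulr_ge0 ?exprn_ge0 ?invr_ge0 ?(ltW c30) ?(ltW tt0).
  have := ler_wpM2l KK h.
  by move=> h'; apply: le_trans h' _; rewrite le_eqVlt; apply/orP; left; apply/eqP; rewrite /K3; ring.
have {}Ha xi : shell_box r j sg xi ->
    1 + c4 * s * r ^- 2 * enorm (xi - a) ^+ 2 <= gain x t xi.
  by move=> /Ha; rewrite -/s -/y st.
move: st => /andP[sy ys].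
pose b := c4 * s * r ^- 2.
have b0 : 0 < b.
  by apply: mulr_gt0; [exact: mulr_gt0|rewrite invr_gt0 exprn_gt0].
apply: (fin _ (Kb * r `^ beta * (pi / Num.sqrt b) ^+ d)).
  by apply: box_integral_cauchy Ha => //.
have sb : Num.sqrt b = Num.sqrt c4 * Num.sqrt s / r.
  have -> : b = (Num.sqrt c4 * Num.sqrt s / r) ^+ 2.
    by rewrite !exprMn !sqr_sqrtr ?(ltW c40) ?(ltW s0)// exprVn.
  by rewrite sqrtr_sqr ger0_norm// divr_ge0 ?mulr_ge0 ?sqrtr_ge0 ?(ltW r0).
have zs : z = Num.sqrt s ^+ d.
  rewrite /z -powR12_sqrt ?(ltW s0)// -powR_mulrn ?powR_ge0// -powRrM.
  by congr (_ `^ _); rewrite mulrC.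
have sc0 : 0 < Num.sqrt c4 by rewrite sqrtr_gt0.
have ss0 : 0 < Num.sqrt s by rewrite sqrtr_gt0.
have -> : Kb * r `^ beta * (pi / Num.sqrt b) ^+ d =
    Kb * (pi / Num.sqrt c4) ^+ d * tt.
  rewrite sb (_ : pi / (_ / r) = (pi / Num.sqrt c4) * (r * (Num.sqrt s)^-1)); last first.
    by field; rewrite !lt0r_neq0.
  rewrite exprMn [(r * _) ^+ d]exprMn.
  rewrite (_ : _ * (_ * (_ * _)) = Kb * (pi / Num.sqrt c4) ^+ d * (r `^ beta * r ^+ d) * (Num.sqrt s)^-1 ^+ d); last by ring.
  rewrite rz [(Num.sqrt s)^-1 ^+ d]exprVn -zs; field; exact: lt0r_neq0.
have C10 : 0 < C1.
  have : 0 < C1 * s by apply: lt_le_trans ys; apply: lt_le_trans sy; rewrite mulr_gt0.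
  by rewrite pmulr_lgt0.
have h : 1 <= (1 + C1) ^+ 2 / c1 * bump (y / s).
  have ys1 : c1 <= y / s by rewrite ler_pdivlMr.
  have ys2 : y / s <= C1 by rewrite ler_pdivrMr.
  move: (y / s) ys1 ys2 => v v1 v2; rewrite /bump.
  have v0 : 0 < v by lra.
  have v10 : 0 < (1 + v) ^+ 2 by rewrite exprn_gt0//; lra.
  rewrite mulf_div ler_pdivlMr ?(mulr_gt0 c10 v10)// mul1r mulrC.
  apply: ler_pM; [exact: ltW|exact: ltW| |exact: v1].
  by rewrite ler_pXn2r ?nnegrE//; lra.
apply: (@le_trans _ _ (K4 * tt * bump (y / s))); last by apply: dom => //; lra.
have KK : 0 <= Kb * (pi / Num.sqrt c4) ^+ d * tt.
  rewrite mulr_ge0 ?(ltW tt0)// mulr_ge0// exprn_ge0// divr_ge0 ?pi_ge0// ltW.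
have := ler_wpM2l KK h; rewrite mulr1 => h'.
by apply: le_trans h' _; rewrite le_eqVlt; apply/orP; left; apply/eqP; rewrite /K4; ring.
Qed.

End weight.

(** * The integral of the weight *)

Section total_weight.
Context {R : realType} {d : nat}.
Local Notation rV := 'rV[R]_d.
Local Notation mR := (measurableTypeR R).
Local Notation mu := (lebesgue_tuple R d).
Local Notation D := (@punctured R d).
Variables (alpha : R) (phi : rV -> R).

(** Large and small scales are the rays [e = 1] and [e = -1]; on each of them every
    power of the scale is a geometric progression indexed by [nat]. *)
Definition scale (e : R) (k : nat) : R := 2 `^ (e * k%:R).

Lemma scale_gt0 e k : 0 < scale e k. Proof. exact: powR_gt0. Qed.

Lemma scale_powR e k (b : R) : scale e k `^ b = (2 `^ (e * b)) ^+ k.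
Proof.
by rewrite -powR_mulrn ?powR_ge0// /scale -!powRrM; congr (_ `^ _); ring.
Qed.

Definition sgR (b : bool) : R := if b then 1 else -1.

Lemma dyadic_cover (u : d.-tuple mR) : D u ->
  exists (ejs : bool * 'I_d * bool) k,
    tuple_box (scale (sgR ejs.1.1) k) ejs.1.2 ejs.2 u.
Proof.
rewrite /punctured /= => u0.
have n0 : mx_norm (rowof u) != 0.
  by apply: contraNneq u0 => /mx_norm_eq0 ->.
have [[i0 j] /= nE] := mx_norm_neq0 n0.
rewrite ord1 in nE => {i0}.
have a0 : 0 < `|rowof u ord0 j|.
  by rewrite lt_neqAle normr_ge0 andbT eq_sym -nE.
have le_a i : `|rowof u ord0 i| <= `|rowof u ord0 j|.
  rewrite -nE mx_normrE; apply/bigmax_geP; right => /=.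
  by exists (ord0, i).
set a := `|rowof u ord0 j| in a0 le_a nE *.
have l2 : 0 < ln 2 :> R by rewrite ln_gt0// ltr1n.
pose m := Num.floor (ln a / ln 2).
have [m1 m2] : 2 `^ m%:~R <= a /\ a <= 2 * 2 `^ m%:~R.
  have := floor_itv (ln a / ln 2); rewrite -/m intrD => /andP[h1 h2].
  have aE : a = 2 `^ (ln a / ln 2).
    rewrite /powR ifF; last by rewrite pnatr_eq0.
    by rewrite divfK ?lt0r_neq0// lnK// posrE.
  split; first by rewrite [leRHS]aE; apply: ler_powR => //; rewrite ler1n.
  rewrite -{1}[2]powRr1// -powRD; last by rewrite pnatr_eq0 implybT.
  rewrite [leLHS]aE; apply: ler_powR; first by rewrite ler1n.
  by rewrite addrC; exact: ltW.
have [e [k sE]] : exists e k, 2 `^ m%:~R = scale (sgR e) k.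
  case: (m) => k; [exists true, k|exists false, k.+1]; rewrite /scale /sgR.
    by rewrite mul1r.
  by rewrite mulN1r NegzE mulrNz.
rewrite sE in m1 m2.
pose sg := 0 <= rowof u ord0 j.
exists (e, j, sg), k => i /=.
have -> : tnth u i = rowof u ord0 i by rewrite mxE.
rewrite /box_side; case: eqVneq => [->|ij]; last first.
  by rewrite /= in_itv/= -ler_norml (le_trans (le_a i)).
rewrite /sg; move: m1 m2; rewrite /a; case: ifPn => [s0|]; rewrite /= in_itv/=.
  by rewrite ger0_norm// => -> ->.
by rewrite -ltNge => s0; rewrite ltr0_norm// => ? ?; apply/andP; split; lra.
Qed.

Hypothesis phiH : almost_homogeneous alpha phi.
Hypotheses (alpha0 : alpha != 0) (alpha1 : alpha != 1).

(** Along the scales [r = 2^(e*k)] the quantities [s^(d/2)] and [y / s] are geometric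
    progressions of ratios [2^(e*alpha*d/2)] and [2^(e*(1-alpha))]; these differ
    from one exactly because [alpha] is neither [0] nor [1]. *)
Lemma ray_integral (e : R) j sg : e != 0 -> exists2 K : R, 0 <= K & forall x t, t != 0 ->
  (\sum_(k <oo) \int[mu]_(u in tuple_box (scale e k) j sg)
     (decay_weight alpha phi x t (rowof u))%:E <= (K * `|t| `^ (- (d%:R / 2)))%:E)%E.
Proof.
move=> e0; have [K K0 HK] := box_integral_bound phiH.
have d0 : d%:R != 0 :> R.
  by rewrite pnatr_eq0 -lt0n (leq_ltn_trans (leq0n j) (ltn_ord j)).
have pow_neq1 (b : R) : b != 0 -> (2 : R) `^ b != 1.
  by move=> b0; rewrite powR_eq1 !negb_or b0 andbT -leNgt ler0n andbT gt_eqF ?ltr1n.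
pose q1 : R := 2 `^ (e * (alpha * (d%:R / 2))).
pose q2 : R := 2 `^ (e * (1 - alpha)).
have q1n : q1 != 1.
  by apply: pow_neq1; rewrite !mulf_neq0// invr_eq0.
have q2n : q2 != 1.
  by apply: pow_neq1; rewrite !mulf_neq0// subr_eq0 eq_sym.
have [K1 K10 H1] := sum_bump_geometric (powR_gt0 _ (ltr0n _ 2)) q1n.
have [K2 K20 H2] := sum_bump_geometric (powR_gt0 _ (ltr0n _ 2)) q2n.
exists (K * (K1 + K2)); first by rewrite mulr_ge0 ?addr_ge0.
move=> x t t0; have T0 : 0 < `|t| by rewrite normr_gt0.
apply: lime_le.
  apply: is_cvg_nneseries => k _ _; apply: integral_ge0 => u _.
  by rewrite lee_fin decay_weight_ge0.
apply: nearW => n.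
pose c := `|t| `^ (d%:R / 2); pose c' := enorm x / `|t|.
have s1 k : (`|t| * scale e k `^ alpha) `^ (d%:R / 2) = c * q1 ^+ k.
  rewrite powRM ?powR_ge0// -powRrM scale_powR.
  by congr (_ * _ ^+ _); rewrite /q1.
have s2 k : enorm x * scale e k / (`|t| * scale e k `^ alpha) = c' * q2 ^+ k.
  rewrite -scale_powR powRD ?(gt_eqF (scale_gt0 e k)) ?implybT//.
  rewrite powRr1 ?powR_ge0// powRN /c'.
  have : scale e k `^ alpha != 0 by rewrite lt0r_neq0// powR_gt0// scale_gt0.
  by move: (_ `^ alpha) => z z0; field; rewrite z0 lt0r_neq0.
apply: (@le_trans _ _ (\sum_(0 <= k < n) (K * `|t| `^ (- (d%:R / 2)) *
    (bump (c * q1 ^+ k) + bump (c' * q2 ^+ k)))%:E)%E).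
  apply: lee_sum => k _; have := HK x t (scale e k) j sg t0 (scale_gt0 _ _).
  by rewrite s1 s2.
rewrite sumEFin lee_fin -mulr_sumr big_split/= !big_mkord.
rewrite [leRHS]mulrAC ler_wpM2l ?mulr_ge0 ?powR_ge0//.
by apply: lerD; [apply: H1|apply: H2]; rewrite /c /c' ?powR_ge0 ?divr_ge0 ?enorm_ge0.
Qed.

(** Finitely many rays of boxes cover the punctured space. *)
Lemma weight_integral_bound : exists2 K : R, 0 <= K & forall x t, t != 0 ->
  (\int[mu]_(u in D) (decay_weight alpha phi x t (rowof u))%:E <=
   (K * `|t| `^ (- (d%:R / 2)))%:E)%E.
Proof.
have e0 (b : bool) : sgR b != 0 by case: b; rewrite /= ?oner_neq0 ?oppr_eq0 ?oner_neq0.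
have /choice[K HK] : forall ejs : bool * 'I_d * bool, exists K : R, 0 <= K /\ forall x t, t != 0 ->
  (\sum_(k <oo) \int[mu]_(u in tuple_box (scale (sgR ejs.1.1) k) ejs.1.2 ejs.2)
     (decay_weight alpha phi x t (rowof u))%:E <= (K * `|t| `^ (- (d%:R / 2)))%:E)%E.
  move=> [[e j] sg]; have [K K0 HK] := ray_integral j sg (e0 e).
  by exists K.
exists (\sum_i K i); first by apply: sumr_ge0 => i _; have [] := HK i.
move=> x t t0.
pose Q (i : bool * 'I_d * bool) k := @tuple_box R d (scale (sgR i.1.1) k) i.1.2 i.2.
have mQ i k : measurable (Q i k) by exact: measurable_tuple_box.
have QD i k : Q i k `<=` D by apply: tuple_box_punctured; exact: scale_gt0.
have mD := @measurable_punctured R d.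
have W0 u : D u -> (0 <= (decay_weight alpha phi x t (rowof u))%:E)%E.
  by rewrite lee_fin decay_weight_ge0.
have mW := measurable_decay_weight phiH x t.
have mUQ i : measurable (\bigcup_k Q i k) by exact: bigcupT_measurable.
have UQD i : \bigcup_k Q i k `<=` D by move=> u [k _] /QD.
apply: (le_trans (integral_le_finite_cover mu mD W0 mW mUQ UQD _)).
  by move=> u /dyadic_cover[i [k Qu]]; exists i => //; exists k.
rewrite mulr_suml -sumEFin; apply: lee_sum => i _.
have [_ Hi] := HK i.
apply: le_trans (Hi x t t0).
apply: (integral_le_cover mu mD W0 mW).
- exact: mUQ.
- exact: UQD.
- exact: mQ.
- exact: QD.
- by [].
Qed.

End total_weight.

(** * The complex power of the Hessian determinant *)

Section amplitude.
Context {R : realType} {d : nat}.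
Local Notation rV := 'rV[R]_d.
Local Notation e_ i := (delta_mx ord0 i : 'rV[R]_d).
Variables (alpha : R) (phi : rV -> R).
Hypothesis phiH : almost_homogeneous alpha phi.
Local Notation beta := ((alpha - 2) * d%:R / 2).
Local Notation hdet := (fun xi : rV => \det (hessian phi xi)).

Definition log_det (xi : rV) : R := ln `|\det (hessian phi xi)|.

Lemma symbol_det (P : Type) :
  symbol (@invnorm R d P) d (fun _ xi => (enorm xi `^ (alpha - 2)) ^+ d) (fun _ => hdet).
Proof.
have W0 (p : P) (xi : rV) : xi != 0 -> 0 <= enorm xi `^ (alpha - 2) by move=> _; exact: powR_ge0.
have i0 (p : P) (xi : rV) : xi != 0 -> 0 <= @invnorm R d P p xi by move=> _; exact: invnorm_ge0.
rewrite /determinant; apply: symbol_sum => //.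
  by move=> p xi xi0; rewrite exprn_ge0 ?(W0 p).
move=> s; apply: symbol_scale.
have szI : size (index_enum 'I_d) = d by rewrite -[RHS]card_ord cardT enumT.
have := @symbol_prod R d P (@invnorm R d P) d (fun _ xi => enorm xi `^ (alpha - 2))
  _ (index_enum 'I_d) (fun i _ xi => hessian phi xi i (s i)) W0 i0.
rewrite szI; apply => i.
have -> : (fun (_ : P) xi => hessian phi xi i (s i)) =
    (fun _ xi => iter_partial [:: i; s i] phi xi).
  by apply/funext => p; apply/funext => xi; rewrite mxE.
by apply: (@symbol_iter_partial _ _ _ _ phiH P d [:: i; s i]).
Qed.

Lemma det_lower : exists2 c : R, 0 < c & forall xi : rV, xi != 0 ->
  c * (enorm xi `^ (alpha - 2)) ^+ d <= `|hdet xi|.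
Proof.
have [lam lam0 form] := hessian_form_ge phiH.
exists (lam ^+ d / (d`!)%:R).
  by rewrite divr_gt0 ?exprn_gt0// ltr0n fact_gt0.
move=> xi xi0; have N0 := enorm_gt0 xi0.
rewrite mulrAC -exprMn; apply: det_ge_form.
  by rewrite mulr_gt0// powR_gt0.
by move=> v; exact: form.
Qed.

Lemma det_neq0 (xi : rV) : xi != 0 -> hdet xi != 0.
Proof.
move=> xi0; have [c c0 H] := det_lower.
rewrite -normr_gt0; apply: lt_le_trans (H xi xi0).
by rewrite mulr_gt0// exprn_gt0// powR_gt0// enorm_gt0.
Qed.

(** The square spares a case distinction on the sign of the determinant. *)
Lemma log_detE (xi : rV) : log_det xi = ln (hdet xi * hdet xi) * 2^-1.
Proof.
rewrite /log_det; have [->|D0] := eqVneq (\det (hessian phi xi)) 0.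
  by rewrite normr0 mul0r ln0// mul0r.
rewrite -expr2 -real_normK ?num_real// lnXn ?normr_gt0//.
by rewrite [ln _ *+ 2]mulr2n; field.
Qed.

Lemma continuous_log_det (xi : rV) : xi != 0 -> {for xi, continuous log_det}.
Proof.
move=> xi0; have D0 := det_neq0 xi0.
apply: (@cont_eq _ _ (fun xi => ln (hdet xi * hdet xi) * 2^-1)).
  by move=> y; rewrite log_detE.
apply: cont_mul; last exact: cont_cst.
have dc : {for xi, continuous hdet}.
  exact: (symbol_cont (symbol_det unit) (p := tt) xi0).
apply: (@cont_comp _ _ (fun xi => hdet xi * hdet xi) (@ln R)); first exact: cont_mul.
by apply: continuous_ln; rewrite -expr2 exprn_even_gt0.
Qed.

Lemma derive_log_det (P : Type) k i : d = k.+1 -> exists g : P -> rV -> R,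
  (forall p xi, xi != 0 -> is_derive xi (e_ i) log_det (g p xi)) /\
  symbol (@invnorm R d P) k (@invnorm R d P) g.
Proof.
move=> dk.
have sD : symbol (@invnorm R d P) k.+1 (fun _ xi => (enorm xi `^ (alpha - 2)) ^+ d) (fun _ => hdet).
  by apply: symbolWn (symbol_det P); rewrite -dk.
have [_ _ /(_ i)[D' [dD sD']]] := sD.
exists (fun p xi => D' p xi * (hdet xi)^-1); split.
  move=> p xi xi0; have D0 := det_neq0 xi0.
  rewrite (_ : log_det = fun xi => ln (hdet xi * hdet xi) * 2^-1); last first.
    by apply/funext => y; exact: log_detE.
  have D20 : 0 < hdet xi * hdet xi by rewrite -expr2 exprn_even_gt0.
  have := deriveF_mul (is_derive_rcomp (deriveF_mul (dD p xi xi0) (dD p xi xi0))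
    (is_derive1_ln D20)) (deriveF_cst 2^-1 xi (e_ i)).
  by move/is_derive_eq; apply; rewrite mulr0 addr0; field.
have [c c0 Hc] := det_lower.
have W0 (p : P) (xi : rV) : xi != 0 -> 0 < (enorm xi `^ (alpha - 2)) ^+ d.
  by move=> xi0; rewrite exprn_gt0// powR_gt0// enorm_gt0.
have sV := symbol_inv c0 W0 (fun p xi xi0 => Hc xi xi0) (symbolW sD).
have := symbol_mul sD' sV.
apply: symbol_eqw => p xi xi0; have := lt0r_neq0 (W0 p xi xi0) => w0.
by rewrite mulrAC divff ?mul1r.
Qed.

Lemma sqrt_det_le : exists2 C : R, 0 <= C & forall xi : rV, xi != 0 ->
  expR (log_det xi / 2) <= C * enorm xi `^ beta.
Proof.
have [C C0 HC] := symbol_bound (symbol_det unit).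
exists (C `^ (2^-1)); first exact: powR_ge0.
move=> xi xi0; have N0 := enorm_gt0 xi0.
have D0 : 0 < `|hdet xi| by rewrite normr_gt0 det_neq0.
have -> : expR (log_det xi / 2) = `|hdet xi| `^ (2^-1).
  by rewrite /powR ifF ?(gt_eqF D0)// mulrC.
have -> : enorm xi `^ beta = ((enorm xi `^ (alpha - 2)) ^+ d) `^ (2^-1).
  by rewrite -powR_mulrn ?powR_ge0// -!powRrM mulrA.
rewrite -powRM ?exprn_ge0 ?powR_ge0//.
apply: ge0_ler_powR; rewrite ?nnegrE ?invr_ge0 ?mulr_ge0 ?exprn_ge0 ?powR_ge0//.
by have := HC tt xi xi0; rewrite [X in _ <= _ * X]ger0_norm// exprn_ge0// powR_ge0.
Qed.

(** The real and imaginary parts of [|det H phi| ^ (1/2 + i * kappa)]. *)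
Definition det_cos (kappa : R) (xi : rV) := expR (log_det xi / 2) * cos (kappa * log_det xi).
Definition det_sin (kappa : R) (xi : rV) := expR (log_det xi / 2) * sin (kappa * log_det xi).

Lemma symbol_det_power (P : Type) (kap T : P -> R) (X : P -> rV) : (0 < d)%N ->
  symbol (ibp_cost alpha phi kap T X) d (fun _ xi => enorm xi `^ beta) (fun p => det_cos (kap p)) /\
  symbol (ibp_cost alpha phi kap T X) d (fun _ xi => enorm xi `^ beta) (fun p => det_sin (kap p)).
Proof.
move=> d0; have [C C0 HC] := sqrt_det_le.
have dk : d = d.-1.+1 by rewrite prednK.
have [sc ss] := @symbol_exp_pair R d P d.-1 (@invnorm R d P) kap
  (fun _ xi => C * enorm xi `^ beta) (fun _ => log_det)
  (fun p xi _ => invnorm_ge0 p xi) (fun _ xi xi0 => HC xi xi0)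
  (fun _ xi xi0 => continuous_log_det xi0) (fun i => derive_log_det P i dk).
have [K HK] := invnorm_le_cost phiH (fun _ => 0) T X.
have A0 (p : P) (xi : rV) : xi != 0 -> 0 <= C * enorm xi `^ beta <= C * enorm xi `^ beta.
  by move=> xi0; rewrite lexx andbT mulr_ge0// powR_ge0.
have cst p (xi : rV) : xi != 0 -> 0 <= (1 + `|kap p|) * @invnorm R d P p xi <=
    K * ibp_cost alpha phi kap T X p xi.
  move=> xi0; have k0 : 0 <= 1 + `|kap p| by rewrite addr_ge0.
  rewrite mulr_ge0 ?invnorm_ge0//=; have /andP[_ /(ler_wpM2l k0)] := HK p xi xi0.
  by rewrite /ibp_cost normr0 addr0 mul1r [leRHS]mulrCA.
rewrite -dk in sc ss.
by split; [apply: (symbol_le A0 cst sc)|apply: (symbol_le A0 cst ss)].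
Qed.

End amplitude.

(** * Removal of the truncation *)

Section truncation.
Context {R : realType} {d : nat}.
Local Notation rV := 'rV[R]_d.
Local Notation mR := (measurableTypeR R).
Local Notation mu := (lebesgue_tuple R d).
Local Notation D := (@punctured R d).
Variables (alpha : R) (phi : rV -> R).
Hypothesis phiH : almost_homogeneous alpha phi.
Hypotheses (alpha0 : alpha != 0) (alpha1 : alpha != 1) (d0 : (0 < d)%N).
Local Notation beta := ((alpha - 2) * d%:R / 2).

Variable g0 : R -> R.
Hypotheses (g0s : smooth g0) (g0_out : forall s, 1 <= `|s| -> g0 s = 0)
  (g0_in : forall s, `|s| < 2^-1 -> g0 s = 1).

(** At every point but the origin these truncations are eventually one, while each of
    them is supported in an annulus. *)
Definition truncation (n : nat) (xi : rV) : R :=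
  g0 (n.+1%:R^-1 * enorm xi) * (1 - g0 (n.+1%:R * enorm xi)).

Lemma symbol_truncation (P : Type) (n : P -> nat) k :
  symbol (@invnorm R d P) k (fun _ _ => 1) (fun p => truncation (n p)).
Proof.
have one0 (p : P) (xi : rV) : xi != 0 -> 0 <= 1 :> R by [].
have i0 (p : P) (xi : rV) : xi != 0 -> 0 <= @invnorm R d P p xi by move=> _; exact: invnorm_ge0.
apply: (symbol_eqw (A := fun _ _ => 1 * 1)); first by move=> *; rewrite mulr1.
apply: symbol_mul; first exact: (symbol_cutoff k (fun p => (n p).+1%:R^-1) g0s g0_out).
apply: symbol_add.
  by apply: (@symbol_cst _ _ _ _ _ _ (fun=> 1) 1) => // *; rewrite normr1 mul1r.
apply: symbol_opp; exact: (symbol_cutoff k (fun p => (n p).+1%:R) g0s g0_out).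
Qed.

Lemma truncation_eq1 (xi : rV) : xi != 0 -> \forall n \near \oo, truncation n xi = 1.
Proof.
move=> xi0; have N0 := enorm_gt0 xi0.
have [m Hm] : exists m : nat, 2 * enorm xi + (enorm xi)^-1 < m.+1%:R.
  exists (Num.trunc (2 * enorm xi + (enorm xi)^-1)).
  by apply: truncnS_gt.
exists m => //= n mn.
have {}Hm : 2 * enorm xi + (enorm xi)^-1 < n.+1%:R.
  by apply: lt_le_trans Hm _; rewrite ler_nat ltnS.
have V0 : 0 < (enorm xi)^-1 by rewrite invr_gt0.
rewrite /truncation g0_in; last first.
  rewrite ger0_norm ?mulr_ge0 ?invr_ge0 ?(ltW N0)// mulrC ltr_pdivrMr// mulrC ltr_pdivlMr//.
  lra.
rewrite g0_out ?subr0 ?mulr1// ger0_norm ?mulr_ge0 ?(ltW N0)//.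
rewrite -ler_pdivrMr// mul1r.
lra.
Qed.

Lemma annular_truncation n : annular (truncation n).
Proof.
split.
  by move=> xi xi0; exact: (symbol_cont (symbol_truncation (fun _ : unit => n) 0) (p := tt) xi0).
have n0 : 0 < n.+1%:R :> R by [].
exists (n.+1%:R^-1 / 2); first by rewrite !divr_gt0// invr_gt0.
exists n.+1%:R => xi xi0 [N1|N1]; rewrite /truncation.
  rewrite [X in 1 - X]g0_in ?subrr ?mulr0//.
  rewrite ger0_norm ?mulr_ge0 ?enorm_ge0// mulrC -ltr_pdivlMr//.
  by rewrite mulrC.
rewrite g0_out ?mul0r// ger0_norm ?mulr_ge0 ?invr_ge0 ?enorm_ge0//.
by rewrite mulrC ler_pdivlMr// mul1r ltW.
Qed.

Variables (g : R -> R) (a0 b0 : R).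
Hypotheses (gs : smooth g) (g_out : forall s, 1 <= `|s| -> g s = 0).
Variable F : R -> rV -> R.
Hypothesis sF : forall (P : Type) (kap T : P -> R) (X : P -> rV),
  symbol (ibp_cost alpha phi kap T X) d (fun _ xi => enorm xi `^ beta) (fun p => F (kap p)).

(** Covers the real and imaginary parts of both [chi] and [1 - chi]. *)
Definition radial_cutoff (e : R) (xi : rV) : R := a0 + b0 * g (e * enorm xi).

Lemma symbol_radial_cutoff (P : Type) (e : P -> R) k :
  symbol (@invnorm R d P) k (fun _ _ => 1) (fun p => radial_cutoff (e p)).
Proof.
have one0 (p : P) (xi : rV) : xi != 0 -> 0 <= 1 :> R by [].
have i0 (p : P) (xi : rV) : xi != 0 -> 0 <= @invnorm R d P p xi by move=> _; exact: invnorm_ge0.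
apply: symbol_add.
  by apply: (@symbol_cst _ _ _ _ _ _ (fun=> a0) `|a0|) => // *; rewrite mulr1.
apply: symbol_scale; exact: (symbol_cutoff k e gs g_out).
Qed.

(** All of [kappa], [x], [t], the dilation [e] and the truncation [n] belong to the
    parameter of one family of symbols, so the bound is uniform in them. *)
Lemma truncated_bound : exists2 C : R, 0 <= C & forall kappa x t e n theta, t != 0 ->
  `|\int[mu]_(u in D) (cos (phase phi x t (rowof u) + theta) *
      (truncation n (rowof u) * (radial_cutoff e (rowof u) * F kappa (rowof u))))|
  <= C * (1 + `|kappa|) ^+ d * `|t| `^ (- (d%:R / 2)).
Proof.
pose P := (((R * rV) * (R * R)) * nat)%type.
pose kap (p : P) := p.1.1.1; pose X (p : P) := p.1.1.2.
pose T (p : P) := p.1.2.1; pose E (p : P) := p.1.2.2.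
pose a (p : P) xi := truncation p.2 xi * (radial_cutoff (E p) xi * F (kap p) xi).
have one0 (p : P) (xi : rV) : xi != 0 -> 0 <= 1 :> R by [].
have A0 (p : P) (xi : rV) : xi != 0 -> 0 <= enorm xi `^ beta by move=> _; exact: powR_ge0.
have sa : symbol (ibp_cost alpha phi kap T X) d (fun _ xi => enorm xi `^ beta) a.
  apply: (symbol_eqw (A := fun _ xi => 1 * (1 * enorm xi `^ beta))).
    by move=> *; rewrite !mul1r.
  apply: symbol_mul; first exact: (symbol_cost phiH kap T X one0 (symbol_truncation (fun p : P => p.2) d)).
  apply: symbol_mul; first exact: (symbol_cost phiH kap T X one0 (symbol_radial_cutoff E d)).
  exact: sF.
have aa p : annular (a p).
  rewrite (_ : a p = fun xi => (radial_cutoff (E p) xi * F (kap p) xi) * truncation p.2 xi); last first.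
    by apply/funext => xi; rewrite mulrC.
  apply: annular_mul; last exact: annular_truncation.
  move=> xi xi0; apply: cont_mul.
    exact: (symbol_cont (symbol_radial_cutoff E 0) xi0).
  exact: (symbol_cont (sF kap T X) xi0).
have [C C0 HC] := osc_integral_bound phiH (leqnn d) A0
  (fun p xi xi0 => @continuous_enorm_powR R d beta xi xi0) sa aa.
have [K K0 HK] := weight_integral_bound phiH alpha0 alpha1.
exists (C * K); first by rewrite mulr_ge0.
move=> kappa x t e n theta t0.
have := HC ((kappa, x), (t, e), n) theta; rewrite /osc_integral /a /X /T /kap /E /=.
rewrite -lee_fin => H; apply: le_trans H _.
have k0 : 0 <= (1 + `|kappa|) ^+ d by rewrite exprn_ge0// addr_ge0.
rewrite (eq_integral (fun u => (((1 + `|kappa|) ^+ d)%:E *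
   (decay_weight alpha phi x t (rowof u))%:E)%E)); last first.
  by move=> u _; rewrite /decay_weight -EFinM exprMn; congr EFin; ring.
have mD := @measurable_punctured R d.
rewrite ge0_integralZl//; last 2 first.
- exact: measurable_decay_weight.
- by move=> u _; rewrite lee_fin decay_weight_ge0.
have := HK x t t0 => HK'.
rewrite muleA -EFinM.
have Ck0 : 0 <= C * (1 + `|kappa|) ^+ d by rewrite mulr_ge0.
apply: (@le_trans _ _ ((C * (1 + `|kappa|) ^+ d)%:E * (K * `|t| `^ (- (d%:R / 2)))%:E)%E).
  by rewrite lee_wpmul2l ?lee_fin.
by rewrite -EFinM lee_fin le_eqVlt; apply/orP; left; apply/eqP; ring.
Qed.

(** The cutoff confines the support to the region where the homogeneity
    [|xi| `^ alpha] is bounded. *)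
Hypothesis cutoff_support :
  (0 < alpha /\ a0 = 0) \/ (alpha < 0 /\ forall s, `|s| < 2^-1 -> a0 + b0 * g s = 0).

Lemma cutoff_support_bound (e : R) : 0 < e -> exists M : R, 0 <= M /\
  forall xi : rV, xi != 0 -> radial_cutoff e xi != 0 -> enorm xi `^ alpha <= M.
Proof.
move=> e0; case: cutoff_support => [[al a00]|[al gin]].
  exists (e^-1 `^ alpha); split; first exact: powR_ge0.
  move=> xi xi0 cut0; have N0 := enorm_gt0 xi0.
  have [h|h] := leP (enorm xi) e^-1.
    by apply: ge0_ler_powR; rewrite ?nnegrE ?enorm_ge0 ?invr_ge0 ?(ltW al) ?(ltW e0).
  case/eqP: cut0; rewrite /radial_cutoff a00 add0r g_out ?mulr0//.
  rewrite ger0_norm ?mulr_ge0 ?(ltW e0) ?enorm_ge0//.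
  by rewrite mulrC -ler_pdivrMr// mul1r ltW.
exists ((2 * e) `^ (- alpha)); split; first exact: powR_ge0.
move=> xi xi0 cut0; have N0 := enorm_gt0 xi0.
have [h|h] := leP (2^-1) (e * enorm xi).
  have -> : enorm xi `^ alpha = (enorm xi `^ (- alpha))^-1.
    by rewrite powRN invrK.
  rewrite -[leLHS]mul1r ler_pdivrMr ?powR_gt0// -powRM ?mulr_ge0 ?(ltW e0) ?(ltW N0)//.
  rewrite -[leLHS](powRr0 (2 * e * enorm xi)); apply: ler_powR; last by lra.
  by rewrite -mulrA -ler_pdivrMl// mulr1.
case/eqP: cut0; rewrite /radial_cutoff gin//.
by rewrite ger0_norm// mulr_ge0 ?(ltW e0) ?enorm_ge0.
Qed.

(** Where [|xi|^alpha] is bounded so is the gain at [x = 0] and [t = 1].  The weight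
    for these values is integrable by the very estimate at [t = 1], and serves as
    an integrable majorant of the amplitude. *)
Lemma dominated_amplitude (e kappa : R) : 0 < e -> exists2 M : R, 0 <= M &
  forall xi : rV, xi != 0 -> `|radial_cutoff e xi * F kappa xi| <= M * decay_weight alpha phi 0 1 xi.
Proof.
move=> e0; have [M [M0 HM]] := cutoff_support_bound e0.
have [Cc Cc0 HCc] := symbol_bound (symbol_radial_cutoff (fun _ : unit => e) 0).
have [CF CF0 HCF] := symbol_bound (sF (fun _ : unit => kappa) (fun=> 1) (fun=> 0)).
have [K K0 HK] := ibp_gain_le phiH.
have KM0 : 0 < K * (1 + M) by rewrite mulr_gt0// ltr_wpDr.
exists (Cc * CF * (K * (1 + M)) ^+ d).
  by rewrite !mulr_ge0 ?exprn_ge0// ltW.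
move=> xi xi0; have [->|cut0] := eqVneq (radial_cutoff e xi) 0.
  rewrite mul0r normr0 mulr_ge0 ?decay_weight_ge0// !mulr_ge0// exprn_ge0// ltW//.
have gle : ibp_gain alpha phi 0 1 xi <= K * (1 + M).
  apply: le_trans (HK 0 1 xi xi0) _; rewrite ler_pM2l//.
  by rewrite /phase_size enorm0 mul0r addr0 normr1 mul1r lerD2l HM.
have g1 := ibp_gain_gt0 alpha phi 0 1 xi.
rewrite normrM.
have h1 := HCc tt xi xi0; rewrite normr1 mulr1 in h1.
have h2 := HCF tt xi xi0; rewrite (ger0_norm (powR_ge0 _ _)) in h2.
apply: (@le_trans _ _ (Cc * (CF * enorm xi `^ beta))); first by rewrite ler_pM.
rewrite /decay_weight (_ : Cc * CF * _ * _ = Cc * (CF * (enorm xi `^ beta *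
  ((K * (1 + M)) ^+ d * (ibp_gain alpha phi 0 1 xi)^-1 ^+ d)))); last by ring.
rewrite ler_wpM2l// ler_wpM2l//.
rewrite ler_peMr ?powR_ge0// -exprMn exprn_ege1//.
by rewrite ler_pdivlMr// mul1r.
Qed.

Lemma radial_amplitude_integrable (e kappa : R) (b : rV -> R) : 0 < e ->
  (forall xi, xi != 0 -> {for xi, continuous b}) ->
  (forall xi, `|b xi| <= 1) ->
  mu.-integrable D (fun u => (b (rowof u) * (radial_cutoff e (rowof u) * F kappa (rowof u)))%:E).
Proof.
move=> e0 bc b1; have [M M0 HM] := dominated_amplitude kappa e0.
have W0 (u : d.-tuple mR) : 0 <= decay_weight alpha phi 0 1 (rowof u).
  exact: decay_weight_ge0.
have mD := @measurable_punctured R d.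
apply: (@le_integrable _ _ _ mu D mD _ (fun u => (M * decay_weight alpha phi 0 1 (rowof u))%:E)).
- apply/measurable_EFinP.
  apply: (@measurable_continuous _ _ (fun xi => b xi * (radial_cutoff e xi * F kappa xi))).
  move=> xi xi0; apply: cont_mul; first exact: bc.
  apply: cont_mul.
    exact: (symbol_cont (symbol_radial_cutoff (fun _ : unit => e) 0) (p := tt) xi0).
  exact: (symbol_cont (sF (fun _ : unit => kappa) (fun=> 1) (fun=> 0)) (p := tt) xi0).
- move=> u uD; rewrite !abse_EFin lee_fin [leRHS]ger0_norm ?(mulr_ge0 M0 (W0 _))//.
  by rewrite normrM -[leRHS]mul1r ler_pM// HM.
have [K K0 HK] := weight_integral_bound phiH alpha0 alpha1.
apply/integrableP; split.
  under eq_fun do rewrite EFinM.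
  by apply: measurable_funeM; exact: measurable_decay_weight.
under eq_integral do rewrite abse_EFin ger0_norm ?(mulr_ge0 M0 (W0 _))// EFinM.
rewrite ge0_integralZl//; last 2 first.
- exact: measurable_decay_weight.
- by move=> u _; rewrite lee_fin decay_weight_ge0.
apply: lte_mul_pinfty; rewrite ?lee_fin//.
by apply: le_lt_trans (HK 0 1 (oner_neq0 _)) _; rewrite ltry.
Qed.

(** The bounds for the truncated integrals are uniform, and pass to the limit by
    dominated convergence. *)
Lemma cutoff_bound : exists2 C : R, 0 <= C & forall kappa x t e theta, t != 0 -> 0 < e ->
  `|\int[mu]_(u in D) (cos (phase phi x t (rowof u) + theta) *
      (radial_cutoff e (rowof u) * F kappa (rowof u)))|
  <= C * (1 + `|kappa|) ^+ d * `|t| `^ (- (d%:R / 2)).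
Proof.
have [C C0 HC] := truncated_bound; exists C => // kappa x t e theta t0 e0.
set B := C * _ * _.
have [M M0 HM] := dominated_amplitude kappa e0.
have [Ct Ct0 HCt] := symbol_bound (symbol_truncation (fun n : nat => n) 0).
have mD := @measurable_punctured R d.
have cosc (xi : rV) : xi != 0 ->
    {for xi, continuous (fun xi => cos (phase phi x t xi + theta))}.
  by move=> xi0; have := @continuous_cos_phase R d alpha phi phiH unit (fun=> t) (fun=> x) tt theta xi xi0.
have [K K0 HK] := weight_integral_bound phiH alpha0 alpha1.
pose h (u : d.-tuple mR) := cos (phase phi x t (rowof u) + theta).
pose cF (u : d.-tuple mR) := radial_cutoff e (rowof u) * F kappa (rowof u).
pose G (u : d.-tuple mR) := Ct * M * decay_weight alpha phi 0 1 (rowof u).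
have CM0 : 0 <= Ct * M by rewrite mulr_ge0.
have h1 u : `|h u| <= 1 by rewrite ler_norml cos_geN1 cos_le1.
have W0 (u : d.-tuple mR) : 0 <= decay_weight alpha phi 0 1 (rowof u).
  exact: decay_weight_ge0.
have iG : mu.-integrable D (EFin \o G).
  apply/integrableP; split.
    rewrite (_ : EFin \o G = fun u => ((Ct * M)%:E * (decay_weight alpha phi 0 1 (rowof u))%:E)%E)//.
    by apply: measurable_funeM; exact: measurable_decay_weight.
  under eq_integral do rewrite abse_EFin ger0_norm ?(mulr_ge0 CM0 (W0 _))// EFinM.
  rewrite ge0_integralZl//; last 2 first.
  - exact: measurable_decay_weight.
  - by move=> u _; rewrite lee_fin decay_weight_ge0.
  apply: lte_mul_pinfty; rewrite ?lee_fin//.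
  by apply: le_lt_trans (HK 0 1 (oner_neq0 _)) _; rewrite ltry.
have acont xi : xi != 0 -> {for xi, continuous (fun xi => radial_cutoff e xi * F kappa xi)}.
  move=> xi0; apply: cont_mul.
    exact: (symbol_cont (symbol_radial_cutoff (fun _ : unit => e) 0) (p := tt) xi0).
  exact: (symbol_cont (sF (fun _ : unit => kappa) (fun=> 1) (fun=> 0)) (p := tt) xi0).
have tcont n xi : xi != 0 -> {for xi, continuous (truncation n)}.
  by move=> xi0; case: (annular_truncation n) => + _; exact.
have mf n : measurable_fun D (fun u => (h u * (truncation n (rowof u) * cF u))%:E).
  apply/measurable_EFinP.
  apply: (@measurable_continuous _ _ (fun xi => cos (phase phi x t xi + theta) *
    (truncation n xi * (radial_cutoff e xi * F kappa xi)))) => xi xi0.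
  apply: cont_mul; first exact: cosc.
  by apply: cont_mul; [exact: tcont|exact: acont].
have cvgf u : D u -> (h u * (truncation n (rowof u) * cF u))%:E @[n --> \oo] --> (h u * cF u)%:E.
  move=> uD; apply: cvg_near_cst; apply: filterS (truncation_eq1 uD) => n ->.
  by rewrite mul1r.
have domf n u : D u -> (`|(h u * (truncation n (rowof u) * cF u))%:E| <= (EFin \o G) u)%E.
  move=> uD; rewrite abse_EFin lee_fin normrM -[leRHS]mul1r ler_pM// normrM /G -mulrA.
  apply: ler_pM => //; last exact: HM.
  by have := HCt n _ uD; rewrite normr1 mulr1.
have finG u : D u -> (EFin \o G) u \is a fin_num by [].
have /cvg_abse cvgI := dominated_cvg mD mf cvgf finG iG domf.
have BI n : (`|\int[mu]_(u in D) (h u * (truncation n (rowof u) * cF u))%:E| <= B%:E)%E.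
  have iF : mu.-integrable D (fun u => (h u * (truncation n (rowof u) * cF u))%:E).
    apply: (@le_integrable _ _ _ mu D mD _ (EFin \o G) (mf n) _ iG) => u uD.
    by apply: le_trans (domf n u uD) _; rewrite lee_abs.
  by rewrite -EFin_normr_Rintegral// lee_fin; exact: HC.
have icut : mu.-integrable D (fun u => (h u * cF u)%:E).
  by apply: (radial_amplitude_integrable kappa e0 cosc) => xi; rewrite ler_norml cos_geN1 cos_le1.
rewrite -lee_fin EFin_normr_Rintegral//.
rewrite -(cvg_lim _ cvgI)//; apply: lime_le.
  by apply/cvg_ex; eexists; exact: cvgI.
by apply: nearW => n; exact: BI.
Qed.

End truncation.

(** * The oscillatory integrals *)

Section conclusion.
Context {R : realType} {d : nat}.
Local Notation rV := 'rV[R]_d.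
Local Notation mR := (measurableTypeR R).
Local Notation mu := (lebesgue_tuple R d).
Local Notation D := (@punctured R d).
Local Open Scope complex_scope.

Lemma Rintegral_punctured (h : d.-tuple mR -> R) : (0 < d)%N ->
  mu.-integrable D (EFin \o h) -> \int[mu]_u h u = \int[mu]_(u in D) h u.
Proof.
move=> d0 ih; have mD := @measurable_punctured R d.
have mC : measurable (~` D) by exact: measurableC.
have DT : setT `\` ~` D = D by rewrite setTD setCK.
have mh : measurable_fun setT (EFin \o h).
  rewrite -(setUv D); apply/measurable_funU => //; split.
    exact: measurable_int ih.
  have [z DCz] : exists z, ~` D `<=` [set z].
    exists [tuple 0 | i < d]; rewrite setC_punctured => u /= u0.
    by apply/eq_from_tnth => i; rewrite tnth_mktuple; exact: u0.
  move=> _ Y _; have [Yz|Yz] := pselect (Y (h z)%:E).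
    rewrite (_ : _ `&` _ = ~` D)//; apply/seteqP; split => [u []//|u Du].
    by split => //; rewrite /preimage /= (DCz _ Du).
  rewrite (_ : _ `&` _ = set0)//; apply/seteqP; split => [u [Du]|//].
  by rewrite /preimage /= (DCz _ Du).
have iT : mu.-integrable setT (EFin \o h).
  by apply/(negligible_integrable mC measurableT mh (punctured_conull d0)); rewrite DT.
by rewrite /Rintegral (negligible_integral mC measurableT iT (punctured_conull d0)) DT.
Qed.

Lemma normc_le (x y : R) : Normc.normc (x +i* y) <= `|x| + `|y|.
Proof.
rewrite /Normc.normc -(ger0_norm (addr_ge0 (normr_ge0 x) (normr_ge0 y))) -sqrtr_sqr.
apply: ler_wsqrtr; rewrite sqrrD !real_normK ?num_real//.
by rewrite addrAC lerDl mulrn_wge0// mulr_ge0.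
Qed.

Variables (alpha : R) (phi : rV -> R).
Hypothesis phiH : almost_homogeneous alpha phi.
Hypotheses (alpha0 : alpha != 0) (alpha1 : alpha != 1) (d0 : (0 < d)%N).
Variables (g0 : R -> R).
Hypotheses (g0s : smooth g0) (g0_out : forall s, 1 <= `|s| -> g0 s = 0)
  (g0_in : forall s, `|s| < 2^-1 -> g0 s = 1).

Variables (g1 g2 : R -> R) (a1 b1 a2 b2 : R).
Hypotheses (g1s : smooth g1) (g1_out : forall s, 1 <= `|s| -> g1 s = 0).
Hypotheses (g2s : smooth g2) (g2_out : forall s, 1 <= `|s| -> g2 s = 0).
Hypothesis support1 :
  (0 < alpha /\ a1 = 0) \/ (alpha < 0 /\ forall s, `|s| < 2^-1 -> a1 + b1 * g1 s = 0).
Hypothesis support2 :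
  (0 < alpha /\ a2 = 0) \/ (alpha < 0 /\ forall s, `|s| < 2^-1 -> a2 + b2 * g2 s = 0).
Local Notation r1 := (radial_cutoff g1 a1 b1).
Local Notation r2 := (radial_cutoff g2 a2 b2).
Local Notation cosp x t theta xi := (cos (phase phi x t xi + theta)).

(** For [theta' = theta + pi / 2] this is the real part ([theta = 0]) or the imaginary
    part ([theta = - pi / 2]) of the product of [exp (i * phase)], the cutoff
    [r1 + i * r2] and the complex power of the determinant. *)
Lemma oscillatory_component_bound : exists2 C : R, 0 <= C &
  forall kappa x t e theta theta', t != 0 -> 0 < e ->
  `|\int[mu]_u (cosp x t theta (rowof u) * (r1 e (rowof u) * det_cos phi kappa (rowof u))
     + cosp x t theta' (rowof u) * (r2 e (rowof u) * det_cos phi kappa (rowof u))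
     + (cosp x t theta' (rowof u) * (r1 e (rowof u) * det_sin phi kappa (rowof u))
     - cosp x t theta (rowof u) * (r2 e (rowof u) * det_sin phi kappa (rowof u))))|
  <= C * (1 + `|kappa|) ^+ d * `|t| `^ (- (d%:R / 2)).
Proof.
have sc P kap T X := (@symbol_det_power _ _ _ _ phiH P kap T X d0).1.
have ss P kap T X := (@symbol_det_power _ _ _ _ phiH P kap T X d0).2.
have [C1 C10 H1] := cutoff_bound phiH alpha0 alpha1 g0s g0_out g0_in g1s g1_out sc support1.
have [C2 C20 H2] := cutoff_bound phiH alpha0 alpha1 g0s g0_out g0_in g2s g2_out sc support2.
have [C3 C30 H3] := cutoff_bound phiH alpha0 alpha1 g0s g0_out g0_in g1s g1_out ss support1.
have [C4 C40 H4] := cutoff_bound phiH alpha0 alpha1 g0s g0_out g0_in g2s g2_out ss support2.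
exists (C1 + C2 + (C3 + C4)); first by rewrite !addr_ge0.
move=> kappa x t e th th' t0 e0.
have mD := @measurable_punctured R d.
have cc theta (xi : rV) : xi != 0 -> {for xi, continuous (fun xi => cosp x t theta xi)}.
  by move=> xi0; have := @continuous_cos_phase R d alpha phi phiH unit (fun=> t) (fun=> x) tt theta xi xi0.
have cb theta (xi : rV) : `|cosp x t theta xi| <= 1 by rewrite ler_norml cos_geN1 cos_le1.
have I1 := radial_amplitude_integrable phiH alpha0 alpha1 g1s g1_out sc support1 kappa e0 (cc th) (cb th).
have I2 := radial_amplitude_integrable phiH alpha0 alpha1 g2s g2_out sc support2 kappa e0 (cc th') (cb th').
have I3 := radial_amplitude_integrable phiH alpha0 alpha1 g1s g1_out ss support1 kappa e0 (cc th') (cb th').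
have I4 := radial_amplitude_integrable phiH alpha0 alpha1 g2s g2_out ss support2 kappa e0 (cc th) (cb th).
have I12 := integrableD mD I1 I2.
have I34 := integrableB mD I3 I4.
rewrite Rintegral_punctured//; last exact: (integrableD mD I12 I34).
rewrite RintegralD// RintegralD// RintegralB//.
rewrite !mulrDl.
apply: le_trans (ler_normD _ _) _; apply: lerD.
  by apply: le_trans (ler_normD _ _) _; apply: lerD; [exact: H1|exact: H2].
by apply: le_trans (ler_normB _ _) _; apply: lerD; [exact: H3|exact: H4].
Qed.

Lemma oscillatory_bound : exists2 C : R, 0 <= C &
  forall kappa x t e, t != 0 -> 0 < e ->
  Normc.normc (Cintegral (fun xi : rV => cexp (0 +i* (dotv x xi + t * phi xi)) *
    (r1 e xi +i* r2 e xi) * cpowR `|\det (hessian phi xi)| (2^-1 +i* kappa)))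
  <= C * (1 + `|kappa|) `^ d%:R * `|t| `^ (- (d%:R / 2)).
Proof.
have [C C0 HC] := oscillatory_component_bound.
(* the real and the imaginary part contribute one constant each *)
exists (C + C); first by rewrite addr_ge0.
move=> kappa x t e t0 e0; rewrite powR_mulrn ?addr_ge0// !mulrDl.
apply: le_trans (normc_le _ _) _; apply: lerD.
  apply: le_trans (HC kappa x t e 0 (pi / 2) t0 e0).
  rewrite le_eqVlt; apply/orP; left; apply/eqP; congr (`|_|); apply: eq_Rintegral => u _ /=.
  rewrite /cexp /cpowR /det_cos /det_sin /log_det /phase /= expR0 addr0 cosDpihalf.
  rewrite ?(mulr0, mul1r, subr0, add0r, addr0) -/(rowof u) [2^-1 * _]mulrC.
  ring.
apply: le_trans (HC kappa x t e (- (pi / 2)) 0 t0 e0).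
rewrite le_eqVlt; apply/orP; left; apply/eqP; congr (`|_|); apply: eq_Rintegral => u _ /=.
rewrite /cexp /cpowR /det_cos /det_sin /log_det /phase /= expR0 addr0 cosBpihalf.
rewrite ?(mulr0, mul1r, subr0, add0r, addr0) -/(rowof u) [2^-1 * _]mulrC.
ring.
Qed.

End conclusion.

Local Open Scope complex_scope.

Lemma cutoff_Re_Im (R : realType) (chi : R -> R[i]) : cutoff chi ->
  [/\ smooth (fun s => complex.Re (chi s)), smooth (fun s => complex.Im (chi s)),
      forall s, 1 <= `|s| -> chi s = 0 & forall s, `|s| < 2^-1 -> chi s = 1].
Proof.
move=> [[sr si _ supp] one]; split => // s s1; last first.
  by apply: one; rewrite -ltr_norml.
apply/eqP; apply: contraTT s1 => cs0; rewrite -ltNge ltr_norml.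
by have /supp := subset_closure (cs0 : [set s | chi s != 0] s); rewrite /= in_itv.
Qed.

Theorem proposition3p8 (R : realType) (chi : R -> R[i]) (hchi : cutoff chi)
  (d : nat) (hd : (1 <= d)%N)
  (alpha : R) (halpha0 : alpha != 0) (halpha1 : alpha != 1)
  (phi : 'rV[R]_d -> R) (hphi : almost_homogeneous alpha phi) :
  exists C N : R, 0 < N /\
    forall (eps kappa : R) (x : 'rV[R]_d) (t : R), 0 < eps ->
      (* for t = 0 the right-hand sides are +oo *)
      t != 0 ->
      (0 < alpha ->
        Normc.normc (I_plus chi phi eps kappa x t)
          <= C * (1 + `|kappa|) `^ N * `|t| `^ (- (d%:R / 2))) /\
      (alpha < 0 ->
        Normc.normc (I_minus chi phi eps kappa x t)
          <= C * (1 + `|kappa|) `^ N * `|t| `^ (- (d%:R / 2))).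
Proof.
have [smooth_re smooth_im out inn] := cutoff_Re_Im hchi.
pose re s := complex.Re (chi s); pose im s := complex.Im (chi s).
have re_out s : 1 <= `|s| -> re s = 0 by move=> /out; rewrite /re => ->.
have im_out s : 1 <= `|s| -> im s = 0 by move=> /out; rewrite /im => ->.
have re_in s : `|s| < 2^-1 -> re s = 1 by move=> /inn; rewrite /re => ->.
have im_in s : `|s| < 2^-1 -> im s = 0 by move=> /inn; rewrite /im => ->.
have dpos : 0 < d%:R :> R by rewrite ltr0n.
have [al|al] := ltP 0 alpha.
  have sup : (0 < alpha /\ 0 = 0 :> R) \/ (alpha < 0 /\ forall s, `|s| < 2^-1 -> 0 + 1 * re s = 0) by left.
  have sup' : (0 < alpha /\ 0 = 0 :> R) \/ (alpha < 0 /\ forall s, `|s| < 2^-1 -> 0 + 1 * im s = 0) by left.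
  have [C C0 HC] := oscillatory_bound hphi halpha0 halpha1 hd smooth_re re_out re_in
    smooth_re re_out smooth_im im_out sup sup'.
  exists C, d%:R; split=> // eps kappa x t e0 t0; split=> [_|]; last by move=> /(lt_trans al); rewrite ltxx.
  have := HC kappa x t eps t0 e0; rewrite /I_plus.
  set f := fun xi => _; set f' := fun xi => _.
  rewrite (_ : f = f')//; apply/funext => xi; rewrite /f /f' /radial_cutoff !add0r !mul1r.
  by rewrite /re /im; case: (chi _).
have {}al : alpha < 0 by rewrite lt_neqAle halpha0.
have sup : (0 < alpha /\ 1 = 0 :> R) \/ (alpha < 0 /\ forall s, `|s| < 2^-1 -> 1 + -1 * re s = 0).
  by right; split => // s /re_in ->; rewrite mulr1 subrr.
have sup' : (0 < alpha /\ 0 = 0 :> R) \/ (alpha < 0 /\ forall s, `|s| < 2^-1 -> 0 + -1 * im s = 0).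
  by right; split => // s /im_in ->; rewrite mulr0 addr0.
have [C C0 HC] := oscillatory_bound hphi halpha0 halpha1 hd smooth_re re_out re_in
  smooth_re re_out smooth_im im_out sup sup'.
exists C, d%:R; split=> // eps kappa x t e0 t0; split=> // _.
have e1 : 0 < eps^-1 by rewrite invr_gt0.
have := HC kappa x t eps^-1 t0 e1; rewrite /I_minus.
set f := fun xi => _; set f' := fun xi => _.
rewrite (_ : f = f')//; apply/funext => xi; rewrite /f /f' /radial_cutoff /chi_infty add0r !mulN1r.
by rewrite /re /im; case: (chi _) => a b; congr (_ * _ * _); congr Complex; rewrite /= ?add0r ?sub0r.
Qed.
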